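(* Let $g>0$, $\mu>0$, let $\bar\rho=\bar\rho(x_3)\in L^\infty(\mathbb{R})$ satisfy $\bar\rho'\in C_0^\infty(\mathbb{R})$, $\inf_{\mathbb{R}}\bar\rho>0$ and $\bar\rho'(x_3^0)>0$ for some $x_3^0$, and let $M$, $\mathcal A$, $\mathbb{A}^{\mathrm g}$ be as in the context. For each $\xi\in\mathbb{A}^{\mathrm g}$ there exist $\psi=\psi(\xi,x_3)\not\equiv0$ and $\lambda=\lambda(\xi)>0$ satisfying $$-\lambda^2[\bar\rho|\xi|^2\psi-(\bar\rho\psi')']=\lambda\mu(|\xi|^4\psi-2|\xi|^2\psi''+\psi'''')-g|\xi|^2\bar\rho'\psi+\begin{cases}M^2\xi_1^2(|\xi|^2\psi-\psi'')&\text{(horizontal case)}\\ M^2(\psi''''-|\xi|^2\psi'')&\text{(vertical case)}\end{cases}$$ on $\mathbb{R}$ and $\psi(\pm\infty)=\psi'(\pm\infty)=0$. Moreover $\psi\in H^\infty(\mathbb{R})\cap\mathcal A$, where $H^\infty(\mathbb{R})=\bigcap_{k\ge0}H^k(\mathbb{R})$.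
   Context: Functions $\psi$ are real-valued functions of $x_3\in\mathbb{R}$, $'=d/dx_3$, $\xi=(\xi_1,\xi_2)$. $M_{\mathrm c}:=\sqrt{\sup_{\psi\in H^1(\mathbb{R}),\psi\not\equiv0}\int g\bar\rho'\psi^2dx_3/\int|\psi'|^2dx_3}\in(0,\infty]$. Horizontal case: $M\neq0$ constant; for $0<|M\xi_1|/|\xi|<M_{\mathrm c}$, $S(\xi):=\sqrt{\sup_{\psi\in H^1,\psi\not\equiv0}(g|\xi|^2\int\bar\rho'\psi^2/(M\xi_1)^2-\int|\psi'|^2)/\int|\psi|^2}$; $\mathbb{A}^{\mathrm g}:=(\{\xi:|\xi_1M|/|\xi|\in(0,M_{\mathrm c}),|\xi|<S(\xi)\}\cup\{\xi_1=0\})\setminus\{\mathbf 0\}$. Vertical case: $M$ constant with $|M|\in(0,M_{\mathrm c})$; $\mathcal M_{\mathrm{vc}}:=\{\psi\in H^2:\int(g\bar\rho'\psi^2-M^2|\psi'|^2)>0\}$; $|\xi|^M_{\mathrm{vc}}:=\sqrt{\inf_{\psi\in\mathcal M_{\mathrm{vc}}}M^2\int|\psi''|^2/\int(g\bar\rho'\psi^2-M^2|\psi'|^2)}$; $\mathbb{A}^{\mathrm g}:=\{\xi:|\xi|>|\xi|^M_{\mathrm{vc}}\}$. In both cases $\mathcal A:=\{\psi\in H^2(\mathbb{R}):\int_{\mathbb{R}}\bar\rho(|\xi|^2\psi^2+|\psi'|^2)dx_3=1\}$. *)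

(* Defs.v *)
From HB Require Import structures.
From mathcomp Require Import all_boot all_order all_algebra.
From mathcomp Require Import all_classical all_reals all_analysis.
Set Implicit Arguments. Unset Strict Implicit. Unset Printing Implicit Defensive.
Import Order.TTheory GRing.Theory Num.Theory.
Import numFieldNormedType.Exports.
Local Open Scope classical_set_scope.
Local Open Scope ring_scope.

Section Defs.
Variable R : realType.
Local Notation mu := (@lebesgue_measure R).

Definition Rint (f : R -> R) : R := fine (\int[mu]_x (f x)%:E)%E.

Definition smooth (f : R -> R) : Prop :=
  forall (n : nat) (x : R), derivable (derive1n n f) x 1.

Definition test_fun (phi : R -> R) : Prop :=
  smooth phi /\ exists K : R, forall x, K < `|x| -> phi x = 0.

Definition L2 (f : R -> R) : Prop :=
  measurable_fun setT f /\ (\int[mu]_x ((f x) ^+ 2)%:E < +oo)%E.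

Definition weak_deriv (k : nat) (psi w : R -> R) : Prop :=
  forall phi, test_fun phi ->
    (\int[mu]_x (psi x * derive1n k phi x)%:E
     = \int[mu]_x ((-1) ^+ k * w x * phi x)%:E)%E.

Definition Hk (k : nat) (psi : R -> R) : Prop :=
  L2 psi /\ forall j : nat, (j <= k)%N -> exists w, L2 w /\ weak_deriv j psi w.

Definition nonzero (psi : R -> R) : Prop := ~ {ae mu, forall x, psi x = 0}.

Definition esqrt (x : \bar R) : \bar R :=
  match x with
  | r%:E => (Num.sqrt r)%:E
  | +oo%E => +oo%E
  | -oo%E => 0%E
  end.

Definition xinorm (xi1 xi2 : R) : R := Num.sqrt (xi1 ^+ 2 + xi2 ^+ 2).

Definition Mc (g : R) (rho : R -> R) : \bar R :=
  esqrt (ereal_sup [set r | exists psi w,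
     [/\ Hk 1 psi, L2 w, weak_deriv 1 psi w, nonzero psi &
      r = (Rint (fun x => g * derive1 rho x * psi x ^+ 2)
           / Rint (fun x => w x ^+ 2))%:E]]).

Definition Sxi (g : R) (rho : R -> R) (M xi1 xi2 : R) : \bar R :=
  esqrt (ereal_sup [set r | exists psi w,
     [/\ Hk 1 psi, L2 w, weak_deriv 1 psi w, nonzero psi &
      r = ((g * xinorm xi1 xi2 ^+ 2 * Rint (fun x => derive1 rho x * psi x ^+ 2)
              / (M * xi1) ^+ 2 - Rint (fun x => w x ^+ 2))
           / Rint (fun x => psi x ^+ 2))%:E]]).

Definition xi_vc (g : R) (rho : R -> R) (M : R) : \bar R :=
  esqrt (ereal_inf [set r | exists psi w1 w2,
     [/\ Hk 2 psi, L2 w1 /\ L2 w2, weak_deriv 1 psi w1 /\ weak_deriv 2 psi w2,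
      0 < Rint (fun x => g * derive1 rho x * psi x ^+ 2 - M ^+ 2 * w1 x ^+ 2) &
      r = (M ^+ 2 * Rint (fun x => w2 x ^+ 2)
           / Rint (fun x => g * derive1 rho x * psi x ^+ 2 - M ^+ 2 * w1 x ^+ 2))%:E]]).

Inductive field_case := Horizontal | Vertical.

Definition Ag (c : field_case) (g : R) (rho : R -> R) (M xi1 xi2 : R) : Prop :=
  match c with
  | Horizontal =>
      ((0 < `|xi1 * M| / xinorm xi1 xi2 /\ ((`|xi1 * M| / xinorm xi1 xi2)%:E < Mc g rho)%E
        /\ ((xinorm xi1 xi2)%:E < Sxi g rho M xi1 xi2)%E)
       \/ xi1 = 0)
      /\ (xi1, xi2) <> (0, 0)
  | Vertical => (xi_vc g rho M < (xinorm xi1 xi2)%:E)%E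
  end.

Definition in_calA (rho : R -> R) (xi1 xi2 : R) (psi : R -> R) : Prop :=
  Hk 2 psi /\ exists w, L2 w /\ weak_deriv 1 psi w /\
    Rint (fun x => rho x * (xinorm xi1 xi2 ^+ 2 * psi x ^+ 2 + w x ^+ 2)) = 1.

Definition mag_term (c : field_case) (M xi1 xi2 : R) (psi : R -> R) (x : R) : R :=
  match c with
  | Horizontal => M ^+ 2 * xi1 ^+ 2 *
                  (xinorm xi1 xi2 ^+ 2 * psi x - derive1n 2 psi x)
  | Vertical => M ^+ 2 * (derive1n 4 psi x - xinorm xi1 xi2 ^+ 2 * derive1n 2 psi x)
  end.

Definition M_hyp (c : field_case) (g : R) (rho : R -> R) (M : R) : Prop :=
  match c with
  | Horizontal => M <> 0
  | Vertical => 0 < `|M| /\ ((`|M|)%:E < Mc g rho)%E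
  end.

End Defs.

(* Main.v *)
(** Write a = |xi|.  For fixed lambda > 0 the equation reads
    c psi'''' - (p psi')' + r psi = 0, the Euler-Lagrange equation of the form
    Q_lambda(u) = int c u''^2 + p u'^2 + r u^2, where only the summand
    - g a^2 rho' of r is not nonnegative.  Membership of xi in A^g provides a weak
    function on which Q_0 is negative, and mollifying it gives a C^2 one.  Since
    Q_lambda increases with lambda and is nonnegative for large lambda, there is a
    critical lambda > 0 at which Q_lambda >= 0 and inf Q_lambda = 0 on the unit
    sphere of H^2.  A minimising sequence u_n is bounded in H^2, hence converges
    pointwise along a subsequence to some psi, and psi <> 0 because rho' has
    compact support while the rest of Q_lambda is coercive.  By Cauchy-Schwarz for
    the semidefinite form, Q_lambda(u_n, phi) -> 0 for every test function phi, so
    psi is a weak solution.  Du Bois-Reymond's lemma makes psi smooth, duality puts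
    psi and psi'' in L^2, interpolation gives psi' in L^2, and the equation itself
    controls all the higher derivatives. *)

Require Import Defs.
From HB Require Import structures.
From mathcomp Require Import all_boot all_order all_algebra.
From mathcomp Require Import all_classical all_reals all_analysis.
From mathcomp Require Import measurable_realfun ring lra.
Import Order.TTheory GRing.Theory Num.Theory.
Import numFieldNormedType.Exports.
Local Open Scope classical_set_scope.
Local Open Scope ring_scope.

(** * Square integrable functions *)

Section Integrals.
Set Implicit Arguments. Unset Strict Implicit. Unset Printing Implicit Defensive.
Variable R : realType.
Local Notation Rint := Defs.Rint.
Local Notation mu := (@lebesgue_measure R).
Implicit Types f g h : R -> R.

(** The parameter enters both as lambda^2 and, through viscosity, as lambda, so it is not the value
    of a Rayleigh quotient; freezing it turns the problem into locating the zero of a monotone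
    function. Neither weak compactness nor completeness of H^2 is used: the minimising sequence
    consists of C^2 functions, its bounds on u and u' give uniform Lipschitz control, and pointwise
    limits suffice once every derivative has been moved to the test function. The price is that the
    limit is at first merely Lipschitz, so the square integrability of psi and psi'' has to be
    encoded as bounds on pairings with test functions, which survive pointwise limits. The two field
    geometries are treated together: their magnetic terms are the cases (Mh, Mv) = (M^2 xi1^2, 0)
    and (0, M^2) of one expression. In the horizontal case viscosity alone makes the fourth order
    coefficient lambda mu + Mv positive. *)

Definition intble f := mu.-integrable setT (EFin \o f).

Lemma RintE f : Rint f = Rintegral mu setT f.
Proof. by []. Qed.

Lemma eq_Rint f g : (forall x, f x = g x) -> Rint f = Rint g.
Proof. by move=> fg; congr Rint; apply/funext. Qed.

Lemma intble_measurable f : intble f -> measurable_fun setT f.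
Proof. by case/integrableP => /measurable_EFinP. Qed.

Lemma intbleD f g : intble f -> intble g -> intble (fun x => f x + g x).
Proof. by move=> fi gi; exact: (integrableD measurableT fi gi). Qed.

Lemma intbleZ k f : intble f -> intble (fun x => k * f x).
Proof.
move=> fi; have := @integrableZl _ _ _ mu _ measurableT k _ fi.
by apply: eq_integrable => //= x _; rewrite EFinM.
Qed.

Lemma intbleN f : intble f -> intble (fun x => - f x).
Proof. by move=> fi; exact: (integrableN fi). Qed.

Lemma intbleB f g : intble f -> intble g -> intble (fun x => f x - g x).
Proof. by move=> fi gi; apply: intbleD => //; apply: intbleN. Qed.

Lemma le_intble f g : measurable_fun setT f -> (forall x, `|f x| <= g x) ->
  intble g -> intble f.
Proof.
move=> mf fg gi; apply: (le_integrable measurableT _ _ gi).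
  exact/measurable_EFinP.
by move=> x _ /=; rewrite lee_fin (le_trans (fg x))// ler_norm.
Qed.

Lemma RintD f g : intble f -> intble g ->
  Rint (fun x => f x + g x) = Rint f + Rint g.
Proof. by move=> fi gi; rewrite RintE (RintegralD measurableT fi gi). Qed.

Lemma RintB f g : intble f -> intble g ->
  Rint (fun x => f x - g x) = Rint f - Rint g.
Proof. by move=> fi gi; rewrite RintE (RintegralB measurableT fi gi). Qed.

Lemma RintZ k f : intble f -> Rint (fun x => k * f x) = k * Rint f.
Proof. by move=> fi; rewrite RintE RintegralZl. Qed.

Lemma RintN f : intble f -> Rint (fun x => - f x) = - Rint f.
Proof.
by move=> fi; rewrite -mulN1r -RintZ//; apply: eq_Rint => x; rewrite mulN1r.
Qed.

Lemma le_Rint f g : intble f -> intble g -> (forall x, f x <= g x) ->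
  Rint f <= Rint g.
Proof.
by move=> fi gi fg; rewrite !RintE; apply: (le_Rintegral measurableT fi gi).
Qed.

Lemma Rint_ge0 f : (forall x, 0 <= f x) -> 0 <= Rint f.
Proof. by move=> f0; rewrite RintE; apply: Rintegral_ge0. Qed.

Lemma le_norm_Rint f : intble f -> `|Rint f| <= Rint (fun x => `|f x|).
Proof. by move=> fi; rewrite !RintE; apply: le_normr_Rintegral. Qed.

Lemma Rint_EFin f : intble f -> (\int[mu]_x (f x)%:E)%E = (Rint f)%:E.
Proof. by move=> fi; rewrite /Rint fineK//; exact: integrable_fin_num. Qed.

Lemma intble_abs f : intble f -> intble (fun x => `|f x|).
Proof. exact: integrable_norm. Qed.

Lemma Rint_zero : Rint (fun=> 0 : R) = 0.
Proof. by rewrite RintE /Rintegral integral0. Qed.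

Lemma L2_sqr f : L2 f -> intble (fun x => f x ^+ 2).
Proof.
move=> [mf fi]; apply/integrableP; split.
  by apply/measurable_EFinP; exact: measurable_funX.
rewrite [ltLHS](_ : _ = (\int[mu]_x (f x ^+ 2)%:E)%E)//.
by apply: eq_integral => x _ /=; rewrite ger0_norm// sqr_ge0.
Qed.

Lemma L2P f : L2 f <-> measurable_fun setT f /\ intble (fun x => f x ^+ 2).
Proof.
split=> [fL|[mf fi]]; first by split; [case: fL|exact: L2_sqr].
by split=> //; rewrite Rint_EFin// ltry.
Qed.

Lemma L2_mul f g : L2 f -> L2 g -> intble (fun x => f x * g x).
Proof.
move=> fL gL; apply: (le_intble _ (g := fun x => f x ^+ 2 + g x ^+ 2)).
- by apply: measurable_funM; [case: fL|case: gL].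
- move=> x; rewrite normrM -(real_normK (num_real (f x))).
  rewrite -(real_normK (num_real (g x))).
  by have := sqr_ge0 (`|f x| - `|g x|); have := sqr_ge0 (`|f x| + `|g x|); nra.
- by apply: intbleD; exact: L2_sqr.
Qed.

Lemma L2D f g : L2 f -> L2 g -> L2 (fun x => f x + g x).
Proof.
move=> fL gL; apply/L2P; split.
  by apply: measurable_funD; [case: fL|case: gL].
have -> : (fun x => (f x + g x) ^+ 2) =
    fun x => (f x ^+ 2 + g x ^+ 2) + 2 * (f x * g x).
  by apply/funext => x; ring.
apply: intbleD; last by apply: intbleZ; exact: L2_mul.
by apply: intbleD; exact: L2_sqr.
Qed.

Lemma intble_mulb f h (C : R) : measurable_fun setT h ->
  (forall x, `|h x| <= C) -> intble f -> intble (fun x => h x * f x).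
Proof.
move=> mh hC fi; apply: (le_intble _ (g := fun x => C * `|f x|)).
- by apply: measurable_funM => //; exact: intble_measurable.
- by move=> x; rewrite normrM ler_wpM2r.
- by apply: intbleZ; exact: intble_abs.
Qed.

Lemma L2_mulb f h (C : R) : measurable_fun setT h ->
  (forall x, `|h x| <= C) -> L2 f -> L2 (fun x => h x * f x).
Proof.
move=> mh hC /L2P[mf fi]; apply/L2P; split; first exact: measurable_funM.
have -> : (fun x => (h x * f x) ^+ 2) = fun x => h x ^+ 2 * f x ^+ 2.
  by apply/funext => x; rewrite exprMn.
apply: (@intble_mulb _ _ (C ^+ 2)) => //; first exact: measurable_funX.
move=> x; rewrite normrX lerXn2r ?nnegrE//.
by rewrite (le_trans _ (hC x)).
Qed.

Lemma L2Z k f : L2 f -> L2 (fun x => k * f x).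
Proof. by move=> fL; apply: (@L2_mulb _ (cst k) `|k|). Qed.

Lemma L2N f : L2 f -> L2 (fun x => - f x).
Proof.
move=> fL; have := L2Z (-1) fL; congr L2.
by apply/funext => x; rewrite mulN1r.
Qed.

(** The discriminant of a nonnegative quadratic in [t], degenerate case included. It serves the L^2
    inequality, the semidefinite form [qform] and the weighted inequality for [corr]. *)
Lemma quadratic_CS (a b c : R) : 0 <= a -> 0 <= c ->
  (forall t, 0 <= a + 2 * t * b + t ^+ 2 * c) -> b ^+ 2 <= a * c.
Proof.
move=> a0 c0 H; have [c1|c1] := ltP 0 c; last first.
  have c2 : c = 0 by apply/eqP; rewrite eq_le c0 c1.
  subst c; rewrite mulr0.
  have [->|bn] := eqVneq b 0; first by rewrite expr0n.
  (* With [c] equal to 0 this [t] would give the value -1. *)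
  have := H (- (a + 1) / (2 * b)); rewrite mulr0 addr0.
  have -> : 2 * (- (a + 1) / (2 * b)) * b = - (a + 1).
    by field.
  lra.
(* The minimum of the parabola. *)
have := H (- b / c).
have -> : a + 2 * (- b / c) * b + (- b / c) ^+ 2 * c = (a * c - b ^+ 2) / c.
  by field; rewrite gt_eqF.
by rewrite pmulr_lge0 ?invr_gt0// subr_ge0.
Qed.

Lemma Rint_CS f g : L2 f -> L2 g ->
  Rint (fun x => f x * g x) ^+ 2 <=
  Rint (fun x => f x ^+ 2) * Rint (fun x => g x ^+ 2).
Proof.
move=> fL gL; apply: quadratic_CS; try by apply: Rint_ge0 => x; exact: sqr_ge0.
move=> t; have fg := L2_mul fL gL; have f2 := L2_sqr fL; have g2 := L2_sqr gL.
rewrite -!RintZ//; rewrite -RintD//; last exact: intbleZ.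
rewrite -RintD//; last 2 first.
- by apply: intbleD => //; exact: intbleZ.
- exact: intbleZ.
by apply: Rint_ge0 => x; have := sqr_ge0 (f x + t * g x); nra.
Qed.

End Integrals.

(** * Smooth functions and a smooth bump *)

Section Smooth.
Set Implicit Arguments. Unset Strict Implicit. Unset Printing Implicit Defensive.
Variable R : realType.
Implicit Types f g h : R -> R.

Definition isder f f' := forall x : R, is_derive x (1 : R) f (f' x).

Lemma isd_eq f (x a b : R) : is_derive x (1:R) f a -> a = b ->
  is_derive x (1:R) f b.
Proof. by move=> + <-. Qed.

Lemma isdD f g (x a b : R) : is_derive x (1:R) f a -> is_derive x (1:R) g b ->
  is_derive x (1:R) (fun y => f y + g y) (a + b).
Proof. exact: is_deriveD. Qed.

Lemma isdN f (x a : R) : is_derive x (1:R) f a ->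
  is_derive x (1:R) (fun y => - f y) (- a).
Proof. exact: is_deriveN. Qed.

Lemma isdB f g (x a b : R) : is_derive x (1:R) f a -> is_derive x (1:R) g b ->
  is_derive x (1:R) (fun y => f y - g y) (a - b).
Proof. exact: is_deriveB. Qed.

Lemma isdM f g (x a b : R) : is_derive x (1:R) f a -> is_derive x (1:R) g b ->
  is_derive x (1:R) (fun y => f y * g y) (a * g x + f x * b).
Proof.
move=> fa gb; apply: isd_eq (is_deriveM fa gb) _.
by rewrite /GRing.scale/= addrC mulrC [RHS]addrC addrC mulrC [_ * a]mulrC.
Qed.

Lemma isdZ k f (x a : R) : is_derive x (1:R) f a ->
  is_derive x (1:R) (fun y => k * f y) (k * a).
Proof. exact: is_deriveZ. Qed.

Lemma isdX n f (x a : R) : is_derive x (1:R) f a ->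
  is_derive x (1:R) (fun y => f y ^+ n) (n%:R * f x ^+ n.-1 * a).
Proof.
move=> fa; elim: n => [|n IH].
  by rewrite !mul0r; exact: is_derive_cst.
under eq_fun do rewrite exprS.
apply: isd_eq (isdM fa IH) _; case: n {IH} => [|n] /=.
  by rewrite expr0 !mulr1 !mul0r mulr0 addr0 mul1r.
by rewrite exprS -[n.+2%:R]natr1; ring.
Qed.

Lemma isd_comp f g (x a b : R) : is_derive (g x) (1:R) f a ->
  is_derive x (1:R) g b -> is_derive x (1:R) (fun y => f (g y)) (a * b).
Proof. by move=> fa gb; exact: is_derive1_comp. Qed.

Lemma isd_affine (k c x : R) : is_derive x (1:R) (fun y => k * y + c) k.
Proof.
apply: isd_eq (isdD (isdZ k (is_derive_id x 1)) (is_derive_cst c x 1)) _.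
by rewrite mulr1 addr0.
Qed.

Lemma isd_aff_comp f (k c x a : R) : is_derive (k * x + c) (1:R) f a ->
  is_derive x (1:R) (fun y => f (k * y + c)) (k * a).
Proof.
by move=> fa; rewrite mulrC; apply: isd_comp => //; exact: isd_affine.
Qed.

Lemma isd_shift f (c x a : R) : is_derive (x + c) (1:R) f a ->
  is_derive x (1:R) (fun y => f (y + c)) a.
Proof.
move=> fa; have := @isd_aff_comp f 1 c x a; rewrite !mul1r => /(_ fa).
by under eq_fun do rewrite mul1r.
Qed.

Lemma isder_derive1 f f' : isder f f' -> derive1 f = f'.
Proof.
by move=> ff'; apply/funext => x; rewrite derive1E; have [_] := ff' x.
Qed.

Lemma isder_derivable f f' x : isder f f' -> derivable f x 1.
Proof. by move=> /(_ x)[]. Qed.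

Lemma derivable_isder f : (forall x, derivable f x 1) -> isder f (derive1 f).
Proof. by move=> df x; apply: DeriveDef => //; rewrite derive1E. Qed.

Lemma isd_continuous f (x a : R) : is_derive x (1:R) f a -> {for x, continuous f}.
Proof.
by move=> [fx _]; exact/differentiable_continuous/derivable1_diffP.
Qed.

Lemma isder_continuous f f' : isder f f' -> continuous f.
Proof. by move=> ff' x; exact: isd_continuous (ff' x). Qed.

Lemma continuous_meas f : continuous f -> measurable_fun setT f.
Proof. by move=> cf; exact: continuous_measurable_fun. Qed.

Lemma derive1n_Sr n f : derive1n n.+1 f = derive1n n (derive1 f).
Proof. by rewrite /derive1n iterSr. Qed.

Lemma smooth_isder f : smooth f -> isder f (derive1 f).
Proof. by move=> sf; apply: derivable_isder => x; exact: (sf 0%N). Qed.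

Lemma smooth_derive1 f : smooth f -> smooth (derive1 f).
Proof. by move=> sf n x; rewrite -derive1n_Sr; exact: sf. Qed.

Lemma smooth_derive1n f n : smooth f -> smooth (derive1n n f).
Proof.
by move=> sf; elim: n => [//|n IH]; rewrite derive1nS; exact: smooth_derive1.
Qed.

Lemma smooth_continuous f : smooth f -> continuous f.
Proof. by move=> /smooth_isder /isder_continuous. Qed.

(** Coinduction: a class closed under differentiation contains only smooth functions. It replaces
    explicit formulas for derivatives of order n of products and compositions. *)
Lemma smooth_coind (P : (R -> R) -> Prop) :
  (forall f, P f -> exists2 f', isder f f' & P f') -> forall f, P f -> smooth f.
Proof.
move=> HP f Pf; have PD g : P g -> P (derive1 g).
  by move=> /HP[g' gg' Pg']; rewrite (isder_derive1 gg').
have Pn n : P (derive1n n f) by elim: n => [//|n IH]; rewrite derive1nS; exact: PD.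
by move=> n x; have [f' ff' _] := HP _ (Pn n); exact: isder_derivable ff'.
Qed.

(* If the derivatives of [G] lie in this algebra, then it is stable under
   differentiation, so that all its elements are smooth. *)
Inductive gen (G : (R -> R) -> Prop) : (R -> R) -> Prop :=
| gen_smooth f : smooth f -> gen G f
| gen_base f : G f -> gen G f
| gen_add f g : gen G f -> gen G g -> gen G (fun x => f x + g x)
| gen_mul f g : gen G f -> gen G g -> gen G (fun x => f x * g x).

Lemma gen_is_smooth (G : (R -> R) -> Prop) :
  (forall g, G g -> exists2 g', isder g g' & gen G g') ->
  forall f, gen G f -> smooth f.
Proof.
move=> HG; apply: smooth_coind => f; elim.
- move=> {}f sf; exists (derive1 f); first exact: smooth_isder.
  by apply: gen_smooth; exact: smooth_derive1.
- by move=> {}f /HG.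
- move=> {}f g _ [f' ff' Pf'] _ [g' gg' Pg'].
  exists (fun x => f' x + g' x); first by move=> x; exact: isdD.
  exact: gen_add.
- move=> {}f g Pf [f' ff' Pf'] Pg [g' gg' Pg'].
  exists (fun x => f' x * g x + f x * g' x); first by move=> x; exact: isdM.
  by apply: gen_add; exact: gen_mul.
Qed.

Lemma smoothD f g : smooth f -> smooth g -> smooth (fun x => f x + g x).
Proof.
move=> sf sg; apply: (@gen_is_smooth (fun=> False)) => //.
by apply: gen_add; exact: gen_smooth.
Qed.

Lemma smoothM f g : smooth f -> smooth g -> smooth (fun x => f x * g x).
Proof.
move=> sf sg; apply: (@gen_is_smooth (fun=> False)) => //.
by apply: gen_mul; exact: gen_smooth.
Qed.

Lemma smooth_cst (k : R) : smooth (fun=> k).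
Proof.
apply: (@smooth_coind (fun f => exists c, f = fun=> c)); last by exists k.
move=> _ [c ->]; exists (fun=> 0); last by exists 0.
by move=> x; exact: is_derive_cst.
Qed.

Lemma smoothZ k f : smooth f -> smooth (fun x => k * f x).
Proof. by move=> sf; exact: smoothM (@smooth_cst k) sf. Qed.

Lemma smoothN f : smooth f -> smooth (fun x => - f x).
Proof.
move=> sf; have := @smoothZ (-1) _ sf.
by under eq_fun do rewrite mulN1r.
Qed.

Lemma smoothB f g : smooth f -> smooth g -> smooth (fun x => f x - g x).
Proof. by move=> sf sg; exact: smoothD sf (smoothN sg). Qed.

Lemma isder_smooth f f' : isder f f' -> smooth f' -> smooth f.
Proof.
move=> ff' sf'; apply: (@smooth_coind (fun h => h = f \/ smooth h)); last by left.
move=> h [->|sh]; first by exists f' => //; right.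
by exists (derive1 h); [exact: smooth_isder|right; exact: smooth_derive1].
Qed.

Lemma smooth_affine f (k c : R) : smooth f -> smooth (fun x => f (k * x + c)).
Proof.
move=> sf; apply: (@smooth_coind
  (fun h => exists l g, smooth g /\ h = fun x => l * g (k * x + c))); last first.
  by exists 1, f; split=> //; apply/funext => x; rewrite mul1r.
move=> _ [l [g [sg ->]]]; exists (fun x => l * (k * derive1 g (k * x + c))).
  by move=> x; apply: isdZ; apply: isd_aff_comp; exact: smooth_isder.
exists (l * k), (derive1 g); split; first exact: smooth_derive1.
by apply/funext => x; rewrite mulrA.
Qed.

Lemma derive1n_affine f (k c : R) n : smooth f ->
  derive1n n (fun x => f (k * x + c)) = fun x => k ^+ n * derive1n n f (k * x + c).
Proof.
move=> sf; elim: n => [|n IH]; first by apply/funext => x; rewrite expr0 mul1r.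
rewrite derive1nS IH; apply: isder_derive1 => x.
rewrite exprSr -mulrA; apply: isdZ; apply: isd_aff_comp.
exact/smooth_isder/smooth_derive1n.
Qed.

Lemma derive1nD f g n : smooth f -> smooth g ->
  derive1n n (fun x => f x + g x) = fun x => derive1n n f x + derive1n n g x.
Proof.
move=> sf sg; elim: n => [//|n IH]; rewrite derive1nS IH.
by apply: isder_derive1 => x; apply: isdD; exact/smooth_isder/smooth_derive1n.
Qed.

Lemma derive1nZ k f n : smooth f ->
  derive1n n (fun x => k * f x) = fun x => k * derive1n n f x.
Proof.
move=> sf; elim: n => [//|n IH]; rewrite derive1nS IH.
by apply: isder_derive1 => x; apply: isdZ; exact/smooth_isder/smooth_derive1n.
Qed.

(** The bound forces [f 0 = 0], and the difference quotient is then at most [C * |h|]. *)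
Lemma isd_flat f (C : R) : (forall h : R, `|f h| <= C * h ^+ 2) ->
  is_derive (0:R) (1:R) f 0.
Proof.
move=> fC; have f0 : f 0 = 0.
  by apply/eqP; rewrite -normr_le0 (le_trans (fC 0))// expr0n mulr0.
have lim0 : (h^-1 *: ((f \o shift 0) (h *: 1) - f 0)) @[h --> (0:R)^'] --> (0:R).
  apply/cvgr0Pnorm_lt => e e0.
  have C0 : 0 <= `|C| by [].
  near=> h.
  have hn0 : h != 0 by near: h; exact: nbhs_dnbhs_neq.
  rewrite /= f0 subr0 addr0 /GRing.scale/= mulr1 normrM normfV.
  rewrite ltr_pdivrMl ?normr_gt0// (le_lt_trans (fC h))//.
  rewrite (@le_lt_trans _ _ (`|h| * (`|C| * `|h|)))//.
    rewrite -(real_normK (num_real h)) expr2 mulrCA ler_wpM2l// ler_wpM2r//.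
    by rewrite ler_norm.
  rewrite ltr_pM2l ?normr_gt0// (@le_lt_trans _ _ ((`|C| + 1) * `|h|))//.
    by rewrite ler_wpM2r// lerDl.
  rewrite -ltr_pdivlMl ?ltr_wpDl//.
  near: h; apply: dnbhs0_lt; rewrite mulr_gt0// invr_gt0 ltr_wpDl//.
split; first by apply/cvg_ex; exists 0.
exact: (cvg_lim _ lim0).
Unshelve. all: by end_near. Qed.

(** [flat 0] is the usual exp(-1/x) extended by 0. The powers of 1/x are included so that the
    derivative of a member is a linear combination of members. *)
Definition flat (n : nat) (x : R) : R :=
  if 0 < x then x^-1 ^+ n * expR (- x^-1) else 0.

(** A single term of the exponential series gives (1/x)^(n+2) <= (n+2)! exp(1/x). The two extra
    powers provide the quadratic bound needed to differentiate at 0. *)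
Lemma flat_bound n x : `|flat n x| <= n.+2`!%:R * x ^+ 2.
Proof.
rewrite /flat; case: ifPn => [x0|_]; last by rewrite normr0 mulr_ge0// sqr_ge0.
have y0 : 0 < x^-1 by rewrite invr_gt0.
rewrite ger0_norm; last by rewrite mulr_ge0 ?expR_ge0 ?exprn_ge0// ltW.
rewrite expRN ler_pdivrMr ?expR_gt0//.
have := expR_ge1Dxn n.+1 (ltW y0); set E := expR _ => HE.
have fact0 : 0 < (n.+2`!%:R : R) by rewrite ltr0n fact_gt0.
have {HE} : x^-1 ^+ n.+2 <= n.+2`!%:R * E.
  rewrite -ler_pdivrMl// mulrC (le_trans _ HE)// lerDr ler01//.
rewrite -addn2 exprD => H.
have -> : x^-1 ^+ n = (x^-1 ^+ n * x^-1 ^+ 2) * x ^+ 2.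
  by field; rewrite gt_eqF.
by rewrite [leRHS]mulrAC ler_wpM2r ?sqr_ge0.
Qed.

Lemma isd_flat_fun n : isder (flat n) (fun x => flat n.+2 x - n%:R * flat n.+1 x).
Proof.
move=> x; cbv beta; have [x0|x0|->] := ltgtP x 0.
- have -> : flat n.+2 x - n%:R * flat n.+1 x = 0.
    by rewrite /flat ltNge (ltW x0)/= mulr0 subr0.
  apply: (@near_eq_is_derive _ _ _ (fun=> 0)).
  near=> y; rewrite /flat ltNge ltW//.
  by near: y; exact: lt_nbhsl.
- have xn0 : x != 0 by rewrite gt_eqF.
  refine (@near_eq_is_derive R R R (fun y : R => y^-1 ^+ n * expR (- y^-1)) _ _ _ _ _ _).
    near=> y; rewrite /flat ifT//.
    by near: y; exact: lt_nbhsr.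
  have dV : is_derive x (1:R) (fun y : R => y^-1) (- x^-1 ^+ 2).
    apply: isd_eq (is_deriveV _ (is_derive_id x 1)) _ => //=.
    by rewrite /GRing.scale/= mulr1 exprVn.
  have dX : is_derive x (1:R) (fun y : R => y^-1 ^+ n)
      (- (n%:R * x^-1 ^+ n.+1)).
    apply: isd_eq (isdX n dV) _.
    rewrite mulrN; congr (- _); case: (n) => [|m].
      by rewrite !mul0r.
    by rewrite -mulrA -exprD addn2.
  have dE := isd_comp (is_derive_expR _) (isdN dV).
  apply: isd_eq (isdM dX dE) _.
  rewrite /flat x0 opprK !exprSr; ring.
- have -> : flat n.+2 0 - n%:R * flat n.+1 0 = 0.
    by rewrite /flat ltxx mulr0 subr0.
  by apply: (@isd_flat _ (n.+2`!%:R)); exact: flat_bound.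
Unshelve. all: by end_near. Qed.

Lemma smooth_flat n : smooth (flat n).
Proof.
pose G f := exists m, f = flat m.
apply: (@gen_is_smooth G); last by apply: gen_base; exists n.
move=> _ [m ->]; eexists; first exact: isd_flat_fun.
have -> : (fun x => flat m.+2 x - m%:R * flat m.+1 x) =
    (fun x => flat m.+2 x + (- m%:R) * flat m.+1 x).
  by apply/funext => x; rewrite mulNr.
apply: gen_add; first by apply: gen_base; exists m.+2.
apply: gen_mul; first by apply: gen_smooth; exact: smooth_cst.
by apply: gen_base; exists m.+1.
Qed.

Lemma flat0_gt0 x : 0 < x -> 0 < flat 0 x.
Proof. by move=> x0; rewrite /flat x0 expr0 mul1r expR_gt0. Qed.

Lemma flat0_ge0 x : 0 <= flat 0 x.
Proof.
by rewrite /flat; case: ifP => // _; rewrite expr0 mul1r expR_ge0.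
Qed.

Lemma flat0_le1 x : flat 0 x <= 1.
Proof.
rewrite /flat; case: ifPn => // x0; rewrite expr0 mul1r.
by rewrite expR_le1 oppr_le0 invr_ge0 ltW.
Qed.

Definition hat (x : R) : R := flat 0 (1 + x) * flat 0 (1 - x).

Lemma smooth_hat : smooth hat.
Proof.
apply: smoothM.
  have := @smooth_affine _ 1 1 (@smooth_flat 0).
  by under eq_fun do rewrite mul1r addrC.
have := @smooth_affine _ (-1) 1 (@smooth_flat 0).
by under eq_fun do rewrite mulN1r addrC.
Qed.

Lemma hat_ge0 x : 0 <= hat x.
Proof. by rewrite mulr_ge0// flat0_ge0. Qed.

Lemma hat_le1 x : hat x <= 1.
Proof. by rewrite mulr_ile1// ?flat0_ge0 ?flat0_le1. Qed.

Lemma hat_gt0 x : `|x| < 1 -> 0 < hat x.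
Proof. by rewrite ltr_norml => /andP[? ?]; rewrite mulr_gt0// flat0_gt0; lra. Qed.

Lemma hat_out x : 1 <= `|x| -> hat x = 0.
Proof.
rewrite /hat ler_normr => /orP[] x1.
  by rewrite /flat [0 < 1 - x]ltNge (_ : 1 - x <= 0) ?mulr0//; lra.
by rewrite /flat [0 < 1 + x]ltNge (_ : 1 + x <= 0) ?mul0r//; lra.
Qed.

Lemma test_hat : test_fun hat.
Proof.
split; first exact: smooth_hat.
by exists 1 => x /ltW; exact: hat_out.
Qed.

End Smooth.

(** * Integration by parts and antiderivatives *)

Section Calculus.
Set Implicit Arguments. Unset Strict Implicit. Unset Printing Implicit Defensive.
Variable R : realType.
Local Notation Rint := Defs.Rint.
Local Notation mu := (@lebesgue_measure R).
Implicit Types f g h : R -> R.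

Definition csupp f := exists K : R, forall x, K < `|x| -> f x = 0.

Lemma csuppP f : csupp f -> exists2 K : R, 0 < K & forall x, K < `|x| -> f x = 0.
Proof.
move=> [K HK]; exists (`|K| + 1); first by rewrite ltr_wpDl.
by move=> x Kx; apply: HK; rewrite (le_lt_trans _ Kx)// ler_wpDr// ler_norm.
Qed.

Lemma contM f g : continuous f -> continuous g -> continuous (fun x => f x * g x).
Proof. by move=> cf cg x; apply: continuousM; [exact: cf|exact: cg]. Qed.

Lemma contD f g : continuous f -> continuous g -> continuous (fun x => f x + g x).
Proof. by move=> cf cg x; apply: continuousD; [exact: cf|exact: cg]. Qed.

Lemma csuppMl f g : csupp f -> csupp (fun x => f x * g x).
Proof. by move=> [K HK]; exists K => x /HK ->; rewrite mul0r. Qed.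

Lemma csuppMr f g : csupp g -> csupp (fun x => f x * g x).
Proof. by move=> [K HK]; exists K => x /HK ->; rewrite mulr0. Qed.

Lemma csuppD f g : csupp f -> csupp g -> csupp (fun x => f x + g x).
Proof.
move=> [K HK] [L HL]; exists (Num.max K L) => x; rewrite gt_max => /andP[? ?].
by rewrite HK// HL// addr0.
Qed.

Lemma isder_supp K f f' : isder f f' -> (forall x, K < `|x| -> f x = 0) ->
  forall x, K < `|x| -> f' x = 0.
Proof.
move=> ff' HK x Kx.
have H : is_derive x (1:R) f 0.
  refine (@near_eq_is_derive R R R (fun=> 0) f x 1 0 _ (is_derive_cst 0 x 1)).
  have : \forall y \near x, K < `|y|.
    have /(_ x) := @norm_continuous R R^o.
    by move=> /cvgr_gt; apply.
  by apply: filterS => y /HK ->.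
by have [_ <-] := ff' x; have [_ <-] := H.
Qed.

Lemma csupp_isder f f' : isder f f' -> csupp f -> csupp f'.
Proof. by move=> ff' [K HK]; exists K; exact: isder_supp HK. Qed.

Lemma continuous_itv_integrable a b f : continuous f ->
  mu.-integrable `[a, b] (EFin \o f).
Proof.
move=> cf; apply: continuous_compact_integrable; first exact: segment_compact.
exact: continuous_subspaceT.
Qed.

Lemma restrict_supp K f : (forall x, K < `|x| -> f x = 0) ->
  f \_ `[- K, K] = f.
Proof.
move=> HK; apply/funext => x; rewrite patchE; case: ifPn => // /negP xK.
apply/esym/HK; rewrite ltNge; apply/negP => /ler_normlP[h1 h2]; apply: xK.
by rewrite inE/= in_itv/= h2 andbT lerNl.
Qed.

Lemma intble_csupp f : continuous f -> csupp f -> intble f.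
Proof.
move=> cf [K HK]; rewrite /intble -(restrict_supp HK) -restrict_EFin.
apply: (integrable_mkcond _ _).1 => //; exact: continuous_itv_integrable.
Qed.

Lemma Rint_supp K f : (forall x, K < `|x| -> f x = 0) ->
  Rint f = \int[mu]_(x in `[- K, K]) f x.
Proof. by move=> HK; rewrite Rintegral_mkcond (restrict_supp HK). Qed.

Lemma FTC2 F f a b : a < b -> isder F f -> continuous f ->
  \int[mu]_(x in `[a, b]) f x = F b - F a.
Proof.
move=> ab Ff cf; rewrite /Rintegral (@continuous_FTC2 _ f F a b ab)//.
- exact: continuous_subspaceT.
- have cF := isder_continuous Ff; split.
  + by move=> x _; exact: isder_derivable Ff.
  + exact/cvg_at_right_filter/cF.
  + exact/cvg_at_left_filter/cF.
- by move=> x _; rewrite (isder_derive1 Ff).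
Qed.

Lemma le_Rint_itv h a b : intble h -> (forall x, 0 <= h x) ->
  \int[mu]_(x in `[a, b]) h x <= Rint h.
Proof.
move=> hi h0; rewrite RintE Rintegral_mkcond; apply: le_Rintegral => //.
- rewrite -restrict_EFin; apply: (integrable_mkcond _ _).1 => //.
  exact: integrableS hi.
- by move=> x _; rewrite patchE; case: ifP => _ //; exact: h0.
Qed.

Lemma Rint_deriv0 F f : isder F f -> continuous f -> csupp F -> Rint f = 0.
Proof.
move=> Ff cf /csuppP[K K0 HK].
have Kf := isder_supp Ff HK.
(* The wider window puts its endpoints strictly outside the support of [F]. *)
have HK1 x : K + 1 < `|x| -> f x = 0 by move=> Kx; apply: Kf; lra.
rewrite (Rint_supp HK1) (FTC2 _ Ff cf); last lra.
by rewrite !HK ?subr0// ?normrN gtr0_norm; lra.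
Qed.

Lemma by_parts f f' g g' : isder f f' -> isder g g' ->
  continuous f' -> continuous g' -> csupp g ->
  Rint (fun x => f' x * g x) = - Rint (fun x => f x * g' x).
Proof.
move=> ff' gg' cf' cg' sg.
have cf := isder_continuous ff'; have cg := isder_continuous gg'.
have sg' := csupp_isder gg' sg.
have c1 : continuous (fun x => f' x * g x) by exact: contM.
have c2 : continuous (fun x => f x * g' x) by exact: contM.
apply/eqP; rewrite -subr_eq0 opprK -RintD; last 2 first.
- by apply: intble_csupp => //; exact: csuppMr.
- by apply: intble_csupp => //; exact: csuppMr.
apply/eqP; apply: (@Rint_deriv0 (fun x => f x * g x)).
- by move=> x; exact: isdM.
- exact: contD.
- exact: csuppMr.
Qed.

(** The fundamental theorem differentiates integrals over [[a, x]] with [a] to the left of [x], so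
    no single base point works on the whole line. Near each point the signed integral from 0 is
    rewritten, up to a constant, as an integral from a suitable [a]. *)
Lemma antiderivative f : continuous f -> exists F, isder F f.
Proof.
move=> cf.
pose F x := if 0 <= x then \int[mu]_(t in `[0, x]) f t
            else - \int[mu]_(t in `[x, 0]) f t.
have Iab a b : mu.-integrable `[a, b] (EFin \o f).
  exact: continuous_itv_integrable.
have chasles a x y : a <= x -> x <= y ->
    \int[mu]_(t in `[a, y]) f t =
    \int[mu]_(t in `[a, x]) f t + \int[mu]_(t in `[x, y]) f t.
  move=> ax xy; apply/eqP; rewrite -subr_eq; apply/eqP.
  rewrite addrC -(Rintegral_itv_obnd_cbnd (r := x)); last first.
    by apply: integrableS (Iab x y) => //; apply: subset_itvr; rewrite bnd_simp.
  rewrite -(@Rintegral_itvB _ f (BLeft a) (BRight y) x)//=.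
  by rewrite opprB subrK.
have FE a y : a < 0 -> a <= y ->
    F y = \int[mu]_(t in `[a, y]) f t - \int[mu]_(t in `[a, 0]) f t.
  move=> a0 ay; rewrite /F; case: ifPn => [y0|].
    by rewrite (@chasles a 0 y)// ?(ltW a0)// addrAC subrr add0r.
  rewrite -ltNge => /ltW y0; rewrite (@chasles a y 0)//.
  by rewrite opprD addrA subrr add0r.
exists F => x; clearbody F.
(* The base point has to lie to the left of both [x] and 0 for [FE] to apply. *)
pose a := Num.min x 0 - 1.
have [ax a0] : a < x /\ a < 0.
  by rewrite /a; have [|] := leP x 0; lra.
have xx1 : x < x + 1 by rewrite ltrDl.
have [d1 d2] := @continuous_FTC1_closed R f a x (x + 1) xx1 (Iab _ _) ax (cf x).
refine (@near_eq_is_derive R R R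
  (fun y => \int[mu]_(t in `[a, y]) f t - \int[mu]_(t in `[a, 0]) f t) F x 1 _ _ _).
  near=> y; rewrite (FE a)//.
  by apply: ltW; near: y; exact: lt_nbhsr.
apply: isd_eq (isdB (_ : is_derive x (1:R) _ (f x)) (is_derive_cst _ x 1)) _.
  by apply: DeriveDef; [exact: d1|rewrite -derive1E; exact: d2].
by rewrite subr0.
Unshelve. all: by end_near. Qed.

End Calculus.

(** * Test functions and distributions *)

Section Distributions.
Set Implicit Arguments. Unset Strict Implicit. Unset Printing Implicit Defensive.
Variable R : realType.
Local Notation Rint := Defs.Rint.
Local Notation mu := (@lebesgue_measure R).
Implicit Types f g h : R -> R.

Lemma test_smooth phi : test_fun phi -> @smooth R phi. Proof. by case. Qed.

Lemma test_csupp phi : @test_fun R phi -> csupp phi. Proof. by case. Qed.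

Lemma test_derive phi : @test_fun R phi -> test_fun (derive1 phi).
Proof.
move=> [sp cp]; split; first exact: smooth_derive1.
exact: csupp_isder (smooth_isder sp) cp.
Qed.

Lemma test_derive1n phi n : @test_fun R phi -> test_fun (derive1n n phi).
Proof.
by move=> tp; elim: n => [//|n IH]; rewrite derive1nS; exact: test_derive.
Qed.

Lemma test_mull f phi : smooth f -> test_fun phi -> test_fun (fun x => f x * phi x).
Proof.
by move=> sf [sp cp]; split; [exact: smoothM|exact: csuppMr].
Qed.

Lemma testD phi eta : @test_fun R phi -> test_fun eta ->
  test_fun (fun x => phi x + eta x).
Proof.
by move=> [sp cp] [se ce]; split; [exact: smoothD|exact: csuppD].
Qed.

Lemma testZ k phi : @test_fun R phi -> test_fun (fun x => k * phi x).
Proof. by apply: test_mull; exact: smooth_cst. Qed.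

Lemma test_affine phi (k c : R) : k != 0 -> test_fun phi ->
  test_fun (fun x => phi (k * x + c)).
Proof.
move=> k0 [sp [K HK]]; split; first exact: smooth_affine.
exists ((`|K| + `|c|) / `|k|) => x.
rewrite ltr_pdivrMr ?normr_gt0// => H; apply: HK.
have := lerB_normD (k * x) c; rewrite normrM.
have := ler_norm K; lra.
Qed.

Lemma test_continuous phi : @test_fun R phi -> continuous phi.
Proof. by move=> /test_smooth /smooth_continuous. Qed.

Lemma intble_test f phi : continuous f -> test_fun phi ->
  intble (fun x => f x * phi x).
Proof.
move=> cf tp; apply: intble_csupp; last exact: csuppMr (test_csupp tp).
exact: contM cf (test_continuous tp).
Qed.

Lemma intble_testT phi : @test_fun R phi -> intble phi.
Proof.
by move=> tp; apply: intble_csupp; [exact: test_continuous|exact: test_csupp].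
Qed.

Lemma L2_csupp f : continuous f -> csupp f -> L2 f.
Proof.
move=> cf sf; apply/L2P; split; first exact: continuous_meas.
by apply: intble_csupp; [exact: contM|exact: csuppMl].
Qed.

Lemma L2_test phi : @test_fun R phi -> L2 phi.
Proof.
by move=> tp; apply: L2_csupp; [exact: test_continuous|exact: test_csupp].
Qed.

Lemma Rint_gt0 g x0 : continuous g -> intble g -> (forall x, 0 <= g x) ->
  0 < g x0 -> 0 < Rint g.
Proof.
move=> cg gi g0 gx0.
have : \forall y \near x0, g x0 / 2 < g y.
  by have /cvgr_gt := cg x0; apply; lra.
move=> /nbhs_ballP[e/= e0 He].
have e2 : 0 < e / 2 by lra.
apply: (@lt_le_trans _ _ (\int[mu]_(x in `[x0 - e / 2, x0 + e / 2]) g x)); last first.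
  exact: le_Rint_itv.
apply: (@lt_le_trans _ _ (\int[mu]_(x in `[x0 - e / 2, x0 + e / 2]) (g x0 / 2))).
  rewrite Rintegral_cst//= lebesgue_measure_itv/= lte_fin ifT; last lra.
  rewrite -EFinB/=; apply: mulr_gt0; lra.
apply: le_Rintegral => //.
- exact: (@continuous_itv_integrable _ _ _ (cst _)) (@cst_continuous _ _ _).
- exact: continuous_itv_integrable.
- move=> x /=; rewrite in_itv/= => /andP[x1 x2]; apply/ltW/He.
  by rewrite /ball/= ltr_distl; apply/andP; split; lra.
Qed.

Lemma Rint_hat_gt0 : 0 < Rint (@hat R).
Proof.
apply: (@Rint_gt0 _ 0).
- exact: test_continuous (@test_hat R).
- exact: intble_testT (@test_hat R).
- exact: hat_ge0.
- by rewrite hat_gt0// normr0.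
Qed.

Lemma fundamental_lemma f : continuous f ->
  (forall phi, test_fun phi -> Rint (fun x => f x * phi x) = 0) -> forall x, f x = 0.
Proof.
move=> cf H.
have pos g x0 : continuous g ->
  (forall phi, test_fun phi -> Rint (fun x => g x * phi x) = 0) -> ~ 0 < g x0.
  move=> cg Hg gx0.
  have : \forall y \near x0, 0 < g y by have /cvgr_gt := cg x0; apply.
  move=> /nbhs_ballP[e/= e0 He].
  (* A bump supported in the ball of radius [e] about [x0], where [g] is positive. *)
  pose phi (x : R) : R := hat (e^-1 * x + - (e^-1 * x0)).
  have tphi : test_fun phi.
    by apply: test_affine; [rewrite invr_neq0// gt_eqF|exact: test_hat].
  have := Hg _ tphi; apply/eqP; rewrite gt_eqF//.
  have phi0 : 0 < phi x0 by rewrite /phi subrr hat_gt0// normr0.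
  apply: (@Rint_gt0 _ x0).
  - exact: contM (test_continuous tphi).
  - exact: intble_test.
  - move=> x; have [xe|xe] := ltP `|x0 - x| e.
      by rewrite mulr_ge0 ?hat_ge0// ltW//; exact: He.
    rewrite /phi hat_out ?mulr0// -mulrBr normrM gtr0_norm ?invr_gt0//.
    by rewrite distrC ler_pdivlMl// mulr1.
  - exact: mulr_gt0.
move=> x; apply/eqP; rewrite eq_le !leNgt; apply/andP; split; apply/negP.
  exact: pos.
rewrite -oppr_gt0; apply: (pos (fun x => - f x)).
  by move=> y; apply: continuousN; exact: cf.
move=> phi tp; rewrite -[RHS]oppr0 -(H _ tp) -RintN; last exact: intble_test.
by apply: eq_Rint => y; rewrite mulNr.
Qed.

(** An antiderivative is constant on each side of the support. Hence differences of rescaled,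
    shifted or reflected antiderivatives have compact support, which is how the changes of variables
    below are obtained from [Rint_deriv0]. *)
Lemma antiderivative_csupp f F K : isder F f -> continuous f ->
  (forall x, K < `|x| -> f x = 0) -> 0 < K ->
  forall x, (K + 1 <= x -> F x = F (K + 1)) /\ (x <= - (K + 1) -> F x = F (- (K + 1))).
Proof.
move=> Ff cf HK K0 x.
have cst_out a b : a < b -> (forall x, a <= x <= b -> f x = 0) -> F a = F b.
  move=> ab Hab; apply/esym/eqP; rewrite -subr_eq0; apply/eqP.
  rewrite -(FTC2 ab Ff cf) (@eq_Rintegral _ _ _ _ _ (cst 0)); last first.
    by move=> y; rewrite inE/= in_itv/= => /Hab.
  by rewrite Rintegral_cst// mul0r.
split; rewrite le_eqVlt => /predU1P[->//|xK].
  apply/esym/cst_out => // y /andP[y1 y2]; apply: HK; rewrite ger0_norm; lra.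
apply: cst_out => // y /andP[y1 y2]; apply: HK; rewrite ltr0_norm; lra.
Qed.

(** The two constant values of an antiderivative differ by the integral of [zeta]; when that
    vanishes, subtracting the common value leaves compact support. *)
Lemma test_antiderivative zeta : @test_fun R zeta -> Rint zeta = 0 ->
  exists2 theta, test_fun theta & isder theta zeta.
Proof.
move=> tz z0; have cz := test_continuous tz.
have [F Fz] := antiderivative cz.
have [K K0 HK] := csuppP (test_csupp tz).
have Fo := antiderivative_csupp Fz cz HK K0.
have FK : F (K + 1) = F (- (K + 1)).
  apply/eqP; rewrite -subr_eq0 -(FTC2 _ Fz cz); last lra.
  by rewrite -Rint_supp ?z0// => y Ky; apply: HK; lra.
pose theta (x : R) : R := F x - F (- (K + 1)).
have thz : isder theta zeta.
  move=> x; apply: isd_eq (isdB (Fz x) (is_derive_cst _ x 1)) _.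
  by rewrite subr0.
exists theta => //; split.
  by apply: isder_smooth thz _; case: tz.
exists (K + 1) => x Kx; rewrite /theta; have [x0|x0] := ltP x 0.
  by move: Kx; rewrite (ltr0_norm x0) => Kx; rewrite (Fo x).2 ?subrr//; lra.
move: Kx; rewrite (ger0_norm x0) => Kx.
by rewrite (Fo x).1 ?FK ?subrr//; lra.
Qed.

(** [m] is a polynomial with leading term (-x)^k / k!. It recovers the integral of [phi] from the
    derivative of order [k], and is the correction subtracted in the induction of
    [du_bois_reymond]. *)
Lemma moment_fun k : exists2 m, @smooth R m & forall phi, test_fun phi ->
  Rint (fun x => m x * derive1n k phi x) = Rint phi.
Proof.
elim: k => [|k [m sm Hm]].
  exists (cst 1); first exact: smooth_cst.
  by move=> phi _; apply: eq_Rint => x; rewrite mul1r.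
have [M Mm] := antiderivative (smooth_continuous (smoothN sm)).
have sM : smooth M by apply: isder_smooth Mm _; exact: smoothN.
exists M => // phi tp; rewrite -(Hm phi tp) derive1nS.
have tpk := test_derive1n k tp.
have Hd := smooth_isder (test_smooth tpk).
have := by_parts Mm Hd (smooth_continuous (smoothN sm))
  (test_continuous (test_derive tpk)) (test_csupp tpk).
move=> /(congr1 -%R); rewrite opprK => <-; rewrite -RintN.
  by apply: eq_Rint => x; rewrite mulNr opprK.
by apply: intble_test => //; exact: smooth_continuous (smoothN sm).
Qed.

(** Induction on [k]. Removing from [phi] its mean times a fixed bump [b] leaves the derivative of a
    test function [theta]. Testing with [theta] shows that the integral of f phi^(k) is [c] times
    the integral of [phi], that is, [c] times the integral of m phi^(k); so f - c m satisfies the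
    hypothesis at order [k]. *)
Lemma du_bois_reymond k f : continuous f ->
  (forall phi, test_fun phi -> Rint (fun x => f x * derive1n k phi x) = 0) ->
  smooth f.
Proof.
elim: k f => [|k IH] f cf H.
  have -> : f = fun=> 0 by apply/funext; exact: fundamental_lemma H.
  exact: smooth_cst.
have hat_pos := Rint_hat_gt0.
pose b (x : R) : R := (Rint (@hat R))^-1 * hat x.
have tb : test_fun b by apply: testZ; exact: test_hat.
have b1 : Rint b = 1.
  by rewrite RintZ ?mulVf ?gt_eqF//; exact: intble_testT (test_hat _).
pose c := Rint (fun x => f x * derive1n k b x).
have [m sm Hm] := moment_fun k.
have ccm : continuous (fun x => (- c) * m x).
  exact: smooth_continuous (@smoothZ R (- c) m sm).
suff : smooth (fun x => f x + (- c) * m x).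
  move=> sfm; have := smoothD sfm (@smoothZ R c m sm).
  by under eq_fun do rewrite mulNr subrK.
apply: IH => [|phi tp]; first exact: contD.
pose zeta (x : R) : R := phi x + (- Rint phi) * b x.
have tz : test_fun zeta by exact: testD tp (@testZ (- Rint phi) _ tb).
have iphi := intble_testT tp; have ib := intble_testT tb.
have z0 : Rint zeta = 0.
  rewrite RintD//; last exact: intbleZ.
  by rewrite RintZ// b1 mulr1 subrr.
have [theta tth thz] := test_antiderivative tz z0.
have := H _ tth; rewrite derive1n_Sr (isder_derive1 thz).
rewrite derive1nD; [|by case: tp|by apply: test_smooth; exact: testZ].
rewrite derive1nZ; last by case: tb.
have i1 := intble_test cf (test_derive1n k tp).
have i2 := intble_test cf (test_derive1n k tb).
have -> : (fun x => f x * (derive1n k phi x + - Rint phi * derive1n k b x)) =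
   (fun x => f x * derive1n k phi x + (- Rint phi) * (f x * derive1n k b x)).
  by apply/funext => x; ring.
rewrite RintD//; last exact: intbleZ.
rewrite RintZ// -/c => E.
have i3 := intble_test (smooth_continuous sm) (test_derive1n k tp).
have -> : (fun x => (f x + - c * m x) * derive1n k phi x) =
   (fun x => f x * derive1n k phi x + (- c) * (m x * derive1n k phi x)).
  by apply/funext => x; ring.
rewrite RintD//; last exact: intbleZ.
by rewrite RintZ// Hm// -E; ring.
Qed.

End Distributions.

(** * Sobolev bounds and compactness *)

Section Compactness.
Set Implicit Arguments. Unset Strict Implicit. Unset Printing Implicit Defensive.
Variable R : realType.
Local Notation Rint := Defs.Rint.
Local Notation mu := (@lebesgue_measure R).
Implicit Types f g h : R -> R.

Lemma Rint_dominated (f_ : nat -> R -> R) f g :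
  (forall n, measurable_fun setT (f_ n)) -> measurable_fun setT f ->
  intble g ->
  {ae mu, forall x, f_ n x @[n --> \oo] --> f x} ->
  (forall n x, `|f_ n x| <= g x) ->
  Rint (f_ n) @[n --> \oo] --> Rint f.
Proof.
move=> mf_ mf ig cv fg.
have [] := @dominated_convergence _ _ _ mu setT measurableT
  (fun n => EFin \o f_ n) (EFin \o f) (EFin \o g).
- move=> n. have /measurable_EFinP H := mf_ n; exact: H.
- by have /measurable_EFinP H := mf; exact: H.
- case: cv => Z [mZ Z0 HZ]; exists Z; split=> //.
  apply: subset_trans HZ => x /=; apply: contra_not => Hx _.
  by apply: cvg_EFin => //; exact: nearW.
- exact: ig.
- by apply: aeW => x n _ /=; rewrite lee_fin.
move=> fi _ H; apply: fine_cvg; rewrite fineK; first exact: H.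
exact: integrable_fin_num.
Qed.

(** Integrate the derivative of (y - x - 1) f(y)^2 over the window: the weight is -1 at [x] and 0 at
    the right end, so the boundary term is exactly f(x)^2. Keeping the bound local gives both the
    uniform bound and the decay at infinity. *)
Lemma sobolev_itv f f' x : isder f f' -> continuous f' ->
  f x ^+ 2 <= \int[mu]_(y in `[x, x + 1]) (2 * f y ^+ 2 + f' y ^+ 2).
Proof.
move=> ff' cf'; have cf := isder_continuous ff'.
have c1 : continuous (fun y => 2 * (f y * f' y)).
  by apply: contM; [exact: cst_continuous|exact: contM].
have dw y : is_derive y (1:R) (fun y : R => y - x - 1) 1.
  rewrite (_ : (fun y : R => y - x - 1) = fun y => 1 * y + (- x - 1)).
    exact: isd_affine.
  by apply/funext => z; ring.
have cw := isder_continuous dw.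
have c2 : continuous (fun y => f y * f y + (y - x - 1) * (2 * (f y * f' y))).
  by apply: contD; exact: contM.
have d y : is_derive y (1:R) (fun y => (y - x - 1) * (f y * f y))
    (f y * f y + (y - x - 1) * (2 * (f y * f' y))).
  apply: isd_eq (isdM (dw y) (isdM (ff' y) (ff' y))) _; ring.
have xx1 : x < x + 1 by lra.
have := FTC2 xx1 d c2.
have -> : (x + 1 - x - 1) * (f (x + 1) * f (x + 1)) - (x - x - 1) * (f x * f x) =
   f x ^+ 2 by ring.
move=> <-; apply: le_Rintegral => //; try exact: continuous_itv_integrable.
  apply: continuous_itv_integrable; apply: contD; last exact: contM.
  by apply: contM; [exact: cst_continuous|exact: contM].
move=> y /=; rewrite in_itv/= => /andP[y1 y2].
have h1 : 0 <= 1 + (y - x - 1) <= 1 by lra.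
have h2 := sqr_ge0 (f y + f' y); have h3 := sqr_ge0 (f y - f' y).
have : - (f y ^+ 2 + f' y ^+ 2) <= 2 * (f y * f' y) <= f y ^+ 2 + f' y ^+ 2 by nra.
nra.
Qed.

Lemma sobolev f f' x : isder f f' -> continuous f' -> L2 f -> L2 f' ->
  f x ^+ 2 <= 2 * Rint (fun y => f y ^+ 2) + Rint (fun y => f' y ^+ 2).
Proof.
move=> ff' cf' /L2_sqr fL /L2_sqr f'L; apply: le_trans (sobolev_itv x ff' cf') _.
rewrite -RintZ// -RintD//; last exact: intbleZ.
apply: le_Rint_itv; first by apply: intbleD => //; exact: intbleZ.
by move=> y; have := sqr_ge0 (f y); have := sqr_ge0 (f' y); lra.
Qed.

(** Dominated convergence makes the integral over {|x| >= n} tend to 0, and distant windows lie in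
    that set. *)
Lemma Rint_tail h (e : R) : intble h -> (forall x, 0 <= h x) -> 0 < e ->
  exists K : R, forall x, K < `|x| -> \int[mu]_(y in `[x, x + 1]) h y < e.
Proof.
move=> hi h0 e0.
pose D n := [set x : R | n%:R <= `|x|].
have mD n : measurable (D n).
  rewrite (_ : D n = ~` `]- n%:R, n%:R[%classic); first exact: measurableC.
  apply/seteqP; split => x; rewrite /D/= in_itv/= -ltr_norml leNgt.
    by move/negP.
  by move=> /negP.
have mh := intble_measurable hi.
have H1 n : measurable_fun setT (h \_ (D n)).
  by apply: (measurable_restrictT _ _).1 => //; exact: measurable_funTS.
have H2 : {ae mu, forall x, (h \_ (D n)) x @[n --> \oo] --> (0:R)}.
  apply: aeW => x; apply: cvg_near_cst; near=> n.
  rewrite patchE ifF//; apply/negbTE/negP; rewrite inE /D/=; apply/negP.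
  by rewrite -ltNge; near: n; exact: nbhs_infty_gtr.
have H3 n x : `|(h \_ (D n)) x| <= h x.
  by rewrite patchE; case: ifP => _; rewrite ?normr0// ger0_norm.
have := @Rint_dominated _ (cst 0) h H1 (measurable_cst _) hi H2 H3.
rewrite Rint_zero => /cvgr0Pnorm_lt /(_ _ e0)[n _ Hn].
(* The extra 1 is the window length: it keeps [[x, x + 1]] inside [D n] for negative [x] too. *)
exists (n%:R + 1) => x nx.
have {Hn} := Hn n (leqnn n).
have hD0 y : 0 <= (h \_ (D n)) y by rewrite patchE; case: ifP.
rewrite /= ger0_norm; last exact: Rint_ge0.
apply: le_lt_trans.
have -> : \int[mu]_(y in `[x, x + 1]) h y = \int[mu]_(y in `[x, x + 1]) (h \_ (D n)) y.
  apply: eq_Rintegral => y. rewrite inE/= in_itv/= => /andP[y1 y2]; rewrite patchE ifT// inE/D/=.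
  have := ler_normB y (y - x); rewrite opprB addrC subrK => H.
  have : `|y - x| <= 1 by rewrite ler_norml; lra.
  lra.
by apply: le_Rint_itv => //; exact: le_intble (H1 n) (H3 n) hi.
Unshelve. all: by end_near. Qed.

(** f(x)^2 is controlled by the energy in a window starting at [x], which is part of the tail of a
    convergent integral. *)
Lemma L2_decay f f' : isder f f' -> continuous f' -> L2 f -> L2 f' ->
  f x @[x --> +oo%R] --> (0:R) /\ f x @[x --> -oo%R] --> (0:R).
Proof.
move=> ff' cf' fL f'L.
have small e : 0 < e -> exists K : R, forall x, K < `|x| -> `|f x| < e.
  move=> e0; have e2 : 0 < e ^+ 2 by rewrite exprn_gt0.
  have hi : intble (fun y => 2 * f y ^+ 2 + f' y ^+ 2).
    by apply: intbleD; [apply: intbleZ|]; exact: L2_sqr.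
  have h0 y : 0 <= 2 * f y ^+ 2 + f' y ^+ 2.
    by have := sqr_ge0 (f y); have := sqr_ge0 (f' y); lra.
  have [K HK] := Rint_tail hi h0 e2; exists K => x /HK H.
  have := le_lt_trans (sobolev_itv x ff' cf') H.
  by rewrite -(real_normK (num_real (f x))) ltr_pXn2r// nnegrE ltW.
split; apply/cvgr0Pnorm_lt => e /small[K HK]; near=> x; apply: HK.
  rewrite (@lt_le_trans _ _ x)// ?ler_norm//.
  by near: x; apply: nbhs_pinfty_gt; exact: num_real.
rewrite -normrN (@lt_le_trans _ _ (- x))// ?ler_norm// ltrNr.
by near: x; apply: nbhs_ninfty_lt; exact: num_real.
Unshelve. all: by end_near. Qed.

Lemma isder_lipschitz f f' (L : R) : isder f f' -> (forall x, `|f' x| <= L) ->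
  forall x y, `|f x - f y| <= L * `|x - y|.
Proof.
move=> ff' HL; have cf := isder_continuous ff'.
have main x y : x < y -> `|f x - f y| <= L * `|x - y|.
  move=> xy; have [|z _] := @MVT R f f' x y xy _ (continuous_subspaceT cf).
    by move=> z _; exact: ff'.
  by move=> E; rewrite distrC E normrM distrC [`|x - y|]distrC ler_wpM2r.
move=> x y; have [xy|xy|->] := ltgtP x y; first exact: main.
  by rewrite distrC [`|x - y|]distrC; exact: main.
by rewrite !subrr normr0 mulr0.
Qed.

End Compactness.

(** * Pointwise convergent selection from an equi-Lipschitz bounded sequence *)

Section Selection.
Set Implicit Arguments. Unset Strict Implicit. Unset Printing Implicit Defensive.
Variable R : realType.
Local Notation Rint := Defs.Rint.
Local Notation mu := (@lebesgue_measure R).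
Implicit Types f g h : R -> R.

(* Pointwise Arzela-Ascoli: a cluster point in the product topology is approximated
   along a sequence on the rationals, then everywhere by equicontinuity. *)
Lemma lipschitz_selection (u : nat -> R -> R) (C L : R) :
  (forall n x, `|u n x| <= C) ->
  (forall n x y, `|u n x - u n y| <= L * `|x - y|) ->
  exists psi (s : nat -> nat), [/\ forall k, (k <= s k)%N,
    forall x y, `|psi x - psi y| <= L * `|x - y| &
    forall x, u (s k) x @[k --> \oo] --> psi x].
Proof.
move=> uC uL.
(* An enumeration of the rationals; codes of no rational are sent to 0, and only the density of the
   range matters. *)
pose q k : R := ratr (odflt 0 (unpickle k) : rat).
have qdense (x e : R) : 0 < e -> exists k, `|x - q k| < e.
  move=> e0; have xe : x < x + e by rewrite ltrDl.
  have [r] := rat_in_itvoo xe; rewrite in_itv/= => /andP[r1 r2].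
  exists (pickle r); rewrite /q pickleK/= distrC ger0_norm ?subr_ge0 ?ltW//.
  by rewrite ltrBlDl.
pose K : set (prod_topology (fun _ : R => R)) := [set f | forall x, `[- C, C]%classic (f x)].
have cK : compact K.
  have := @tychonoff R (fun=> R) (fun=> `[- C, C]%classic).
  by apply => x; exact: segment_compact.
have [|psi [_ psi_cl]] := cK (u @ \oo) _.
  by exists 0%N => // n _ x /=; rewrite in_itv/= -ler_norml.
have FF := @nbhs_filter (prod_topology (fun _ : R => R)) psi.
(* A neighbourhood in the product topology may constrain any finite number of coordinates at once;
   [near_u] combines this with the cluster property. *)
have near_fin (p : nat -> R) k (e : R) : 0 < e ->
    nbhs (psi : prod_topology (fun _ : R => R)) [set f | forall i, (i < k)%N -> `|psi (p i) - f (p i)| < e].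
  move=> e0; elim: k => [|k IH]; first by apply: (@filterE _ _ FF) => f i.
  have Hk : nbhs (psi : prod_topology (fun _ : R => R)) [set f | `|psi (p k) - f (p k)| < e].
    have /cvgrPdist_lt := @proj_continuous R (fun=> R) (p k) psi.
    exact.
  apply: (@filterS2 _ _ FF _ _ _ _ IH Hk) => f H1 H2 i; rewrite ltnS leq_eqVlt => /predU1P[->//|].
  exact: H1.
have near_u (p : nat -> R) k (e : R) : 0 < e -> exists n, (k <= n)%N /\
    forall i, (i < k)%N -> `|psi (p i) - u n (p i)| < e.
  move=> e0.
  have H : (u @ \oo) (u @` [set n | (k <= n)%N]).
    by exists k => // n /= kn; exists n.
  by have [_ [[n kn <-] Hn]] := psi_cl _ _ H (near_fin p k e e0); exists n.
have psiL x y : `|psi x - psi y| <= L * `|x - y|.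
  apply/ler_addgt0Pr => e e0.
  have e2 : 0 < e / 2 by lra.
  (* A two-valued sequence of points: one [u n] is close to [psi] at [x] and at [y]
     simultaneously. *)
  have [n [_ Hn]] := near_u (fun i => if i == 0%N then x else y) 2%N _ e2.
  have := Hn 0%N isT; have := Hn 1%N isT => /=.
  have := ler_distD (u n x) (psi x) (psi y).
  have := ler_distD (u n y) (u n x) (psi y).
  have := uL n x y; rewrite [`|u n y - _|]distrC; lra.
(* The choice [s k] is within 1/(k+1) of [psi] at the first [k] rationals. It need not increase;
   [k <= s k] is enough for the later limits. *)
have pick k := near_u q k k.+1%:R^-1 (ltac:(by rewrite invr_gt0 ltr0n)).
have [s Hs] := choice pick.
exists psi, s; split=> [k| |x]; [by have [] := Hs k|exact: psiL|].
have L0 : 0 <= L.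
  have := le_trans (normr_ge0 _) (uL 0%N 0 1).
  by rewrite sub0r normrN normr1 mulr1.
apply/cvgrPdist_lt => e e0.
(* Two Lipschitz errors must fit into e/2; adding 1 to the denominator covers [L = 0]. *)
have e3 : 0 < e / (2 * L + 1) / 2 by rewrite !divr_gt0//; lra.
have [i xi] := qdense x _ e3; near=> k.
have ik : (i < k)%N by near: k; exact: nbhs_infty_gt.
have H1 : `|psi (q i) - u (s k) (q i)| < e / 2.
  apply: lt_trans ((Hs k).2 i ik) _.
  near: k; have e2 : 0 < e / 2 by lra.
  exact: near_infty_natSinv_lt (PosNum e2).
have H2 := psiL x (q i); have H3 := uL (s k) (q i) x.
have H4 := ler_distD (psi (q i)) (psi x) (u (s k) x).
have H5 := ler_distD (u (s k) (q i)) (psi (q i)) (u (s k) x).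
have H6 : (2 * L) * `|x - q i| <= e / 2.
  apply: (@le_trans _ _ ((2 * L + 1) * (e / (2 * L + 1) / 2))).
    by apply: ler_pM; [lra|by []|lra|exact: ltW].
  by rewrite mulrA mulrCA divff ?mulr1//; lra.
move: H3; rewrite [`|q i - x|]distrC => H3; lra.
Unshelve. all: by end_near. Qed.

End Selection.

(** * The variational problem *)

Section Variational.
Set Implicit Arguments. Unset Strict Implicit. Unset Printing Implicit Defensive.
Variable R : realType.
Local Notation Rint := Defs.Rint.
Local Notation mu := (@lebesgue_measure R).
Implicit Types f g h : R -> R.

(** [l] is the supremum of the parameters at which the form takes a negative value. A negative value
    at [l] itself would persist slightly above it. A negative value slightly below [l] stays under e
    N(u) at [l], because [al] and [be] bound the change of the form by the norm; rescaling then
    gives unit norm. *)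
Lemma critical_parameter (T : Type) (P : T -> Prop) (A B C N : T -> R) (al be : R) :
  (forall u, P u -> 0 <= A u <= al * N u) ->
  (forall u, P u -> 0 <= B u <= be * N u) ->
  (forall u, P u -> 0 <= N u /\ (N u = 0 -> C u = 0)) ->
  (forall u k, P u -> exists v, [/\ P v, A v = k ^+ 2 * A u, B v = k ^+ 2 * B u,
     C v = k ^+ 2 * C u & N v = k ^+ 2 * N u]) ->
  (exists2 u, P u & C u < 0) ->
  (exists2 l0, 0 < l0 & forall u, P u -> 0 <= l0 ^+ 2 * A u + l0 * B u + C u) ->
  exists l, [/\ 0 < l, forall u, P u -> 0 <= l ^+ 2 * A u + l * B u + C u &
    forall e, 0 < e -> exists u, [/\ P u, N u = 1 & l ^+ 2 * A u + l * B u + C u < e]].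
Proof.
move=> HA HB HN scale [u0 Pu0 Cu0] [l0 l0_gt0 Hl0].
pose Q l u := l ^+ 2 * A u + l * B u + C u.
pose S := [set l : R | 0 < l /\ exists2 u, P u & Q l u < 0].
have Qmon l l' u : P u -> 0 < l -> l <= l' -> Q l u <= Q l' u.
  move=> Pu l0' ll'; have /andP[A0 _] := HA _ Pu; have /andP[B0 _] := HB _ Pu.
  rewrite /Q lerD2r lerD//; last exact: ler_wpM2r.
  by rewrite ler_wpM2r// lerXn2r// nnegrE ltW// (lt_le_trans l0').
have [l1 l1_gt0 Sl1] : exists2 l1, 0 < l1 & S l1.
  have /andP[A0 _] := HA _ Pu0; have /andP[B0 _] := HB _ Pu0.
  have AB : 0 < A u0 + B u0 + 1 by lra.
  (* [l1 <= 1] allows [l1 ^+ 2] to be replaced by [l1], and the second bound then gives a form value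
     of at most [- l1]. *)
  pose l1 := Num.min 1 (- C u0 / (A u0 + B u0 + 1)).
  have l1_gt0 : 0 < l1 by rewrite lt_min ltr01 divr_gt0 ?oppr_gt0.
  exists l1 => //; split=> //; exists u0 => //; rewrite /Q.
  have l11 : l1 <= 1 by rewrite ge_min lexx.
  have : l1 * (A u0 + B u0 + 1) <= - C u0.
    by rewrite -ler_pdivlMr// ge_min lexx orbT.
  have : l1 ^+ 2 * A u0 <= l1 * A u0.
    by rewrite ler_wpM2r// expr2 ler_piMl// ltW.
  nra.
have S_ub : has_ubound S.
  exists l0 => l [l_gt0 [u Pu Qu]]; rewrite leNgt; apply/negP => l0l.
  by have := Hl0 _ Pu; have := Qmon l0 l u Pu l0_gt0 (ltW l0l); rewrite /Q in Qu *; lra.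
have S_sup : has_sup S by split => //; exists l1.
pose l := sup S; have ll1 : l1 <= l by exact: sup_upper_bound.
have l_gt0 : 0 < l by exact: lt_le_trans ll1.
exists l; split=> // [u Pu|e e0].
- rewrite leNgt; apply/negP; rewrite -/(Q l u) => Qu.
  have /andP[A0 _] := HA _ Pu; have /andP[B0 _] := HB _ Pu.
  (* A bound for the slope in the parameter on [[l, l + 1]]; the form stays negative after the step
     [d]. *)
  pose D := (2 * l + 1) * A u + B u.
  have D0 : 0 <= D by rewrite addr_ge0// mulr_ge0//; lra.
  pose d := Num.min 1 (- Q l u / (D + 1)).
  have d_gt0 : 0 < d by rewrite lt_min ltr01 divr_gt0 ?oppr_gt0//; lra.
  have d1 : d <= 1 by rewrite ge_min lexx.
  have dD : d * (D + 1) <= - Q l u.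
    by rewrite -ler_pdivlMr ?ge_min ?lexx ?orbT//; lra.
  have Sld : S (l + d).
    split; first lra.
    exists u => //.
    have -> : Q (l + d) u = Q l u + d * ((2 * l + d) * A u + B u) by rewrite /Q; ring.
    have : d * ((2 * l + d) * A u + B u) <= d * D.
      apply: ler_wpM2l; first exact: ltW.
      by rewrite /D lerD2r ler_wpM2r//; lra.
    nra.
  by have := sup_upper_bound S_sup Sld; rewrite -/l; lra.
(* The rate of change of the form in the parameter, up to [l], is at most [K * N u]; [al] and [be]
   carry no sign, hence the absolute values. *)
- pose K := 2 * l * `|al| + `|be|.
  have K0 : 0 <= K by rewrite addr_ge0// mulr_ge0//; lra.
  have d_gt0 : 0 < e / (K + 1) by rewrite divr_gt0//; lra.
  have [l' [l'_gt0 [u Pu Qu]] l'l] := sup_adherent d_gt0 S_sup.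
  rewrite -/l in l'l.
  have l'_le : l' <= l by apply: sup_upper_bound => //; split=> //; exists u.
  have [N0 NC] := HN _ Pu.
  have /andP[A0 AN] := HA _ Pu; have /andP[B0 BN] := HB _ Pu.
  have N_gt0 : 0 < N u.
    (* If [N u] were 0, then [C u] would vanish and the form could not be negative. *)
    rewrite lt_neqAle N0 andbT eq_sym; apply/eqP => Nu.
    move: Qu; rewrite /Q NC// addr0 ltNge addr_ge0// mulr_ge0// ?sqr_ge0//.
    exact: ltW.
  have Ne : Q l u < e * N u.
    have -> : Q l u = Q l' u + (l - l') * ((l + l') * A u + B u) by rewrite /Q; ring.
    have h1 : (l + l') * A u + B u <= K * N u.
      rewrite /K [leRHS]mulrDl lerD//.
        rewrite -mulrA; apply: ler_pM => //; [lra|lra|].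
        by apply: le_trans AN _; rewrite ler_wpM2r// ler_norm.
      by apply: le_trans BN _; rewrite ler_wpM2r// ler_norm.
    have h2 : (l - l') * ((l + l') * A u + B u) <= (e / (K + 1)) * (K * N u).
      apply: ler_pM => //; [lra| |lra].
      by rewrite addr_ge0// mulr_ge0//; lra.
    have h3 : (e / (K + 1)) * (K * N u) <= e * N u.
      rewrite mulrA ler_wpM2r// mulrAC ler_pdivrMr; last lra.
      by apply: ler_wpM2l; [exact: ltW|lra].
    lra.
  have [v [Pv Av Bv Cv Nv]] := scale u (Num.sqrt (N u))^-1 Pu.
  have E : (Num.sqrt (N u))^-1 ^+ 2 = (N u)^-1 by rewrite exprVn sqr_sqrtr.
  exists v; split => //; first by rewrite Nv E mulVf// gt_eqF.
  rewrite Av Bv Cv E.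
  have -> : l ^+ 2 * ((N u)^-1 * A u) + l * ((N u)^-1 * B u) + (N u)^-1 * C u =
     Q l u / N u by rewrite /Q; field; rewrite gt_eqF.
  by rewrite ltr_pdivrMr.
Qed.

(** The derivatives are carried as data because those of a mollified function are known directly as
    integrals against the differentiated kernel. *)
Record jet := Jet { j0 : R -> R; j1 : R -> R; j2 : R -> R }.
Implicit Types u v : jet.

Definition admissible u := [/\ isder (j0 u) (j1 u), isder (j1 u) (j2 u),
  continuous (j2 u) & [/\ L2 (j0 u), L2 (j1 u) & L2 (j2 u)]].

Definition jadd (t : R) u v := Jet (fun x => j0 u x + t * j0 v x)
  (fun x => j1 u x + t * j1 v x) (fun x => j2 u x + t * j2 v x).

Definition jscale (k : R) u := Jet (fun x => k * j0 u x)
  (fun x => k * j1 u x) (fun x => k * j2 u x).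

Lemma admissible_add t u v : admissible u -> admissible v ->
  admissible (jadd t u v).
Proof.
move=> [du du' cu [Lu Lu1 Lu2]] [dv dv' cv [Lv Lv1 Lv2]]; split => /=.
- by move=> x; apply: isdD => //; exact: isdZ.
- by move=> x; apply: isdD => //; exact: isdZ.
- by apply: contD => //; apply: contM => //; exact: cst_continuous.
- by split; apply: L2D => //; exact: L2Z.
Qed.

Lemma admissible_scale k u : admissible u -> admissible (jscale k u).
Proof.
move=> [du du' cu [Lu Lu1 Lu2]]; split => /=.
- by move=> x; exact: isdZ.
- by move=> x; exact: isdZ.
- by apply: contM => //; exact: cst_continuous.
- by split; exact: L2Z.
Qed.

Definition jet_of f := Jet f (derive1n 1 f) (derive1n 2 f).

Lemma admissible_test phi : test_fun phi -> admissible (jet_of phi).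
Proof.
move=> tp; split => /=.
- exact/smooth_isder/test_smooth.
- exact/smooth_isder/test_smooth/test_derive.
- exact/test_continuous/(test_derive1n 2).
- by split; apply: L2_test => //; [exact: (test_derive1n 1)|exact: (test_derive1n 2)].
Qed.

Definition bdd f := continuous f /\ exists C : R, forall x, `|f x| <= C.

Lemma bdd_cst (c : R) : bdd (fun=> c).
Proof. by split; [exact: cst_continuous|exists `|c|]. Qed.

Lemma bddD f g : bdd f -> bdd g -> bdd (fun x => f x + g x).
Proof.
move=> [cf [C fC]] [cg [D gD]]; split; first exact: contD.
by exists (C + D) => x; rewrite (le_trans (ler_normD _ _))// lerD.
Qed.

Lemma bddM f g : bdd f -> bdd g -> bdd (fun x => f x * g x).
Proof.
move=> [cf [C fC]] [cg [D gD]]; split; first exact: contM.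
by exists (C * D) => x; rewrite normrM ler_pM.
Qed.

Lemma intble_bdd h f : bdd h -> intble f -> intble (fun x => h x * f x).
Proof. by move=> [ch [C hC]]; apply: intble_mulb hC; exact: continuous_meas. Qed.

Lemma L2_bdd h f : bdd h -> L2 f -> L2 (fun x => h x * f x).
Proof. by move=> [ch [C hC]]; apply: L2_mulb hC; exact: continuous_meas. Qed.

Definition dens (c p r : R -> R) u v (x : R) := c x * (j2 u x * j2 v x) +
  p x * (j1 u x * j1 v x) + r x * (j0 u x * j0 v x).

Definition qform c p r u v := Rint (dens c p r u v).

Lemma intble_dens c p r u v : bdd c -> bdd p -> bdd r ->
  admissible u -> admissible v -> intble (dens c p r u v).
Proof.
move=> bc bp br [_ _ _ [Lu Lu1 Lu2]] [_ _ _ [Lv Lv1 Lv2]].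
apply: intbleD; last by apply: intble_bdd => //; exact: L2_mul.
by apply: intbleD; apply: intble_bdd => //; exact: L2_mul.
Qed.

Lemma qform_scale c p r k u : bdd c -> bdd p -> bdd r -> admissible u ->
  qform c p r (jscale k u) (jscale k u) = k ^+ 2 * qform c p r u u.
Proof.
move=> bc bp br au; rewrite /qform -RintZ; last exact: intble_dens.
by apply: eq_Rint => x; rewrite /dens /=; ring.
Qed.

Lemma qform_quad c p r t u v : bdd c -> bdd p -> bdd r ->
  admissible u -> admissible v ->
  qform c p r (jadd t u v) (jadd t u v) =
  qform c p r u u + 2 * t * qform c p r u v + t ^+ 2 * qform c p r v v.
Proof.
move=> bc bp br au av; rewrite /qform.
have duu := intble_dens bc bp br au au; have duv := intble_dens bc bp br au av.
have dvv := intble_dens bc bp br av av.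
have iv := intbleZ (2 * t) duv; have ivv := intbleZ (t ^+ 2) dvv.
rewrite -!RintZ// -RintD// -RintD//; last exact: intbleD.
by apply: eq_Rint => x; rewrite /dens /=; ring.
Qed.

Lemma qform_le c p r c' p' r' u : bdd c -> bdd p -> bdd r ->
  bdd c' -> bdd p' -> bdd r' -> admissible u ->
  (forall x, c x <= c' x) -> (forall x, p x <= p' x) -> (forall x, r x <= r' x) ->
  qform c p r u u <= qform c' p' r' u u.
Proof.
move=> bc bp br bc' bp' br' au cc' pp' rr'.
apply: le_Rint; try exact: intble_dens.
by move=> x; rewrite /dens -!expr2 !lerD// ler_wpM2r// sqr_ge0.
Qed.

Lemma qform_ge0 c p r u : (forall x, 0 <= c x) -> (forall x, 0 <= p x) ->
  (forall x, 0 <= r x) -> 0 <= qform c p r u u.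
Proof.
move=> c0 p0 r0; apply: Rint_ge0 => x.
by rewrite /dens -!expr2 !addr_ge0// mulr_ge0// sqr_ge0.
Qed.

Lemma qform_CS c p r u v : bdd c -> bdd p -> bdd r -> admissible u -> admissible v ->
  (forall w, admissible w -> 0 <= qform c p r w w) ->
  qform c p r u v ^+ 2 <= qform c p r u u * qform c p r v v.
Proof.
move=> bc bp br au av pos; apply: quadratic_CS; [exact: pos..|] => t.
by rewrite -qform_quad//; apply: pos; exact: admissible_add.
Qed.

(** The squared H^2 norm, as an instance of [qform], so that scaling and comparison of coefficients
    apply to it. *)
Definition sqnorm u := qform (fun=> 1) (fun=> 1) (fun=> 1) u u.

Lemma sqnormE u : admissible u -> sqnorm u = Rint (fun x => j2 u x ^+ 2) +
  Rint (fun x => j1 u x ^+ 2) + Rint (fun x => j0 u x ^+ 2).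
Proof.
move=> [_ _ _ [/L2_sqr Lu /L2_sqr Lu1 /L2_sqr Lu2]].
rewrite -!RintD//; last exact: intbleD.
by apply: eq_Rint => x; rewrite /dens; ring.
Qed.

End Variational.

(** * From minimising sequences to weak solutions *)

Section WeakSolution.
Set Implicit Arguments. Unset Strict Implicit. Unset Printing Implicit Defensive.
Variable R : realType.
Local Notation Rint := Defs.Rint.
Local Notation mu := (@lebesgue_measure R).
Implicit Types f g h : R -> R.
Implicit Types u v : jet R.
Implicit Types p r phi : R -> R.

Definition elop (c : R) p r f (x : R) : R :=
  c * derive1n 4 f x - derive1 (fun y => p y * derive1 f y) x + r x * f x.

Lemma smooth_flux p f : smooth p -> smooth f ->
  smooth (fun y => p y * derive1 f y).
Proof. by move=> sp sf; exact: smoothM sp (smooth_derive1 sf). Qed.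

Lemma test_flux p phi : smooth p -> test_fun phi ->
  test_fun (fun y => p y * derive1 phi y).
Proof. by move=> sp tp; exact: test_mull sp (test_derive tp). Qed.

Lemma smooth_elop c p r f : smooth p -> smooth r -> smooth f ->
  smooth (elop c p r f).
Proof.
move=> sp sr sf; apply: smoothD; last exact: smoothM.
apply: smoothB; last exact/smooth_derive1/smooth_flux.
by apply: smoothZ; exact: (smooth_derive1n (n := 4)).
Qed.

Lemma csupp_elop c p r phi : smooth p -> test_fun phi -> csupp (elop c p r phi).
Proof.
move=> sp tp.
have [_ [K1 H1]] := test_derive1n 4 tp.
have [_ [K2 H2]] := test_derive (test_flux sp tp).
have [_ [K3 H3]] := tp.
exists (Num.max K1 (Num.max K2 K3)) => x; rewrite !gt_max => /and3P[x1 x2 x3].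
by rewrite /elop H1// H2// H3// !mulr0 subr0 addr0.
Qed.

Lemma test_elop c p r phi : smooth p -> smooth r -> test_fun phi ->
  test_fun (elop c p r phi).
Proof.
move=> sp sr tp; split; last exact: csupp_elop.
exact: smooth_elop sp sr (test_smooth tp).
Qed.

Lemma by_parts_test f f' phi : isder f f' -> continuous f' -> test_fun phi ->
  Rint (fun x => f' x * phi x) = - Rint (fun x => f x * derive1 phi x).
Proof.
move=> ff' cf' tp; apply: (by_parts ff' _ cf').
- exact/smooth_isder/test_smooth.
- exact/test_continuous/test_derive.
- exact: test_csupp.
Qed.

Lemma by_parts_testn f f' phi n : isder f f' -> continuous f' -> test_fun phi ->
  Rint (fun x => f' x * derive1n n phi x) =
  - Rint (fun x => f x * derive1n n.+1 phi x).
Proof.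
by move=> ff' cf' tp; rewrite derive1nS; apply: by_parts_test => //; exact: test_derive1n.
Qed.

(** All derivatives move to the test function, so that only the values of [u] remain and a pointwise
    limit can be taken. *)
Lemma qform_test c p r u phi : smooth p -> bdd p -> smooth r -> bdd r ->
  admissible u -> test_fun phi ->
  qform (fun=> c) p r u (jet_of phi) = Rint (fun x => j0 u x * elop c p r phi x).
Proof.
move=> sp bp sr br [du du' cu [Lu Lu1 Lu2]] tp.
have cu1 := isder_continuous du'; have cu0 := isder_continuous du.
have t n : test_fun (derive1n n phi) by exact: test_derive1n.
have tf := test_flux sp tp.
have E2 := etrans (@by_parts_testn _ _ phi 2 du' cu tp)
  (etrans (congr1 -%R (@by_parts_testn _ _ phi 3 du cu1 tp)) (opprK _)).
have E1 : Rint (fun x => j1 u x * (p x * derive1 phi x)) =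
    - Rint (fun x => j0 u x * derive1 (fun y => p y * derive1 phi y) x).
  exact: by_parts_test du cu1 tf.
have i2 := intble_test cu (t 2%N).
have i4 := intble_test cu0 (t 4%N).
have i1 := intble_test cu1 tf.
have i1' := intble_test cu0 (test_derive tf).
have i0 := intble_test cu0 (test_mull sr tp).
rewrite /qform /dens /elop /jet_of; cbn [j0 j1 j2].
change (derive1n 1 phi) with (derive1 phi).
move: E1 E2 i2 i4 i1 i1' i0.
move: (derive1n 2 phi) (derive1n 4 phi) (derive1 phi)
  (derive1 (fun y => p y * derive1 phi y)) => d2 d4 d1 fl E1 E2 i2 i4 i1 i1' i0.
rewrite (@eq_Rint _ _ (fun x => c * (j2 u x * d2 x) + j1 u x * (p x * d1 x) +
   j0 u x * (r x * phi x))); last by move=> x; ring.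
rewrite [RHS](@eq_Rint _ _ (fun x => c * (j0 u x * d4 x) - j0 u x * fl x +
   j0 u x * (r x * phi x))); last by move=> x; ring.
rewrite RintD//; last by apply: intbleD => //; exact: intbleZ.
rewrite [RHS]RintD//; last by apply: intbleB => //; exact: intbleZ.
rewrite RintD//; last exact: intbleZ.
rewrite [in RHS]RintB//; last exact: intbleZ.
by rewrite !RintZ// E1 E2.
Qed.

Lemma cvg_sqr (a : nat -> R) (l : R) : a k @[k --> \oo] --> l ->
  a k ^+ 2 @[k --> \oo] --> l ^+ 2.
Proof.
by move=> al; rewrite expr2; under eq_fun do rewrite expr2; exact: cvgM.
Qed.

(** [q] is the compactly supported defect of coercivity; its integral passes to the limit, which
    prevents the limit from vanishing. The last two conclusions are the dual form of psi and psi''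
    having L^2 norm at most 1, stated this way because [psi] is only known to be continuous here. *)
Lemma weak_solution c p r q (ka : R) : smooth p -> bdd p -> smooth r -> bdd r ->
  continuous q -> csupp q -> 0 < ka ->
  (forall u, admissible u -> 0 <= qform (fun=> c) p r u u) ->
  (forall u, admissible u ->
     ka * sqnorm u <= qform (fun=> c) p r u u + Rint (fun x => q x * j0 u x ^+ 2)) ->
  (forall e, 0 < e -> exists u, [/\ admissible u, sqnorm u = 1 &
     qform (fun=> c) p r u u < e]) ->
  exists psi : R -> R, [/\ continuous psi, exists x, psi x <> 0,
    forall phi, test_fun phi -> Rint (fun x => psi x * elop c p r phi x) = 0,
    forall phi, test_fun phi ->
      Rint (fun x => psi x * phi x) ^+ 2 <= Rint (fun x => phi x ^+ 2) &
    forall phi, test_fun phi ->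
      Rint (fun x => psi x * derive1n 2 phi x) ^+ 2 <= Rint (fun x => phi x ^+ 2)].
Proof.
move=> sp bp sr br cq sq ka0 pos coer min.
have pick n : exists u, [/\ admissible u, sqnorm u = 1 &
    qform (fun=> c) p r u u < n.+1%:R^-1].
  by apply: min; rewrite invr_gt0 ltr0n.
have [u Hu] := choice pick.
have au n : admissible (u n) by case: (Hu n).
have norms n : [/\ Rint (fun x => j0 (u n) x ^+ 2) <= 1,
    Rint (fun x => j1 (u n) x ^+ 2) <= 1 & Rint (fun x => j2 (u n) x ^+ 2) <= 1].
  have [_ + _] := Hu n; rewrite sqnormE//.
  have h0 : 0 <= Rint (fun x => j0 (u n) x ^+ 2) by apply: Rint_ge0 => x; exact: sqr_ge0.
  have h1 : 0 <= Rint (fun x => j1 (u n) x ^+ 2) by apply: Rint_ge0 => x; exact: sqr_ge0.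
  have h2 : 0 <= Rint (fun x => j2 (u n) x ^+ 2) by apply: Rint_ge0 => x; exact: sqr_ge0.
  by split; lra.
(* Unit norms and the Sobolev inequality bound the squares of u and u' by 3; the bound 2 on u'
   becomes the Lipschitz constant. *)
have le2 (x : R) : x ^+ 2 <= 2 * 1 + 1 -> `|x| <= 2.
  move=> H; have H2 : `|x| ^+ 2 <= 2 ^+ 2 by rewrite real_normK ?num_real//; lra.
  by move: H2; rewrite ler_pXn2r// nnegrE.
have ub0 n x : `|j0 (u n) x| <= 2.
  have [du du' cu [Lu Lu1 Lu2]] := au n; have [n0 n1 n2] := norms n.
  apply: le2; apply: le_trans (sobolev x du (isder_continuous du') Lu Lu1) _.
  by rewrite lerD// ler_wpM2l.
have ub1 n x : `|j1 (u n) x| <= 2.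
  have [du du' cu [Lu Lu1 Lu2]] := au n; have [n0 n1 n2] := norms n.
  apply: le2; apply: le_trans (sobolev x du' cu Lu1 Lu2) _.
  by rewrite lerD// ler_wpM2l.
have [|psi [s [ks psiL cvs]]] := lipschitz_selection ub0 (L := 2).
  by move=> n x y; have [du _ _ _] := au n; exact: isder_lipschitz du (ub1 n) x y.
have cpsi : continuous psi.
  move=> x; apply/cvgrPdist_lt => e e0; near=> y.
  apply: le_lt_trans (psiL x y) _; rewrite -ltr_pdivlMl//.
  by near: y; apply: (nbhsx_ballx x (2^-1 * e)); rewrite mulr_gt0.
pose v k := j0 (u (s k)).
have av k : admissible (u (s k)) by [].
have cv k : continuous (v k) by have [du _ _ _] := av k; exact: isder_continuous du.
have inv_le k : (s k).+1%:R^-1 <= k.+1%:R^-1 :> R.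
  by rewrite lef_pV2 ?posrE ?ltr0n// ler_nat ltnS.
have dom phi : continuous phi -> csupp phi ->
    Rint (fun x => v k x * phi x) @[k --> \oo] --> Rint (fun x => psi x * phi x).
  move=> cphi sphi; apply: (@Rint_dominated _ _ _ (fun x => 2 * `|phi x|)).
  - by move=> k; exact: continuous_meas (contM (cv k) cphi).
  - exact: continuous_meas (contM cpsi cphi).
  - by apply: intbleZ; apply: intble_abs; exact: intble_csupp.
  - by apply: aeW => x; apply: cvgMl; exact: cvs.
  - by move=> k x; rewrite normrM ler_wpM2r//; exact: ub0.
have cvg_le (a : nat -> R) (l M : R) : a k @[k --> \oo] --> l ->
    (forall k, a k <= M) -> l <= M.
  move=> al aM; rewrite -(cvg_lim (@Rhausdorff R) al).
  by apply: limr_le; [apply/cvg_ex; exists l|exact: nearW].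
exists psi; split => //.
(* If [psi] vanished, both the form and the integral of [q] times the square would fall below ka/2
   along the sequence, against coercivity on the unit sphere. *)
- apply: contrapT => Hn.
  have psi0x x : psi x = 0 by apply: contrapT => H; apply: Hn; exists x.
  have : Rint (fun x => q x * v k x ^+ 2) @[k --> \oo] --> Rint (fun x : R => 0).
    apply: (@Rint_dominated _ _ _ (fun x => 4 * `|q x|)).
    + move=> k; have H := contM cq (contM (cv k) (cv k)).
      by apply: continuous_meas; under eq_fun do rewrite expr2; exact: H.
    + exact: measurable_cst.
    + by apply: intbleZ; apply: intble_abs; exact: intble_csupp.
    + apply: aeW => x; rewrite -(mulr0 (q x)); apply: cvgMr.
      by have := cvg_sqr (cvs x); rewrite psi0x expr0n.
    + move=> k x; rewrite normrM mulrC ler_wpM2r// normrX.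
      rewrite (_ : 4 = 2 ^+ 2); last by ring.
      by rewrite lerXn2r// ?nnegrE//; exact: ub0.
  rewrite Rint_zero => /cvgr0Pnorm_lt H.
  have ka2 : 0 < ka / 2 by lra.
  near \oo => k.
  have h1 : `|Rint (fun x => q x * v k x ^+ 2)| < ka / 2 by near: k; exact: H.
  have h2 : k.+1%:R^-1 < ka / 2 :> R.
    by near: k; exact: near_infty_natSinv_lt (PosNum ka2).
  have [_ n1 Q1] := Hu (s k); have := coer _ (av k); rewrite n1 -/(v k) => h3.
  have := ler_norm (Rint (fun x => q x * v k x ^+ 2)); have := inv_le k.
  move: h1 h2 Q1 h3; move: (Rint _) (qform _ _ _ _ _) (k.+1%:R^-1) ((s k).+1%:R^-1).
  by move=> F Q a b h1 h2 Q1 h3; lra.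
- move=> phi tp; have tL := test_elop c sp sr tp.
  have H := dom _ (test_continuous tL) (test_csupp tL).
  have H2 : Rint (fun x => v k x * elop c p r phi x) ^+ 2 @[k --> \oo] --> (0 : R).
    apply: (@squeeze_cvgr _ _ _ _ (fun=> 0)
      (fun k => k.+1%:R^-1 * qform (fun=> c) p r (jet_of phi) (jet_of phi))).
    + near=> k; rewrite sqr_ge0/= /v -qform_test//.
      apply: le_trans (qform_CS (bdd_cst c) bp br (av k) (admissible_test tp) pos) _.
      apply: ler_wpM2r; first exact/pos/admissible_test.
      by apply: le_trans (inv_le k); apply: ltW; have [] := Hu (s k).
    + exact: cvg_cst.
    + rewrite -(mul0r (qform (fun=> c) p r (jet_of phi) (jet_of phi))).
      by apply: cvgMl; exact: cvg_harmonic.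
  have E := cvg_unique (@Rhausdorff R) (cvg_sqr H) H2.
  by apply/eqP; rewrite -sqrf_eq0; apply/eqP; exact: E.
- move=> phi tp; have H := dom _ (test_continuous tp) (test_csupp tp).
  apply: cvg_le (cvg_sqr H) _ => k.
  have [_ _ _ [Lu _ _]] := av k; have [n0 _ _] := norms (s k).
  apply: le_trans (Rint_CS Lu (L2_test tp)) _.
  by rewrite ler_piMl// Rint_ge0// => x; exact: sqr_ge0.
- move=> phi tp; have t2 := test_derive1n 2 tp.
  have H := dom _ (test_continuous t2) (test_csupp t2).
  apply: cvg_le (cvg_sqr H) _ => k.
  have [du du' cu [_ _ Lu]] := av k; have [_ _ n2] := norms (s k).
  have e1 := @by_parts_testn _ _ phi 0 du' cu tp.
  have e2 := @by_parts_testn _ _ phi 1 du (isder_continuous du') tp.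
  have <- : Rint (fun x => j2 (u (s k)) x * phi x) =
      Rint (fun x => v k x * derive1n 2 phi x).
    exact: (etrans e1 (etrans (congr1 -%R e2) (opprK _))).
  apply: le_trans (Rint_CS Lu (L2_test tp)) _.
  by rewrite ler_piMl// Rint_ge0// => x; exact: sqr_ge0.
Unshelve. all: by end_near. Qed.

End WeakSolution.

(** * Regularity and square integrability of weak solutions *)

Section Regularity.
Set Implicit Arguments. Unset Strict Implicit. Unset Printing Implicit Defensive.
Variable R : realType.
Local Notation Rint := Defs.Rint.
Local Notation mu := (@lebesgue_measure R).
Implicit Types f g h : R -> R.
Implicit Types p r phi psi : R -> R.

Lemma iterated_antiderivative h : continuous h ->
  exists H : nat -> R -> R, H 0%N = h /\ forall i, isder (H i.+1) (H i).
Proof.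
move=> ch.
(* A total antiderivative operator with a dummy value on discontinuous functions, which the iterates
   of [h] never meet. *)
have pick f : exists F, continuous f -> isder F f.
  have [cf|ncf] := pselect (continuous f); last by exists f.
  by have [F Ff] := antiderivative cf; exists F.
have [I HI] := choice pick.
exists (fun i => iter i I h); split=> // i.
by elim: i => [|i IH]; apply: HI => //; exact: isder_continuous IH.
Qed.

Lemma by_parts_iter (H : nat -> R -> R) phi n k : continuous (H 0%N) ->
  (forall i, isder (H i.+1) (H i)) -> test_fun phi ->
  Rint (fun x => H k x * derive1n (n + k) phi x) =
  (-1) ^+ k * Rint (fun x => H 0%N x * derive1n n phi x).
Proof.
move=> c0 Hd tp; elim: k => [|k IH]; first by rewrite addn0 expr0 mul1r.
have ck : continuous (H k) by case: (k) => // j; exact: isder_continuous (Hd j).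
have E := @by_parts_testn _ _ _ phi (n + k) (Hd k) ck tp.
rewrite addnS exprS mulN1r mulNr -IH E opprK.
by [].
Qed.

Lemma elop_test_expand c p r phi x : smooth p -> test_fun phi ->
  elop c p r phi x = c * derive1n 4 phi x - derive1 p x * derive1n 1 phi x -
    p x * derive1n 2 phi x + r x * phi x.
Proof.
move=> sp tp; rewrite /elop.
have d y := isdM (smooth_isder sp y) (smooth_isder (test_smooth (test_derive tp)) y).
have -> := isder_derive1 d.
by rewrite opprD addrA.
Qed.

(** Iterated antiderivatives of p psi, p' psi and r psi bring every lower order term to the fourth
    derivative of the test function, so c psi - A2 + B3 + D4 is annihilated by all fourth
    derivatives and is smooth by [du_bois_reymond]. Solving for psi and differentiating expresses
    psi' through psi and these antiderivatives, and the bootstrap closes. *)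
Lemma weak_smooth c p r psi : c != 0 -> smooth p -> smooth r -> continuous psi ->
  (forall phi, test_fun phi -> Rint (fun x => psi x * elop c p r phi x) = 0) ->
  smooth psi.
Proof.
move=> c0 sp sr cpsi weak.
have cp := smooth_continuous sp; have cr := smooth_continuous sr.
have sp' := smooth_derive1 sp; have cp' := smooth_continuous sp'.
have [A [A0 dA]] := iterated_antiderivative (contM cp cpsi).
have [B [B0 dB]] := iterated_antiderivative (contM cp' cpsi).
have [D [D0 dD]] := iterated_antiderivative (contM cr cpsi).
have cA i := isder_continuous (dA i); have cB i := isder_continuous (dB i).
have cD i := isder_continuous (dD i).
pose f (x : R) : R := c * psi x + (- 1) * A 2 x + B 3 x + D 4 x.
have cf : continuous f.
  apply: contD; last exact: cD.
  apply: contD; last exact: cB.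
  by apply: contD; apply: contM; try exact: cst_continuous; [exact: cpsi|exact: cA].
have sf : smooth f.
  apply: (@du_bois_reymond _ 4) => // phi tp.
  have t n := test_derive1n n tp.
  have cA0 : continuous (A 0%N) by rewrite A0; exact: contM.
  have cB0 : continuous (B 0%N) by rewrite B0; exact: contM.
  have cD0 : continuous (D 0%N) by rewrite D0; exact: contM.
  have EA : Rint (fun x => A 2 x * derive1n 4 phi x) = _ :=
    @by_parts_iter A phi 2 2 cA0 dA tp.
  have EB : Rint (fun x => B 3 x * derive1n 4 phi x) = _ :=
    @by_parts_iter B phi 1 3 cB0 dB tp.
  have ED : Rint (fun x => D 4 x * derive1n 4 phi x) =
    (-1) ^+ 4 * Rint (fun x => D 0 x * phi x) :=
    @by_parts_iter D phi 0 4 cD0 dD tp.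
  have := weak phi tp.
  rewrite (eq_Rint (fun x => congr1 _ (@elop_test_expand c p r phi x sp tp))).
  move: EA EB ED; rewrite A0 B0 D0.
  have i1 := intble_test cpsi (t 4%N).
  have i2 := intble_test (contM cp cpsi) (t 2%N).
  have i3 := intble_test (contM cp' cpsi) (t 1%N).
  have i4 := intble_test (contM cr cpsi) tp.
  have iA := intble_test (cA 1%N) (t 4%N).
  have iB := intble_test (cB 2%N) (t 4%N).
  have iD := intble_test (cD 3%N) (t 4%N).
  move: (derive1n 4 phi) (derive1n 2 phi) (derive1n 1 phi) i1 i2 i3 iA iB iD.
  move=> d4 d2 d1 i1 i2 i3 iA iB iD EA EB ED.
  rewrite (@eq_Rint _ _ (fun x => c * (psi x * d4 x) - derive1 p x * psi x * d1 x -
     p x * psi x * d2 x + r x * psi x * phi x)); last by move=> x; ring.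
  have i1c := intbleZ c i1; have i12 := intbleB i1c i3; have i123 := intbleB i12 i2.
  rewrite RintD// RintB// RintB// RintZ// => E.
  rewrite (@eq_Rint _ _ (fun x => c * (psi x * d4 x) - A 2 x * d4 x + B 3 x * d4 x +
     D 4 x * d4 x)); last by move=> x; rewrite /f; ring.
  have j1 := intbleB i1c iA; have j2 := intbleD j1 iB.
  by rewrite RintD// RintD// RintB// RintZ// EA EB ED -E; ring.
(* Generators of an algebra stable under differentiation: the antiderivatives differentiate into one
   another and end at [psi] times a smooth coefficient. *)
pose G g := [\/ g = psi, exists i, g = A i.+1, exists i, g = B i.+1 |
  exists i, g = D i.+1].
have gA i : gen G (A i).
  case: i => [|i]; last by apply: gen_base; apply: Or42; exists i.
  by rewrite A0; apply: gen_mul; [exact: gen_smooth|apply: gen_base; exact: Or41].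
have gB i : gen G (B i).
  case: i => [|i]; last by apply: gen_base; apply: Or43; exists i.
  by rewrite B0; apply: gen_mul; [exact: gen_smooth|apply: gen_base; exact: Or41].
have gD i : gen G (D i).
  case: i => [|i]; last by apply: gen_base; apply: Or44; exists i.
  by rewrite D0; apply: gen_mul; [exact: gen_smooth|apply: gen_base; exact: Or41].
apply: (@gen_is_smooth _ G); last by apply: gen_base; exact: Or41.
move=> _ [->|[i ->]|[i ->]|[i ->]]; last 3 first.
- by exists (A i).
- by exists (B i).
- by exists (D i).
exists (fun x => c^-1 * (derive1 f x + A 1 x + (-1) * B 2 x + (-1) * D 3 x)).
  move=> x.
  have -> : psi = fun x => c^-1 * (f x + A 2 x + (-1) * B 3 x + (-1) * D 4 x).
    apply/funext => y; rewrite /f; field.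
    exact: c0.
  apply: isdZ; apply: isdD; [apply: isdD; [apply: isdD|]|].
  - exact: smooth_isder.
  - exact: dA.
  - by apply: isdZ; exact: dB.
  - by apply: isdZ; exact: dD.
have gc k : gen G (fun=> k) by apply: gen_smooth; exact: smooth_cst.
apply: gen_mul => //; apply: gen_add; [apply: gen_add; [apply: gen_add|]|].
- by apply: gen_smooth; exact: smooth_derive1.
- exact: gA.
- by apply: gen_mul.
- by apply: gen_mul.
Qed.

Lemma elop_sym c p r psi phi : smooth p -> smooth r -> smooth psi -> test_fun phi ->
  Rint (fun x => elop c p r psi x * phi x) = Rint (fun x => psi x * elop c p r phi x).
Proof.
move=> sp sr spsi tp.
have s n : smooth (derive1n n psi) by exact: smooth_derive1n.
have d n : isder (derive1n n psi) (derive1n n.+1 psi) by exact: smooth_isder (s n).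
(* [e n] moves one derivative from psi^(4-n) to phi^(n); four uses transfer them all. *)
have e (n : nat) := @by_parts_testn R _ _ phi n (d (3 - n)%N)
  (smooth_continuous (s (3 - n).+1%N)) tp.
have e4 : Rint (fun x => derive1n 4 psi x * phi x) =
    Rint (fun x => psi x * derive1n 4 phi x).
  apply: (etrans (e 0%N)); apply: (etrans (congr1 -%R (e 1%N))).
  apply: (etrans (opprK _)); apply: (etrans (e 2%N)).
  by apply: (etrans (congr1 -%R (e 3%N))); exact: opprK.
have sf := smooth_flux sp spsi.
have tf := test_flux sp tp.
have e1 : Rint (fun x => derive1 (fun y => p y * derive1 psi y) x * phi x) =
    Rint (fun x => psi x * derive1 (fun y => p y * derive1 phi y) x).
  apply: (etrans (by_parts_test (smooth_isder sf)
    (smooth_continuous (smooth_derive1 sf)) tp)).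
  have := by_parts_test (smooth_isder spsi)
    (smooth_continuous (smooth_derive1 spsi)) tf.
  move=> /(congr1 -%R); rewrite opprK => <-; congr (- _).
  by apply: eq_Rint => x; ring.
have cpsi := smooth_continuous spsi.
have i1 := intble_test (smooth_continuous (s 4%N)) tp.
have i2 := intble_test (smooth_continuous (smooth_derive1 sf)) tp.
have i3 := intble_test (smooth_continuous (smoothM sr spsi)) tp.
have k1 := intble_test cpsi (test_derive1n 4 tp).
have k2 := intble_test cpsi (test_derive tf).
have k3 := intble_test cpsi (test_mull sr tp).
rewrite /elop; move: e4 e1 i1 i2 i3 k1 k2 k3.
move: (derive1n 4 psi) (derive1 (fun y => p y * derive1 psi y))
  (derive1n 4 phi) (derive1 (fun y => p y * derive1 phi y)).
move=> d4 fl d4' fl' e4 e1 i1 i2 i3 k1 k2 k3.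
rewrite (@eq_Rint _ _ (fun x => c * (d4 x * phi x) - fl x * phi x +
  r x * psi x * phi x)); last by move=> x; ring.
rewrite [RHS](@eq_Rint _ _ (fun x => c * (psi x * d4' x) - psi x * fl' x +
  psi x * (r x * phi x))); last by move=> x; ring.
have i1c := intbleZ c i1; have i12 := intbleB i1c i2.
have k1c := intbleZ c k1; have k12 := intbleB k1c k2.
rewrite RintD// RintB// RintZ// [RHS]RintD// RintB// RintZ// e4 e1; congr (_ + _).
by apply: eq_Rint => x; ring.
Qed.

Lemma weak_classical c p r psi : c != 0 -> smooth p -> smooth r -> continuous psi ->
  (forall phi, test_fun phi -> Rint (fun x => psi x * elop c p r phi x) = 0) ->
  smooth psi /\ forall x, elop c p r psi x = 0.
Proof.
move=> c0 sp sr cpsi weak; have spsi := weak_smooth c0 sp sr cpsi weak.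
split=> //; apply: fundamental_lemma.
  exact/smooth_continuous/smooth_elop.
by move=> phi tp; rewrite elop_sym//; exact: weak.
Qed.


End Regularity.

(** * Square integrability of the solution and of all its derivatives *)

Section SquareIntegrability.
Set Implicit Arguments. Unset Strict Implicit. Unset Printing Implicit Defensive.
Variable R : realType.
Local Notation Rint := Defs.Rint.
Local Notation mu := (@lebesgue_measure R).
Implicit Types f g h : R -> R.
Implicit Types p r phi psi : R -> R.

Lemma Rint_fatou (f_ : nat -> R -> R) f (C : R) :
  (forall n, intble (f_ n)) -> (forall n x, 0 <= f_ n x) ->
  (forall x, f_ n x @[n --> \oo] --> f x) -> (forall n, Rint (f_ n) <= C) ->
  (\int[mu]_x (f x)%:E < +oo)%E.
Proof.
move=> i_ f0 cv bd.
have := @fatou _ _ _ mu setT measurableT (fun n => EFin \o f_ n).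
have m_ n : measurable_fun setT (EFin \o f_ n).
  by have /intble_measurable/measurable_EFinP := i_ n.
move=> /(_ (fun n => m_ n)).
have f0' n x : setT x -> (0 <= (EFin \o f_ n) x)%E by rewrite lee_fin.
move=> /(_ f0') H.
have E : (\int[mu]_x (f x)%:E)%E =
    (\int[mu]_x limn_einf (fun n => (EFin \o f_ n) x))%E.
  apply: eq_integral => x _; apply/esym.
  have cvx : (EFin \o f_ n) x @[n --> \oo] --> (f x)%:E.
    by apply: cvg_EFin; [exact: nearW|exact: cv].
  by have [-> _] := cvg_limn_einf_sup cvx.
rewrite E; apply: le_lt_trans H _.
apply: (@le_lt_trans _ _ C%:E); last exact: ltry.
rewrite limn_einf_lim; apply: lime_le; first exact: is_cvg_einfs.
apply: nearW => n; apply: (@le_trans _ _ (\int[mu]_x (EFin \o f_ n) x)%E).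
  by apply: ereal_inf_lbound; exists n => /=.
by rewrite /= Rint_EFin// lee_fin.
Qed.

(** [hat] is not normalised, so the cutoffs tend to the positive constant [hat 0] rather than to
    1. *)
Definition cutoff (n : nat) (x : R) : R := hat (n.+1%:R^-1 * x + 0).

Lemma test_cutoff n : test_fun (cutoff n).
Proof. by apply: test_affine; [rewrite invr_neq0// pnatr_eq0|exact: test_hat]. Qed.

Lemma cutoff_ge0 n x : 0 <= cutoff n x. Proof. exact: hat_ge0. Qed.

Lemma cutoff_le1 n x : cutoff n x <= 1. Proof. exact: hat_le1. Qed.

Lemma cvg_cutoff x : cutoff n x @[n --> \oo] --> (hat 0 : R).
Proof.
have : (n.+1%:R^-1 * x + 0 : R) @[n --> \oo] --> (0 * x + 0 : R).
  apply: cvgD; last exact: cvg_cst.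
  by apply: cvgMl; exact: cvg_harmonic.
rewrite mul0r addr0 => H.
have cs : continuous (@hat R) by apply: smooth_continuous; exact: smooth_hat.
have H2 := cs 0.
exact: (cvg_comp (fun n : nat => n.+1%:R^-1 * x + 0) _ H H2).
Qed.


(** Fatou's lemma along the cutoffs; the limiting factor [hat 0] is divided out at the end. *)
Lemma L2_cutoff f (C : R) : continuous f ->
  (forall n, Rint (fun x => cutoff n x * f x ^+ 2) <= C) -> L2 f.
Proof.
move=> cf H; have h0 : 0 < hat (0 : R) by rewrite hat_gt0// normr0.
have cf2 : continuous (fun x => f x ^+ 2).
  by have := contM cf cf; under eq_fun do rewrite -expr2.
have i_ n : intble (fun x => cutoff n x * f x ^+ 2).
  have := intble_test cf2 (test_cutoff n).
  by under eq_fun do rewrite mulrC.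
have cvc x : cutoff n x * f x ^+ 2 @[n --> \oo] --> hat 0 * f x ^+ 2.
  by apply: cvgMl; exact: cvg_cutoff.
have := @Rint_fatou (fun n x => cutoff n x * f x ^+ 2)
  (fun x => hat 0 * f x ^+ 2) C i_ _ _ H.
move=> /(_ (fun n x => mulr_ge0 (cutoff_ge0 n x) (sqr_ge0 (f x)))).
move=> /(_ cvc) H2.
have mf := continuous_meas cf.
apply/L2P; split=> //.
have : intble (fun x => hat 0 * f x ^+ 2).
  apply/integrableP; split.
    by apply/measurable_EFinP; apply: measurable_funM => //; exact: measurable_funX.
  rewrite [ltLHS](_ : _ = (\int[mu]_x (hat 0 * f x ^+ 2)%:E)%E)//.
  by apply: eq_integral => x _ /=; rewrite ger0_norm// mulr_ge0 ?sqr_ge0// ltW.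
move=> /(intbleZ (hat 0)^-1).
by under eq_fun do rewrite mulKf ?gt_eqF//.
Qed.

(** Test with chi f for a cutoff chi. Writing a for the integral of chi f^2, the hypothesis and 0 <=
    chi <= 1 give a^2 <= a, hence a <= 1 whatever the cutoff. *)
Lemma L2_of_dual f : smooth f ->
  (forall phi, test_fun phi ->
     Rint (fun x => f x * phi x) ^+ 2 <= Rint (fun x => phi x ^+ 2)) -> L2 f.
Proof.
move=> sf H; apply: (@L2_cutoff _ 1); first exact: smooth_continuous.
move=> n; have tc := test_cutoff n.
have tcf : test_fun (fun x => cutoff n x * f x).
  have := test_mull sf tc.
  by under eq_fun do rewrite mulrC.
have cf := smooth_continuous sf.
have i1 : intble (fun x => cutoff n x * f x ^+ 2).
  have := intble_test cf tcf.
  by under eq_fun do rewrite mulrCA -expr2.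
have i2 : intble (fun x => (cutoff n x * f x) ^+ 2) by exact/L2_sqr/L2_test.
have := H _ tcf; under eq_Rint do rewrite mulrCA -expr2.
set a := Rint _ => h1.
have h2 : Rint (fun x => (cutoff n x * f x) ^+ 2) <= a.
  apply: le_Rint => // x; rewrite exprMn ler_wpM2r ?sqr_ge0// expr2.
  by rewrite ler_piMl// ?cutoff_ge0// cutoff_le1.
have h3 : a ^+ 2 <= a by exact: le_trans h1 h2.
rewrite leNgt; apply/negP => a1; nra.
Qed.

Lemma bdd_csupp f : continuous f -> csupp f -> bdd f.
Proof.
move=> cf /csuppP[K K0 HK]; split=> //.
have KK : - K <= K by lra.
have cn : {within `[- K, K], continuous (fun x => `|f x|)}.
  apply: continuous_subspaceT => x; apply: (cvg_norm (cf x)).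
have [c _ Hc] := EVT_max KK cn.
exists `|f c| => x; have [xK|xK] := ltP K `|x|; first by rewrite HK// normr0.
by apply: Hc; rewrite in_itv/= -ler_norml.
Qed.

(** For a cutoff chi, the integral of chi f'^2 is that of -chi f f'' plus half that of chi'' f^2.
    The second integration by parts removes the term f f' chi', which is not yet controlled; chi''
    is bounded uniformly in [n] by scaling. *)
Lemma L2_interpolation f : smooth f -> L2 f -> L2 (derive1n 2 f) -> L2 (derive1 f).
Proof.
move=> sf Lf Lf2.
have sf1 := smooth_derive1 sf.
have cf := smooth_continuous sf; have cf1 := smooth_continuous sf1.
have cf2 : continuous (derive1n 2 f) by exact/smooth_continuous/smooth_derive1n.
have [_ [M HM]] : bdd (derive1n 2 (@hat R)).
  have t2 := test_derive1n 2 (@test_hat R).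
  by apply: bdd_csupp; [exact: test_continuous|exact: test_csupp].
apply: (@L2_cutoff _ (Rint (fun x => `|f x * derive1n 2 f x|) +
  M * Rint (fun x => f x ^+ 2))) => // n.
have tc := test_cutoff n; have tc1 := test_derive tc; have tc2 := test_derive1n 2 tc.
have d1 x := isdM (smooth_isder sf x) (smooth_isder sf1 x).
have d2 x := isdM (smooth_isder sf x) (smooth_isder sf x).
have c1 := contD (contM cf1 cf1) (contM cf cf2).
have c2 := contD (contM cf1 cf) (contM cf cf1).
have E1 := by_parts_test d1 c1 tc.
have E2 := by_parts_test d2 c2 tc1.
have i1 := intble_test (contM cf1 cf1) tc.
have i2 := intble_test (contM cf cf2) tc.
have i3 := intble_test (contM cf cf1) tc1.
have i4 := intble_test (contM cf cf) tc2.
have i5 := L2_mul Lf Lf2; have i6 := L2_sqr Lf.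
have M2 x : `|derive1n 2 (cutoff n) x| <= M.
  rewrite (derive1n_affine _ _ _ (@smooth_hat R)) normrM.
  apply: le_trans (HM (n.+1%:R^-1 * x + 0)); rewrite ler_piMl//.
  by rewrite ger0_norm ?exprn_ge0// exprn_ile1// invf_le1// ler1n.
have B1 : - Rint (fun x => f x * derive1n 2 f x * cutoff n x) <=
    Rint (fun x => `|f x * derive1n 2 f x|).
  rewrite -RintN//; apply: le_Rint; [exact: intbleN|exact: intble_abs|].
  move=> x; apply: le_trans (ler_norm _) _; rewrite normrN normrM.
  by rewrite ler_piMr// ger0_norm ?cutoff_le1// cutoff_ge0.
have B2 : Rint (fun x => f x * f x * derive1n 2 (cutoff n) x) <=
    M * Rint (fun x => f x ^+ 2).
  rewrite -RintZ//; apply: le_Rint => //; first exact: intbleZ.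
  move=> x; rewrite -expr2 mulrC ler_wpM2r ?sqr_ge0//.
  exact: le_trans (ler_norm _) (M2 x).
have M0 : 0 <= M * Rint (fun x => f x ^+ 2).
  rewrite mulr_ge0 ?(le_trans _ (HM 0))//.
  by apply: Rint_ge0 => x; exact: sqr_ge0.
move: E1 E2 i1 i2 i3 i4 B1 B2.
change (derive1 (derive1 (cutoff n))) with (derive1n 2 (cutoff n)).
change (derive1 (derive1 f)) with (derive1n 2 f).
clear i5 HM M2 d1 d2 c1 c2 cf2 Lf2.
move: (derive1n 2 (cutoff n)) (derive1n 2 f) (derive1 (cutoff n)) (derive1 f).
move=> k2 f2 k1 f1 E1 E2 i1 i2 i3 i4 B1 B2.
have E1' : Rint (fun x => f1 x * f1 x * cutoff n x) +
   Rint (fun x => f x * f2 x * cutoff n x) = - Rint (fun x => f x * f1 x * k1 x).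
  by rewrite -RintD// -E1; apply: eq_Rint => x; rewrite mulrDl.
have E2' : 2 * Rint (fun x => f x * f1 x * k1 x) = - Rint (fun x => f x * f x * k2 x).
  by rewrite -E2 -RintZ//; apply: eq_Rint => x; ring.
have -> : Rint (fun x => cutoff n x * f1 x ^+ 2) = Rint (fun x => f1 x * f1 x * cutoff n x).
  by apply: eq_Rint => x; ring.
move: E1' E2' B1 B2 M0.
move: (Rint _) (Rint _) (Rint _) (Rint _) (M * _) => a b d e m.
lra.
Qed.

Definition smooth_bdd (b : R -> R) := smooth b /\ forall n, bdd (derive1n n b).

Lemma smooth_bdd_derive b : smooth_bdd b -> smooth_bdd (derive1 b).
Proof.
move=> [sb bb]; split; first exact: smooth_derive1.
by move=> n; rewrite -derive1n_Sr; exact: bb.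
Qed.

(** Combinations of derivatives up to order [m], with coefficients whose derivatives are all
    bounded: differentiation raises [m] by one, and the result is in L^2 as soon as those
    derivatives of [f] are. *)
Inductive dspan f (m : nat) : (R -> R) -> Prop :=
| dspan_term b j : smooth_bdd b -> (j <= m)%N -> dspan f m (fun x => b x * derive1n j f x)
| dspan_add g h : dspan f m g -> dspan f m h -> dspan f m (fun x => g x + h x).

Lemma dspan_derive f m g : smooth f -> dspan f m g ->
  exists2 g', isder g g' & dspan f m.+1 g'.
Proof.
move=> sf; elim=> [b j sb jm|g1 g2 _ [g1' d1 S1] _ [g2' d2 S2]].
- have [sb' _] := sb.
  exists (fun x => derive1 b x * derive1n j f x + b x * derive1n j.+1 f x).
    move=> x; apply: isdM; first exact: smooth_isder.
    exact/smooth_isder/smooth_derive1n.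
  apply: dspan_add; apply: dspan_term; [|exact: leqW|exact: sb|exact: jm].
  exact: smooth_bdd_derive.
- exists (fun x => g1' x + g2' x); first by move=> x; exact: isdD.
  exact: dspan_add.
Qed.

Lemma dspan_L2 f m g : (forall j, (j <= m)%N -> L2 (derive1n j f)) ->
  dspan f m g -> L2 g.
Proof.
move=> H; elim=> [b j [_ bb] jm|g1 g2 _ L1 _ L2']; last exact: L2D.
by apply: L2_bdd; [exact: (bb 0%N)|exact: H].
Qed.

(** Differentiating the equation expresses f^(4+k) through derivatives of order at most k + 2. Order
    4 follows at once; order 3, out of reach of the equation, is interpolated between orders 2 and
    4. *)
Lemma L2_derive1n f : smooth f -> L2 f -> L2 (derive1n 2 f) ->
  dspan f 2 (derive1n 4 f) -> forall k, L2 (derive1n k f).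
Proof.
move=> sf L0 L2' S4.
have L1 : L2 (derive1n 1 f) by exact: L2_interpolation.
have low j : (j <= 2)%N -> L2 (derive1n j f).
  rewrite leq_eqVlt ltnS leq_eqVlt ltnS leqn0.
  by move=> /or3P[|  |] /eqP->; [exact: L2'|exact: L1|exact: L0].
have L4 := dspan_L2 low S4.
have L3 : L2 (derive1n 3 f).
  exact: (@L2_interpolation _ (@smooth_derive1n R f 2 sf) L2' L4).
have Sk k : dspan f (2 + k) (derive1n (4 + k) f).
  elim: k => [//|k IH]; have [g' dg Sg] := dspan_derive sf IH.
  by rewrite !addnS derive1nS (isder_derive1 dg).
have all k : forall j, (j <= 3 + k)%N -> L2 (derive1n j f).
  elim: k => [|k IH] j.
    rewrite addn0 leq_eqVlt ltnS => /predU1P[->|]; [exact: L3|exact: low].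
  rewrite addnS leq_eqVlt => /predU1P[->|]; last by rewrite ltnS; exact: IH.
  apply: dspan_L2 (Sk k) => i ik; apply: IH; exact: leq_trans ik (leqnSn _).
by move=> k; apply: (all k); rewrite leq_addl.
Qed.

End SquareIntegrability.

(** * Mollification *)

Section Mollification.
Set Implicit Arguments. Unset Strict Implicit. Unset Printing Implicit Defensive.
Variable R : realType.
Local Notation Rint := Defs.Rint.
Local Notation mu := (@lebesgue_measure R).
Implicit Types f g h : R -> R.
Implicit Types k psi w : R -> R.

Lemma cont_shift f (c : R) : continuous f -> continuous (fun x => f (x - c)).
Proof.
move=> cf x; apply: (@continuous_comp _ _ _ (fun x => x - c) f); last exact: cf.
by apply: continuousB; [exact: cvg_id|exact: cvg_cst].
Qed.

Lemma csupp_shift f (c : R) : csupp f -> csupp (fun x => f (x - c)).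
Proof.
move=> [K HK]; exists (K + `|c|) => x xK; apply: HK.
by have := lerB_dist x c; lra.
Qed.

Lemma cont_reflect f (c : R) : continuous f -> continuous (fun x => f (c - x)).
Proof.
move=> cf x; apply: (@continuous_comp _ _ _ (fun x => c - x) f); last exact: cf.
by apply: continuousB; [exact: cvg_cst|exact: cvg_id].
Qed.

Lemma csupp_reflect f (c : R) : csupp f -> csupp (fun x => f (c - x)).
Proof.
move=> [K HK]; exists (K + `|c|) => x xK; apply: HK.
by have := lerB_dist x c; rewrite distrC; lra.
Qed.

Lemma Rint_shift f (c : R) : continuous f -> csupp f ->
  Rint (fun x => f (x - c)) = Rint f.
Proof.
move=> cf sf; have [K K0 HK] := csuppP sf.
have [F Ff] := antiderivative cf.
have Fo := antiderivative_csupp Ff cf HK K0.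
have cs := @cont_shift _ c cf; have ss := @csupp_shift _ c sf.
have i1 := intble_csupp cs ss; have i2 := intble_csupp cf sf.
apply/eqP; rewrite -subr_eq0 -RintB//; apply/eqP.
(* Far out, both terms equal the same limiting constant of [F], so this primitive has compact
   support. *)
apply: (@Rint_deriv0 _ (fun x => F (x - c) - F x)).
- by move=> x; apply: isdB; [apply: isd_shift; exact: Ff|exact: Ff].
- by apply: contD => // x; apply: continuousN; exact: cf.
- exists (K + 1 + `|c|) => x xK; have := ler_norm c; have := ler_norm (- c).
  rewrite normrN => c1 c2; have [x0|x0] := ltP x 0.
    move: xK; rewrite (ltr0_norm x0) => xK.
    by rewrite (Fo (x - c)).2 ?(Fo x).2 ?subrr//; lra.
  move: xK; rewrite (ger0_norm x0) => xK.
  by rewrite (Fo (x - c)).1 ?(Fo x).1 ?subrr//; lra.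
Qed.

Lemma Rint_reflect f (c : R) : continuous f -> csupp f ->
  Rint (fun x => f (c - x)) = Rint f.
Proof.
move=> cf sf; have [K K0 HK] := csuppP sf.
have [F Ff] := antiderivative cf.
have Fo := antiderivative_csupp Ff cf HK K0.
have cs := @cont_reflect _ c cf; have ss := @csupp_reflect _ c sf.
have i1 := intble_csupp cs ss; have i2 := intble_csupp cf sf.
apply/eqP; rewrite -subr_eq0 -RintB//; apply/eqP.
(* Reflection exchanges the two limiting constants of [F]; adding their sum makes the primitive
   vanish at both ends. *)
apply: (@Rint_deriv0 _ (fun x => F (K + 1) + F (- (K + 1)) - F (c - x) - F x)).
- move=> x; apply: isdB; last exact: Ff.
  have d : is_derive x (1:R) (fun y => F (c - y)) (- f (c - x)).
    have := @isd_aff_comp _ F (-1) c x (f (c - x)).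
    rewrite mulN1r addrC mulN1r => /(_ (Ff _)).
    by under eq_fun do rewrite mulN1r addrC.
  by apply: isd_eq (isdB (is_derive_cst _ x 1) d) _; rewrite sub0r opprK.
- by apply: contD => // x; apply: continuousN; exact: cf.
- exists (K + 1 + `|c|) => x xK; have := ler_norm c; have := ler_norm (- c).
  rewrite normrN => c1 c2; have [x0|x0] := ltP x 0.
    move: xK; rewrite (ltr0_norm x0) => xK.
    by rewrite (Fo (c - x)).1 ?(Fo x).2; lra.
  move: xK; rewrite (ger0_norm x0) => xK.
  by rewrite (Fo (c - x)).2 ?(Fo x).1; lra.
Qed.

(** Correlation rather than convolution: as a function of [y] the kernel is a translate of [k], so a
    weak derivative applies to it without a reflection. The sign appears instead when
    differentiating in [x]. *)
Definition corr k f (x : R) : R := Rint (fun y => f y * k (y - x)).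

Lemma test_shift k (x : R) : test_fun k -> test_fun (fun y => k (y - x)).
Proof.
move=> tk; have := @test_affine R k 1 (- x) (oner_neq0 _) tk.
by under eq_fun do rewrite mul1r.
Qed.

Lemma isder_corr k f : test_fun k -> L2 f ->
  isder (corr k f) (fun x => - corr (derive1 k) f x).
Proof.
move=> tk Lf a.
have mf : measurable_fun setT f by case: Lf.
have [K K0 HK] := csuppP (test_csupp (test_derive tk)).
have [_ [M HM]] := bdd_csupp (test_continuous (test_derive tk)) (test_csupp (test_derive tk)).
have M0 : 0 <= M by exact: le_trans (normr_ge0 _) (HM 0).
(* At least 1 within distance K + 1 of [a], which covers the support of the differentiated kernel
   for every [x] within 1 of [a]. Its compact support makes the dominating function integrable
   although [f] is only in L^2. *)
pose tent (y : R) : R := Num.max 0 (K + 2 - `|y - a|).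
have ctent : continuous tent.
  move=> y; apply: (@continuous_max R R (cst 0) (fun y => K + 2 - `|y - a|)).
    exact: cvg_cst.
  apply: continuousB; first exact: cvg_cst.
  apply: (@cvg_norm _ R^o); apply: continuousB; [exact: cvg_id|exact: cvg_cst].
have stent : csupp tent.
  exists (K + 2 + `|a|) => y yK; rewrite /tent max_l// subr_le0.
  have := lerB_dist y a; lra.
have Ltent := L2_csupp ctent stent.
have dk x y : is_derive x (1:R) (fun x => f y * k (y - x)) (f y * - derive1 k (y - x)).
  apply: isdZ; have := @isd_aff_comp _ k (-1) y x (derive1 k (y - x)).
  rewrite mulN1r addrC mulN1r => /(_ (smooth_isder (test_smooth tk) _)).
  by under eq_fun do rewrite mulN1r addrC.
have int_f x : intble (fun y => f y * k (y - x)).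
  by apply: L2_mul => //; apply: L2_test; exact: test_shift.
pose G (y : R) : R := M * `|f y * tent y|.
have iG : intble G by apply: intbleZ; apply: intble_abs; exact: L2_mul.
have aI : `]a - 1, a + 1[%classic a by rewrite /= in_itv/=; lra.
have G0 y : 0 <= G y by rewrite mulr_ge0.
have dG x y : `]a - 1, a + 1[%classic x -> setT y ->
    `|partial1of2 (fun x y => f y * k (y - x)) x y| <= G y.
  move=> /=; rewrite in_itv/= => /andP[x1 x2] _.
  rewrite partial1of2E; have [_ ->] := dk x y.
  rewrite /G !normrM normrN [leRHS]mulrCA ler_wpM2l//.
  have [yK|yK] := ltP K `|y - x|; first by rewrite HK// normr0 mulr_ge0.
  apply: le_trans (HM _) _; rewrite ler_peMr//.
  have : `|y - a| <= K + 1.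
    apply: le_trans (ler_distD x y a) _; rewrite lerD//.
    by rewrite ler_norml; lra.
  move=> ya; rewrite /tent max_r; last lra.
  by rewrite ger0_norm; lra.
have der x y : `]a - 1, a + 1[%classic x -> setT y ->
    derivable (fun x => f y * k (y - x)) x 1.
  by move=> _ _; have [] := dk x y.
have int_f' x : `]a - 1, a + 1[%classic x ->
    mu.-integrable setT (EFin \o (fun y => f y * k (y - x))) by move=> _; exact: int_f.
have D1 := differentiation_under_integral measurableT aI int_f' der G0 iG dG.
have D2 := derivable_under_integral measurableT aI int_f' der G0 iG dG.
have Lk : intble (fun y => f y * derive1 k (y - a)).
  apply: L2_mul => //; apply: L2_test; apply: test_shift; exact: test_derive.
apply: DeriveDef; first exact: D2.
rewrite -derive1E; apply: etrans D1 _.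
rewrite -RintN//; apply: eq_Rint => y.
by rewrite partial1of2E; have [_ ->] := dk a y; rewrite mulrN.
Qed.

(** Tonelli: integrating first in [x], the kernel contributes its full mass, by reflection. *)
Lemma Young_sqr k f : continuous k -> csupp k -> (forall x, 0 <= k x) -> L2 f ->
  intble (fun x => Rint (fun y => f y ^+ 2 * k (y - x))) /\
  Rint (fun x => Rint (fun y => f y ^+ 2 * k (y - x))) =
    Rint k * Rint (fun y => f y ^+ 2).
Proof.
move=> ck sk k0 Lf; have f2 := L2_sqr Lf.
have mf : measurable_fun setT f by case: Lf.
have [_ [M HM]] := bdd_csupp ck sk.
have mkx x : measurable_fun setT (fun y : R => k (y - x)).
  by apply: continuous_meas; exact: cont_shift.
have i_ x : intble (fun y => f y ^+ 2 * k (y - x)).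
  have := @intble_mulb R (fun y => f y ^+ 2) (fun y => k (y - x)) M (mkx x) _ f2.
  by under eq_fun do rewrite mulrC; apply.
pose F (z : R * R) := (f z.2 ^+ 2 * k (z.2 - z.1))%:E.
have mF : measurable_fun setT F.
  apply/measurable_EFinP; apply: measurable_funM.
    by apply: measurable_funX; apply: measurableT_comp.
  apply: (measurableT_comp (continuous_meas ck)).
  by apply: measurable_funB; [exact: measurable_snd|exact: measurable_fst].
have F0 z : (0 <= F z)%E by rewrite lee_fin mulr_ge0// sqr_ge0.
pose h x := Rint (fun y => f y ^+ 2 * k (y - x)).
have h0 x : 0 <= h x by apply: Rint_ge0 => y; rewrite mulr_ge0 ?sqr_ge0.
have hE x : (\int[mu]_y F (x, y))%E = (h x)%:E by rewrite -Rint_EFin.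
have mh : measurable_fun setT (EFin \o h).
  have := @measurable_fun_fubini_tonelli_F _ _ _ _ _ mu F mF F0.
  by apply: eq_measurable_fun => x _; rewrite /fubini_F hE.
have Ih : (\int[mu]_x (h x)%:E)%E = (Rint k * Rint (fun y => f y ^+ 2))%:E.
  under eq_integral do rewrite -hE.
  rewrite (@fubini_tonelli _ _ _ _ _ mu mu F mF F0).
  transitivity (\int[mu]_y (Rint k * f y ^+ 2)%:E)%E.
    apply: eq_integral => y _.
    have ir : intble (fun x => k (y - x)).
      by apply: intble_csupp; [exact: cont_reflect|exact: csupp_reflect].
    by rewrite /F/= Rint_EFin ?RintZ// ?Rint_reflect 1?mulrC//; exact: intbleZ.
  by rewrite Rint_EFin ?RintZ//; exact: intbleZ.
have ih : intble h.
  apply/integrableP; split=> //.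
  have -> : (\int[mu]_x `|(EFin \o h) x|)%E = (\int[mu]_x (h x)%:E)%E.
    by apply: eq_integral => x _ /=; rewrite ger0_norm.
  by rewrite Ih ltry.
split=> //; apply/EFin_inj; rewrite -Ih -Rint_EFin//.
Qed.

(** Cauchy-Schwarz for the measure of density |k(y - x)|. The nonnegative quadratic is the integral
    of |k| (1 + t f)^2 where [k >= 0] and of |k| (1 - t f)^2 where [k < 0]. *)
Lemma corr_sqr_le k f x : continuous k -> csupp k -> L2 f ->
  corr k f x ^+ 2 <=
  Rint (fun y => `|k y|) * Rint (fun y => f y ^+ 2 * `|k (y - x)|).
Proof.
move=> ck sk Lf; have f2 := L2_sqr Lf.
have ckx := @cont_shift _ x ck; have skx := @csupp_shift _ x sk.
have cak : continuous (fun y => `|k y|) by move=> y; apply: (cvg_norm (ck y)).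
have sak : csupp (fun y => `|k y|).
  by move: sk => [K HK]; exists K => y yK; rewrite HK// normr0.
rewrite -(@Rint_shift _ x cak sak).
have i1 : intble (fun y => `|k (y - x)|) by apply: intble_abs; exact: intble_csupp.
have i2 : intble (fun y => f y * k (y - x)) by apply: L2_mul => //; exact: L2_csupp.
have i3 : intble (fun y => f y ^+ 2 * `|k (y - x)|).
  have bk : bdd (fun y => `|k (y - x)|).
    by apply: bdd_csupp; [exact: (@cont_shift _ x cak)|exact: (@csupp_shift _ x sak)].
  by have := intble_bdd bk f2; under eq_fun do rewrite mulrC.
apply: quadratic_CS.
- by apply: Rint_ge0 => y.
- by apply: Rint_ge0 => y; rewrite mulr_ge0 ?sqr_ge0.
move=> t; have j2 := intbleZ (2 * t) i2; have j3 := intbleZ (t ^+ 2) i3.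
rewrite /corr -!RintZ// -RintD// -RintD//; last exact: intbleD.
apply: Rint_ge0 => y.
have [ky|ky] := leP 0 (k (y - x)).
  rewrite (ger0_norm ky); have := mulr_ge0 ky (sqr_ge0 (1 + t * f y)); nra.
have ky' : 0 <= - k (y - x) by rewrite oppr_ge0 ltW.
rewrite (ltr0_norm ky); have := mulr_ge0 ky' (sqr_ge0 (1 - t * f y)); nra.
Qed.

(** Young's inequality for L^1 and L^2. Kernels of variable sign are allowed because derivatives of
    the mollifier are used as kernels too. *)
Lemma corr_L2 k f : test_fun k -> L2 f ->
  L2 (corr k f) /\ Rint (fun x => corr k f x ^+ 2) <=
    Rint (fun y => `|k y|) ^+ 2 * Rint (fun y => f y ^+ 2).
Proof.
move=> tk Lf; have ck := test_continuous tk; have sk := test_csupp tk.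
have cak : continuous (fun y => `|k y|) by move=> y; apply: (cvg_norm (ck y)).
have sak : csupp (fun y => `|k y|).
  by move: sk => [K HK]; exists K => y yK; rewrite HK// normr0.
have [ih Eh] := Young_sqr cak sak (fun x => normr_ge0 _) Lf.
have le1 x := corr_sqr_le x ck sk Lf.
have mc : measurable_fun setT (corr k f).
  exact: continuous_meas (isder_continuous (isder_corr tk Lf)).
have jh := intbleZ (Rint (fun y => `|k y|)) ih.
have i2 : intble (fun x => corr k f x ^+ 2).
  apply: le_intble jh; first exact: measurable_funX.
  by move=> x; rewrite ger0_norm ?sqr_ge0.
split; first by apply/L2P.
by rewrite expr2 -mulrA -Eh -RintZ//; exact: le_Rint i2 jh le1.
Qed.

End Mollification.

(** * Convergence of mollifications at Lebesgue points *)

Section Approximation.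
Set Implicit Arguments. Unset Strict Implicit. Unset Printing Implicit Defensive.
Variable R : realType.
Local Notation Rint := Defs.Rint.
Local Notation mu := (@lebesgue_measure R).
Implicit Types f g h : R -> R.
Implicit Types k psi w : R -> R.

Definition mollifier (n : nat) (x : R) : R :=
  n.+1%:R / Rint (@hat R) * hat (n.+1%:R * x + 0).

Lemma test_mollifier n : test_fun (mollifier n).
Proof. by apply: testZ; apply: test_affine; [rewrite pnatr_eq0|exact: test_hat]. Qed.

Lemma mollifier_ge0 n x : 0 <= mollifier n x.
Proof. by rewrite mulr_ge0 ?hat_ge0// divr_ge0// ltW// Rint_hat_gt0. Qed.

Lemma mollifier_le n x : mollifier n x <= n.+1%:R / Rint (@hat R).
Proof.
by rewrite ler_piMr ?hat_le1// divr_ge0// ltW// Rint_hat_gt0.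
Qed.

Lemma mollifier_out n x : n.+1%:R^-1 <= `|x| -> mollifier n x = 0.
Proof.
move=> xn; rewrite /mollifier hat_out ?mulr0// addr0 normrM ger0_norm//.
by rewrite -ler_pdivrMl ?ltr0n// mulr1.
Qed.

Lemma Rint_mollifier n : Rint (mollifier n) = 1.
Proof.
have i0 := @Rint_hat_gt0 R.
have th := @test_hat R; have ch := test_continuous th.
have ta : test_fun (fun x => hat (n.+1%:R * x + 0) : R).
  by apply: test_affine => //; rewrite pnatr_eq0.
have ia := intble_testT ta; have ih := intble_testT th.
suff E : n.+1%:R * Rint (fun x => hat (n.+1%:R * x + 0)) = Rint (@hat R).
  by rewrite RintZ// mulrAC E mulfV// gt_eqF.
have [F Ff] := antiderivative ch.
have HK (x : R) : 1 < `|x| -> hat x = 0 by move=> /ltW; exact: hat_out.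
have Fo := antiderivative_csupp Ff ch HK ltr01.
have n1 : 1 <= n.+1%:R :> R by rewrite ler1n.
apply/eqP; rewrite -subr_eq0 -RintZ// -RintB//; last exact: intbleZ.
(* Dilation preserves the limiting constants of [F] on each side, so the difference has compact
   support. *)
apply/eqP; apply: (@Rint_deriv0 _ (fun x => F (n.+1%:R * x + 0) - F x)).
- by move=> x; apply: isdB; [apply: isd_aff_comp; exact: Ff|exact: Ff].
- apply: contD => [|x]; last by apply: continuousN; exact: ch.
  by apply: contM; [exact: cst_continuous|exact: test_continuous ta].
- exists 2 => x x2; rewrite addr0; have [x0|x0] := ltP x 0.
    move: x2; rewrite (ltr0_norm x0) => x2.
    rewrite (Fo x).2; last lra.
    by rewrite (Fo (n.+1%:R * x)).2 ?subrr//; nra.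
  move: x2; rewrite (ger0_norm x0) => x2.
  rewrite (Fo x).1; last lra.
  by rewrite (Fo (n.+1%:R * x)).1 ?subrr//; nra.
Qed.

Lemma L2_locally_integrable f : L2 f -> locally_integrable setT f.
Proof.
move=> Lf; have [mf _] := Lf; split=> //; first exact: openT.
move=> K _ cK.
have mK : measurable K by exact: compact_measurable.
have fK : (mu K < +oo)%E by exact: compact_finite_measure.
apply: (@le_lt_trans _ _ (\int[mu]_(x in K) (1 + f x ^+ 2)%:E)%E).
  apply: ge0_le_integral => //.
    - by apply: measurable_funTS; apply/measurable_EFinP; exact: measurableT_comp.
  - apply: measurable_funTS; apply/measurable_EFinP; apply: measurable_funD => //.
    exact: measurable_funX.
  - move=> x _; rewrite lee_fin; have := sqr_ge0 (`|f x| - 1).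
    by have := real_normK (num_real (f x)); nra.
have h1 : mu.-integrable K (EFin \o (fun=> 1 : R)).
  by apply: continuous_compact_integrable => //; apply: continuous_subspaceT; exact: cst_continuous.
have h2 : mu.-integrable K (EFin \o (fun x => f x ^+ 2)).
  exact: integrableS (L2_sqr Lf).
have h3 := @integrableD _ _ _ mu K mK _ _ h1 h2.
have h := @integrable_fin_num _ _ _ mu K mK _ h3.
rewrite -ge0_fin_numE; first exact: h.
by apply: integral_ge0 => x _; rewrite lee_fin addr_ge0// sqr_ge0.
Qed.

(** The kernel is at most (n+1)/I0 on a ball of radius 1/(n+1), whose measure is 2/(n+1). The error
    is thus at most 2/I0 times the mean oscillation over that ball, which tends to 0 at a Lebesgue
    point. *)
Lemma cvg_mollifier psi x : L2 psi -> lebesgue_pt psi x ->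
  corr (mollifier n) psi x @[n --> \oo] --> psi x.
Proof.
move=> Lpsi; rewrite /lebesgue_pt => lx.
have mpsi : measurable_fun setT psi by case: Lpsi.
have lim0 : davg psi x n.+1%:R^-1 @[n --> \oo] --> 0%E.
  apply: (cvg_comp (fun n : nat => n.+1%:R^-1 : R) _ _ lx) => P [e /= e0 He].
  near=> n; apply: He => /=; last by rewrite invr_gt0 ltr0n.
  rewrite sub0r normrN ger0_norm ?invr_ge0//.
  by near: n; exact: near_infty_natSinv_lt (PosNum e0).
pose I0 := Rint (@hat R); have I0_gt0 : 0 < I0 := @Rint_hat_gt0 R.
have key n : (`|corr (mollifier n) psi x - psi x|%:E <=
    (2 / I0)%:E * davg psi x n.+1%:R^-1)%E.
  set e : R := n.+1%:R^-1; have e0 : 0 < e by rewrite invr_gt0 ltr0n.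
  have tk := test_mollifier n.
  have tkx := test_shift x tk.
  have i1 : intble (fun y => psi y * mollifier n (y - x)) by apply: L2_mul => //; exact: L2_test.
  have i2 : intble (fun y => psi x * mollifier n (y - x)) by apply: intbleZ; exact: intble_testT.
  have i3 := intbleB i1 i2.
  have -> : corr (mollifier n) psi x - psi x =
      Rint (fun y => psi y * mollifier n (y - x) - psi x * mollifier n (y - x)).
    rewrite RintB// RintZ; last exact: intble_testT.
    rewrite (@Rint_shift R (mollifier n) x (test_continuous tk) (test_csupp tk)).
    by rewrite Rint_mollifier mulr1.
  apply: (@le_trans _ _ (Rint (fun y =>
    `|psi y * mollifier n (y - x) - psi x * mollifier n (y - x)|))%:E).
    by rewrite lee_fin; exact: le_norm_Rint.
  rewrite -Rint_EFin; last exact: intble_abs.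
  have mB : measurable (ball x e) by exact: measurable_ball.
  have mg : measurable_fun setT (fun y => `|psi y - psi x|%:E).
    apply/measurable_EFinP; apply: measurableT_comp => //.
    by apply: measurable_funB.
  have E : ((2 / I0)%:E * davg psi x e =
      (n.+1%:R / I0)%:E * \int[mu]_(y in ball x e) `|psi y - psi x|%:E)%E.
    rewrite /davg /iavg (lebesgue_measure_ball x (ltW e0)) inver.
    rewrite gt_eqF; last by rewrite mulrn_wgt0.
    rewrite muleA -EFinM; congr (_ * _)%E.
    have N0 : n.+1%:R != 0 :> R by rewrite pnatr_eq0.
    have J0 : I0 != 0 by rewrite gt_eqF.
    rewrite /e; congr EFin; move: N0; move: (n.+1%:R) => N N0.
    by field; rewrite N0 J0.
  rewrite E -ge0_integralZl//; last 2 first.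
  - exact: measurable_funTS.
  - by rewrite lee_fin divr_ge0// ltW.
  rewrite [leRHS]integral_mkcond; apply: ge0_le_integral => //.
  - apply/measurable_EFinP; apply: measurableT_comp => //.
    exact: intble_measurable i3.
  - apply: (measurable_restrictT _ mB).1; apply: measurable_funTS.
    exact: measurable_funeM.
  move=> y _; rewrite patchE; case: ifPn => [_|yB].
    rewrite -EFinM lee_fin -mulrBl normrM mulrC ler_wpM2r//.
    by rewrite ger0_norm ?mollifier_ge0// mollifier_le.
  rewrite mollifier_out ?mulr0 ?subrr ?normr0// leNgt; apply: contra yB => yB.
  by rewrite inE /ball/= distrC.
have /fine_cvgP[fin /cvgr0Pnorm_lt lim] := lim0.
apply/cvgrPdist_lt => d d0.
have C0 : 0 < 2 / I0 by rewrite divr_gt0.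
have dC : 0 < d / (2 / I0) by rewrite divr_gt0.
near=> n.
have h1 : davg psi x n.+1%:R^-1 \is a fin_num by near: n; exact: fin.
have h2 : `|fine (davg psi x n.+1%:R^-1)| < d / (2 / I0).
  by near: n; exact: lim _ dC.
have := key n; rewrite -(fineK h1) -EFinM lee_fin distrC => h3.
apply: le_lt_trans h3 _; rewrite mulrC -ltr_pdivlMr//.
exact: le_lt_trans (ler_norm _) h2.
Unshelve. all: by end_near. Qed.

End Approximation.

(** * Replacing a weak Sobolev function by a C^2 one in a strict inequality *)

Section Core.
Set Implicit Arguments. Unset Strict Implicit. Unset Printing Implicit Defensive.
Variable R : realType.
Local Notation Rint := Defs.Rint.
Local Notation mu := (@lebesgue_measure R).
Implicit Types f g h : R -> R.
Implicit Types k psi w rho q : R -> R.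

Lemma derive1n_shift k (x : R) j : smooth k ->
  derive1n j (fun y => k (y - x)) = fun y => derive1n j k (y - x).
Proof.
move=> sk; have := @derive1n_affine R k 1 (- x) j sk.
under eq_fun do rewrite mul1r; move=> ->.
by apply/funext => y; rewrite expr1n !mul1r.
Qed.

Lemma corr_weak_deriv j k psi w x : test_fun k -> L2 w -> weak_deriv j psi w ->
  corr (derive1n j k) psi x = (-1) ^+ j * corr k w x.
Proof.
move=> tk Lw /(_ _ (test_shift x tk)) /(congr1 fine).
rewrite derive1n_shift; last exact: test_smooth.
move=> H; apply: etrans H _.
have i1 : intble (fun y => w y * k (y - x)).
  by apply: L2_mul => //; apply: L2_test; exact: test_shift.
by rewrite /corr -RintZ//; apply: eq_Rint => y; rewrite mulrA.
Qed.

(** A kernel of mass one does not increase L^2 norms. The second weak derivative is quantified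
    inside the conclusion because only the vertical case provides one. *)
Lemma mollify psi w : L2 psi -> L2 w -> weak_deriv 1 psi w ->
  exists U : nat -> jet R, [/\ forall n, admissible (U n),
    forall n, Rint (fun x => j0 (U n) x ^+ 2) <= Rint (fun x => psi x ^+ 2),
    forall n, Rint (fun x => j1 (U n) x ^+ 2) <= Rint (fun x => w x ^+ 2),
    forall w2, L2 w2 -> weak_deriv 2 psi w2 ->
      forall n, Rint (fun x => j2 (U n) x ^+ 2) <= Rint (fun x => w2 x ^+ 2) &
    forall q, continuous q -> csupp q ->
      Rint (fun x => q x * j0 (U n) x ^+ 2) @[n --> \oo] -->
      Rint (fun x => q x * psi x ^+ 2)].
Proof.
move=> Lpsi Lw dw.
pose K (n : nat) := @mollifier R n.
have tK n : test_fun (K n) by exact: test_mollifier.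
have normK n : Rint (fun y => `|K n y|) = 1.
  rewrite -(@Rint_mollifier R n); apply: eq_Rint => y.
  by rewrite ger0_norm// mollifier_ge0.
have young n f : L2 f -> Rint (fun x => corr (K n) f x ^+ 2) <= Rint (fun x => f x ^+ 2).
  by move=> Lf; have [_] := corr_L2 (tK n) Lf; rewrite normK expr1n mul1r.
pose U n := Jet (corr (K n) psi) (fun x => - corr (derive1n 1 (K n)) psi x)
  (fun x => corr (derive1n 2 (K n)) psi x).
have E1 n x : - corr (derive1n 1 (K n)) psi x = corr (K n) w x.
  by rewrite (corr_weak_deriv x (tK n) Lw dw) expr1 mulN1r opprK.
have d0 n : isder (j0 (U n)) (j1 (U n)) by exact: isder_corr.
have d1 n : isder (j1 (U n)) (j2 (U n)).
  move=> x; apply: isd_eq (isdN (isder_corr (test_derive1n 1 (tK n)) Lpsi x)) _.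
  by rewrite opprK.
have aU n : admissible (U n).
  split; [exact: d0|exact: d1| |split].
  - exact: isder_continuous (isder_corr (test_derive1n 2 (tK n)) Lpsi).
  - by have [] := corr_L2 (tK n) Lpsi.
  - by apply: L2N; have [] := corr_L2 (test_derive1n 1 (tK n)) Lpsi.
  - by have [] := corr_L2 (test_derive1n 2 (tK n)) Lpsi.
have b0 n : Rint (fun x => j0 (U n) x ^+ 2) <= Rint (fun x => psi x ^+ 2).
  exact: young.
have b1 n : Rint (fun x => j1 (U n) x ^+ 2) <= Rint (fun x => w x ^+ 2).
  apply: le_trans (young n w Lw).
  by rewrite (eq_Rint (fun x => congr1 (fun z => z ^+ 2) (E1 n x))).
exists U; split => //.
- move=> w2 Lw2 dw2 n; apply: le_trans (young n w2 Lw2).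
  have E2 x : corr (derive1n 2 (K n)) psi x = corr (K n) w2 x.
    by rewrite (corr_weak_deriv x (tK n) Lw2 dw2) sqrrN expr1n mul1r.
  by rewrite (eq_Rint (fun x => congr1 (fun z => z ^+ 2) (E2 x))).
- move=> q cq sq.
  (* The Sobolev bound on the square of every mollification, uniform in [n]: the dominating
     constant. *)
  pose B := 2 * Rint (fun x => psi x ^+ 2) + Rint (fun x => w x ^+ 2).
  apply: (@Rint_dominated R _ _ (fun x => B * `|q x|)).
  + move=> n; have H := contM cq (contM (isder_continuous (d0 n)) (isder_continuous (d0 n))).
    by apply: continuous_meas; under eq_fun do rewrite expr2; exact: H.
  + apply: measurable_funM; first exact: continuous_meas.
    by apply: measurable_funX; case: Lpsi.
  + by apply: intbleZ; apply: intble_abs; exact: intble_csupp.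
  + case: (lebesgue_differentiation (L2_locally_integrable Lpsi)) => Z [mZ Z0 HZ].
    exists Z; split=> //; apply: subset_trans HZ => x /=; apply: contra_not => lx.
    apply: cvgMr; exact: cvg_sqr (cvg_mollifier Lpsi lx).
  + move=> n x; rewrite normrM mulrC ler_wpM2r// ger0_norm ?sqr_ge0//.
    have [_ _ cU2 [LU LU1 LU2]] := aU n.
    apply: le_trans (sobolev x (d0 n) (isder_continuous (d1 n)) LU LU1) _.
    by rewrite /B lerD// ler_wpM2l.
Qed.

(** Mollifying does not increase the left side, while the right side converges, so strictness
    survives for some index. *)
Lemma strict_approximation q (al be ga : R) psi w w2 : continuous q -> csupp q ->
  0 <= al -> 0 <= be -> 0 <= ga -> L2 psi -> L2 w -> weak_deriv 1 psi w ->
  (ga = 0 \/ L2 w2 /\ weak_deriv 2 psi w2) ->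
  al * Rint (fun x => psi x ^+ 2) + be * Rint (fun x => w x ^+ 2) +
    ga * Rint (fun x => w2 x ^+ 2) < Rint (fun x => q x * psi x ^+ 2) ->
  exists2 u : jet R, admissible u &
    al * Rint (fun x => j0 u x ^+ 2) + be * Rint (fun x => j1 u x ^+ 2) +
    ga * Rint (fun x => j2 u x ^+ 2) < Rint (fun x => q x * j0 u x ^+ 2).
Proof.
move=> cq sq al0 be0 ga0 Lpsi Lw dw H2 lt.
have [U [aU b0 b1 b2 cv]] := mollify Lpsi Lw dw.
have := cv q cq sq => /cvgr_gt /(_ _ lt) [n _ Hn].
exists (U n) => //; apply: le_lt_trans (Hn n (leqnn n)).
apply: lerD; first by rewrite lerD ?ler_wpM2l.
case: H2 => [->|[Lw2 dw2]]; first by rewrite !mul0r.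
by rewrite ler_wpM2l//; exact: b2.
Qed.

End Core.

(** * Existence of the eigenfunction *)

Section Existence.
Set Implicit Arguments. Unset Strict Implicit. Unset Printing Implicit Defensive.
Variable R : realType.
Local Notation Rint := Defs.Rint.
Local Notation mu := (@lebesgue_measure R).
Implicit Types f g h : R -> R.
Implicit Types p r psi rho q : R -> R.
Implicit Types u v : jet R.

Lemma smooth_bdd_cst (c : R) : smooth_bdd (fun=> c).
Proof.
split=> [|n]; first exact: smooth_cst.
have [d ->] : exists d : R, derive1n n (fun=> c) = fun=> d.
  elim: n => [|n [d IH]]; first by exists c.
  exists 0; rewrite derive1nS IH; apply: isder_derive1 => x; exact: is_derive_cst.
exact: bdd_cst.
Qed.

Lemma smooth_bddZ (c : R) f : smooth_bdd f -> smooth_bdd (fun x => c * f x).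
Proof.
move=> [sf bf]; split; first exact: smoothZ.
by move=> n; rewrite derive1nZ//; apply: bddM; [exact: bdd_cst|exact: bf].
Qed.

Lemma smooth_bddD f g : smooth_bdd f -> smooth_bdd g ->
  smooth_bdd (fun x => f x + g x).
Proof.
move=> [sf bf] [sg bg]; split; first exact: smoothD.
by move=> n; rewrite derive1nD//; apply: bddD; [exact: bf|exact: bg].
Qed.

Lemma smooth_bdd_csupp_derive f : smooth f -> (exists C : R, forall x, `|f x| <= C) ->
  csupp (derive1 f) -> smooth_bdd f.
Proof.
move=> sf bf sf'; split=> // -[|n].
  by split; first exact: smooth_continuous.
have t : test_fun (derive1n n (derive1 f)).
  by apply: test_derive1n; split; [exact: smooth_derive1|exact: sf'].
rewrite derive1n_Sr; apply: bdd_csupp; [exact: test_continuous|exact: test_csupp].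
Qed.

Lemma qformE c p r u : bdd c -> bdd p -> bdd r -> admissible u ->
  qform c p r u u = Rint (fun x => c x * j2 u x ^+ 2) +
    Rint (fun x => p x * j1 u x ^+ 2) + Rint (fun x => r x * j0 u x ^+ 2).
Proof.
move=> bc bp br [_ _ _ [/L2_sqr Lu /L2_sqr Lu1 /L2_sqr Lu2]].
have i2 := intble_bdd bc Lu2; have i1 := intble_bdd bp Lu1; have i0 := intble_bdd br Lu.
by rewrite -RintD// -RintD//; exact: intbleD.
Qed.

Lemma sqnormZ (k : R) u : admissible u ->
  k * sqnorm u = qform (fun=> k) (fun=> k) (fun=> k) u u.
Proof.
move=> au; rewrite /sqnorm /qform -RintZ; last by apply: intble_dens => //; exact: bdd_cst.
by apply: eq_Rint => x; rewrite /dens; ring.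
Qed.

Lemma qform_comb (l : R) c1 p1 r1 c2 p2 r2 c3 p3 r3 u :
  bdd c1 -> bdd p1 -> bdd r1 -> bdd c2 -> bdd p2 -> bdd r2 ->
  bdd c3 -> bdd p3 -> bdd r3 -> admissible u ->
  l ^+ 2 * qform c1 p1 r1 u u + l * qform c2 p2 r2 u u + qform c3 p3 r3 u u =
  qform (fun x => l ^+ 2 * c1 x + l * c2 x + c3 x)
    (fun x => l ^+ 2 * p1 x + l * p2 x + p3 x)
    (fun x => l ^+ 2 * r1 x + l * r2 x + r3 x) u u.
Proof.
move=> ? ? ? ? ? ? ? ? ? au.
have i1 : intble (dens c1 p1 r1 u u) by exact: intble_dens.
have i2 : intble (dens c2 p2 r2 u u) by exact: intble_dens.
have i3 : intble (dens c3 p3 r3 u u) by exact: intble_dens.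
have k1 := intbleZ (l ^+ 2) i1; have k2 := intbleZ l i2.
rewrite /qform -!RintZ// -RintD// -RintD//; last exact: intbleD.
by apply: eq_Rint => x; rewrite /dens; ring.
Qed.

Section Eigenfunction.
Variables (a m g Mh Mv rho0 : R) (rho : R -> R).
Hypotheses (a_gt0 : 0 < a) (m_gt0 : 0 < m) (Mh_ge0 : 0 <= Mh)
  (Mv_ge0 : 0 <= Mv) (rho0_gt0 : 0 < rho0) (rho_ge : forall x, rho0 <= rho x)
  (rho_sb : smooth_bdd rho) (rho'_cs : csupp (derive1 rho)).

Let q x := g * a ^+ 2 * derive1 rho x.

(** With [a] for |xi| and [m] for the viscosity, the equation in divergence form has leading
    coefficient [l * m + Mv], with [flux_coef] as p and [mass_coef] as r. *)
Definition flux_coef (l : R) (x : R) := l ^+ 2 * rho x + (2 * l * m * a ^+ 2 + Mh + a ^+ 2 * Mv).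

Definition mass_coef (l : R) (x : R) :=
  l ^+ 2 * a ^+ 2 * rho x + (l * m * a ^+ 4 + Mh * a ^+ 2) - g * a ^+ 2 * derive1 rho x.

Lemma smooth_bdd_flux l : smooth_bdd (flux_coef l).
Proof.
apply: smooth_bddD; last exact: smooth_bdd_cst.
exact: smooth_bddZ.
Qed.

Lemma smooth_bdd_q : smooth_bdd q.
Proof. by apply: smooth_bddZ; exact: smooth_bdd_derive. Qed.

Lemma smooth_bdd_mass l : smooth_bdd (mass_coef l).
Proof.
have -> : mass_coef l = fun x => (l ^+ 2 * a ^+ 2 * rho x + (l * m * a ^+ 4 + Mh * a ^+ 2)) +
   (-1) * q x by apply/funext => x; rewrite mulN1r.
apply: smooth_bddD; last by apply: smooth_bddZ; exact: smooth_bdd_q.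
apply: smooth_bddD; last exact: smooth_bdd_cst.
exact: smooth_bddZ.
Qed.

Lemma smooth_bdd0 f : smooth_bdd f -> bdd f.
Proof. by move=> [_ /(_ 0%N)]. Qed.

Lemma critical_eigenvalue u0 : admissible u0 ->
  Mh * a ^+ 2 * Rint (fun x => j0 u0 x ^+ 2) +
  (Mh + a ^+ 2 * Mv) * Rint (fun x => j1 u0 x ^+ 2) +
  Mv * Rint (fun x => j2 u0 x ^+ 2) < Rint (fun x => q x * j0 u0 x ^+ 2) ->
  exists l, [/\ 0 < l,
    forall u, admissible u ->
      0 <= qform (fun=> l * m + Mv) (flux_coef l) (mass_coef l) u u &
    forall e, 0 < e -> exists u, [/\ admissible u, sqnorm u = 1 &
      qform (fun=> l * m + Mv) (flux_coef l) (mass_coef l) u u < e]].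
Proof.
move=> au0 Hu0.
have brho := smooth_bdd0 rho_sb; have bq := smooth_bdd0 smooth_bdd_q.
have [_ [C rhoC]] := brho; have [_ [D qD]] := bq.
have C0 : 0 <= C by exact: le_trans (normr_ge0 _) (rhoC 0).
have D0 : 0 <= D by exact: le_trans (normr_ge0 _) (qD 0).
have a2 : 0 < a ^+ 2 by rewrite exprn_gt0.
have a4 : 0 < a ^+ 4 by rewrite exprn_gt0.
have rho_gt0 x : 0 <= rho x by exact: le_trans (ltW rho0_gt0) (rho_ge x).
(* The coefficients sorted by powers of [l]: index 1 for [l ^+ 2], index 2 for [l], index 3 for the
   part independent of [l]. *)
pose c3 := fun _ : R => Mv; pose p3 := fun _ : R => Mh + a ^+ 2 * Mv.
pose r3 := fun x => Mh * a ^+ 2 + (-1) * q x.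
pose c1 := fun _ : R => 0 : R; pose r1 := fun x => a ^+ 2 * rho x.
pose c2 := fun _ : R => m; pose p2 := fun _ : R => 2 * m * a ^+ 2.
pose r2 := fun _ : R => m * a ^+ 4.
have b_ k : bdd (fun _ : R => k) by exact: bdd_cst.
have br1 : bdd r1 by exact: bddM (b_ _) brho.
have br3 : bdd r3 by exact: bddD (b_ _) (bddM (b_ _) bq).
have [bc1 bc2 bc3] : [/\ bdd c1, bdd c2 & bdd c3] by split; exact: b_.
have [bp2 bp3 br2] : [/\ bdd p2, bdd p3 & bdd r2] by split; exact: b_.
have comb l u : admissible u ->
    l ^+ 2 * qform c1 rho r1 u u + l * qform c2 p2 r2 u u + qform c3 p3 r3 u u =
    qform (fun=> l * m + Mv) (flux_coef l) (mass_coef l) u u.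
  move=> au; rewrite qform_comb//; congr (qform _ _ _ u u); apply/funext => x.
  - by rewrite /c1 /c2 /c3; ring.
  - by rewrite /p2 /p3 /flux_coef; ring.
  - by rewrite /r1 /r2 /r3 /mass_coef /q; ring.
have bnd c p r u (k : R) : admissible u -> bdd c -> bdd p -> bdd r ->
    (forall x, c x <= k) -> (forall x, p x <= k) -> (forall x, r x <= k) ->
    qform c p r u u <= k * sqnorm u.
  by move=> au *; rewrite sqnormZ//; apply: qform_le.
have H6 : exists2 l0, 0 < l0 & forall u, admissible u ->
    0 <= l0 ^+ 2 * qform c1 rho r1 u u + l0 * qform c2 p2 r2 u u + qform c3 p3 r3 u u.
  (* For [l0 >= 1], l0^2 a^2 rho is at least l0 a^2 rho0, and this choice makes the latter at least
     [D], a bound for [q]: every coefficient is then nonnegative. *)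
  exists (1 + D / (a ^+ 2 * rho0)).
    by rewrite ltr_pwDl// divr_ge0// mulr_ge0// ltW.
  set l0 := 1 + _ => u au; rewrite comb//.
  have l01 : 1 <= l0 by rewrite lerDl divr_ge0// mulr_ge0// ltW.
  have l02 : l0 <= l0 ^+ 2 by rewrite expr2 ler_peMl//; lra.
  have l0D : D <= l0 * (a ^+ 2 * rho0).
    rewrite mulrDl mul1r divfK ?gt_eqF ?mulr_gt0//.
    by rewrite lerDr mulr_ge0// ltW.
  clearbody l0; have lm : 0 <= l0 * m by rewrite mulr_ge0// ?ltW//; lra.
  apply: qform_ge0 => x; first by rewrite addr_ge0.
    rewrite /flux_coef; have h1 := mulr_ge0 (sqr_ge0 l0) (rho_gt0 x).
    have h2 := mulr_ge0 lm (ltW a2); have h3 := mulr_ge0 (ltW a2) Mv_ge0; have h4 := Mh_ge0; nra.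
  have h1 := mulr_ge0 lm (ltW a4); have h2 := mulr_ge0 Mh_ge0 (ltW a2).
  have h3 : q x <= D by exact: le_trans (ler_norm _) (qD x).
  have h4 : l0 * (a ^+ 2 * rho0) <= l0 ^+ 2 * (a ^+ 2 * rho x).
    apply: ler_pM => //; [lra|by rewrite mulr_ge0// ltW|].
    by rewrite ler_wpM2l// ltW.
  by rewrite /mass_coef -/(q x); lra.
have H5 : exists2 u, admissible u & qform c3 p3 r3 u u < 0.
  exists u0 => //; have [_ _ _ [/L2_sqr Lu /L2_sqr Lu1 /L2_sqr Lu2]] := au0.
  have iq := intble_bdd bq Lu.
  rewrite qformE// RintZ// RintZ//.
  have -> : Rint (fun x => r3 x * j0 u0 x ^+ 2) =
      Mh * a ^+ 2 * Rint (fun x => j0 u0 x ^+ 2) - Rint (fun x => q x * j0 u0 x ^+ 2).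
    have iM := intbleZ (Mh * a ^+ 2) Lu.
    by rewrite -RintZ// -RintB//; apply: eq_Rint => x; rewrite /r3; ring.
  move: Hu0; move: (Rint _) (Rint _) (Rint _) (Rint _) => A1 A2 A3 A4; lra.
have H4 u k : admissible u -> exists v, [/\ admissible v,
    qform c1 rho r1 v v = k ^+ 2 * qform c1 rho r1 u u,
    qform c2 p2 r2 v v = k ^+ 2 * qform c2 p2 r2 u u,
    qform c3 p3 r3 v v = k ^+ 2 * qform c3 p3 r3 u u &
    sqnorm v = k ^+ 2 * sqnorm u].
  move=> au; exists (jscale k u); split; first exact: admissible_scale.
  + exact: qform_scale.
  + exact: qform_scale.
  + exact: qform_scale.
  + exact: qform_scale.
have H3 u : admissible u -> 0 <= sqnorm u /\ (sqnorm u = 0 -> qform c3 p3 r3 u u = 0).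
  move=> au; have N0 : 0 <= sqnorm u by apply: qform_ge0.
  split=> // Nu0.
  (* A common bound for the absolute values of the three coefficients, so that |C(u)| <= k N(u). *)
  pose k := Mv + (Mh + a ^+ 2 * Mv) + (Mh * a ^+ 2 + D).
  have h4 := Mh_ge0; have h5 := Mv_ge0.
  have h1 := mulr_ge0 (ltW a2) Mv_ge0; have h2 := mulr_ge0 Mh_ge0 (ltW a2).
  have up : qform c3 p3 r3 u u <= k * sqnorm u.
    apply: bnd => // x; rewrite /c3 /p3 /r3 /k; [lra|lra|].
    by have := le_trans (ler_norm _) (qD x); have := ler_norm (- q x); rewrite normrN;
      have := qD x; lra.
  have lo : (- k) * sqnorm u <= qform c3 p3 r3 u u.
    rewrite sqnormZ//; apply: qform_le => // x; rewrite /c3 /p3 /r3 /k; [lra|lra|].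
    by have := ler_norm (q x); have := qD x; lra.
  by apply/eqP; rewrite eq_le; move: up lo; rewrite Nu0 !mulr0 => -> ->.
have H2 u : admissible u ->
    0 <= qform c2 p2 r2 u u <= (m + 2 * m * a ^+ 2 + m * a ^+ 4) * sqnorm u.
  move=> au; rewrite qform_ge0//=.
    apply: bnd => // x; rewrite /c2 /p2 /r2.
    + by rewrite -addrA lerDl addr_ge0// ltW// !mulr_gt0.
    + by rewrite addrAC lerDr addr_ge0// ltW// !mulr_gt0.
    + by rewrite lerDr addr_ge0// ltW// !mulr_gt0.
  + by move=> x; exact: ltW.
  + by move=> x; rewrite /p2 ltW// !mulr_gt0.
  + by move=> x; rewrite /r2 ltW// !mulr_gt0.
have H1 u : admissible u -> 0 <= qform c1 rho r1 u u <= (C + a ^+ 2 * C) * sqnorm u.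
  have aC : 0 <= a ^+ 2 * C by rewrite mulr_ge0// ltW.
  have rC x : rho x <= C by exact: le_trans (ler_norm _) (rhoC x).
  move=> au; rewrite qform_ge0//=.
    apply: bnd => // x; rewrite /c1 /r1.
    + by rewrite addr_ge0.
    + by rewrite (le_trans (rC x))// lerDl.
    + by rewrite (@le_trans _ _ (a ^+ 2 * C))// ?lerDr// ler_wpM2l// ltW.
  by move=> x; rewrite /r1 mulr_ge0// ltW.
have [l [l0 pos small]] := critical_parameter H1 H2 H3 H4 H5 H6.
exists l; split=> // [u au|e e0]; first by rewrite -comb//; exact: pos.
by have [u [au nu Hu]] := small e e0; exists u; split=> //; rewrite -comb.
Qed.

Lemma eigenfunction u0 : admissible u0 ->
  Mh * a ^+ 2 * Rint (fun x => j0 u0 x ^+ 2) +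
  (Mh + a ^+ 2 * Mv) * Rint (fun x => j1 u0 x ^+ 2) +
  Mv * Rint (fun x => j2 u0 x ^+ 2) < Rint (fun x => q x * j0 u0 x ^+ 2) ->
  exists l psi, [/\ 0 < l, smooth psi, exists x, psi x <> 0,
    forall k, L2 (derive1n k psi) &
    forall x, elop (l * m + Mv) (flux_coef l) (mass_coef l) psi x = 0].
Proof.
move=> au0 Hu0; have [l [l0 pos small]] := critical_eigenvalue au0 Hu0.
have [sp _] := smooth_bdd_flux l; have [sr _] := smooth_bdd_mass l.
have bp := smooth_bdd0 (smooth_bdd_flux l); have br := smooth_bdd0 (smooth_bdd_mass l).
have bq := smooth_bdd0 smooth_bdd_q; have [sq _] := smooth_bdd_q.
have cq := smooth_continuous sq.
have qs : csupp q by exact: csuppMr.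
have a2 : 0 < a ^+ 2 by rewrite exprn_gt0.
have a4 : 0 < a ^+ 4 by rewrite exprn_gt0.
have lm : 0 < l * m by rewrite mulr_gt0.
have c_gt0 : 0 < l * m + Mv by rewrite ltr_wpDr.
have c0 : l * m + Mv != 0 by rewrite gt_eqF.
have rho_gt0 x : 0 <= rho x by exact: le_trans (ltW rho0_gt0) (rho_ge x).
(* The viscous contributions at orders 2, 1 and 0 alone give coercivity once [q] is added back. *)
pose ka := Num.min (l * m) (Num.min (l * m * a ^+ 2) (l * m * a ^+ 4)).
have ka1 : ka <= l * m by rewrite /ka ge_min lexx.
have ka2 : ka <= l * m * a ^+ 2 by rewrite /ka !ge_min lexx orbT.
have ka3 : ka <= l * m * a ^+ 4 by rewrite /ka !ge_min lexx !orbT.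
have ka0 : 0 < ka by rewrite !lt_min lm !mulr_gt0.
clearbody ka.
have coer u : admissible u -> ka * sqnorm u <=
    qform (fun=> l * m + Mv) (flux_coef l) (mass_coef l) u u +
    Rint (fun x => q x * j0 u x ^+ 2).
  move=> au; have [_ _ _ [/L2_sqr Lu _ _]] := au.
  have -> : qform (fun=> l * m + Mv) (flux_coef l) (mass_coef l) u u +
      Rint (fun x => q x * j0 u x ^+ 2) =
      qform (fun=> l * m + Mv) (flux_coef l) (fun x => mass_coef l x + q x) u u.
    rewrite -RintD; last 2 first.
    - by apply: intble_dens => //; exact: bdd_cst.
    - exact: intble_bdd.
    by apply: eq_Rint => x; rewrite /dens; ring.
  have bmq := bddD br bq; have bk := @bdd_cst R ka; have bc := @bdd_cst R (l * m + Mv).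
  have h4 := Mh_ge0; have h5 := Mv_ge0.
  rewrite sqnormZ//; apply: qform_le => // x.
  - by rewrite ler_wpDr.
  - rewrite /flux_coef; have h1 := mulr_ge0 (sqr_ge0 l) (rho_gt0 x).
    have h2 := mulr_ge0 (ltW lm) (ltW a2); have h3 := mulr_ge0 (ltW a2) h5; nra.
  - rewrite /mass_coef -/(q x) subrK.
    have h1 := mulr_ge0 (sqr_ge0 l) (mulr_ge0 (ltW a2) (rho_gt0 x)).
    have h2 := mulr_ge0 h4 (ltW a2); lra.
have [psi [cpsi psi0 weak dual0 dual2]] :=
  weak_solution sp bp sr br cq qs ka0 pos coer small.
have [spsi eq0] := weak_classical c0 sp sr cpsi weak.
exists l, psi; split => //.
apply: L2_derive1n => //; first exact: L2_of_dual.
- apply: L2_of_dual; first exact: (@smooth_derive1n R psi 2).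
  move=> phi tp.
  have e1 := @by_parts_testn R _ _ phi 0 (smooth_isder (smooth_derive1 spsi))
    (smooth_continuous (@smooth_derive1n R psi 2 spsi)) tp.
  have e2 := @by_parts_testn R _ _ phi 1 (smooth_isder spsi)
    (smooth_continuous (smooth_derive1 spsi)) tp.
  have E : Rint (fun x => derive1n 2 psi x * phi x) = Rint (fun x => psi x * derive1n 2 phi x).
    exact: (etrans e1 (etrans (congr1 -%R e2) (opprK _))).
  by rewrite E; exact: dual2.
- set c := l * m + Mv.
  have sbp := smooth_bdd_flux l; have sbr := smooth_bdd_mass l.
  (* The equation solved for the fourth derivative; expanding (p psi')' leaves no term of order
     above 2. *)
  have E : derive1n 4 psi = fun x =>
     (c^-1 * derive1 (flux_coef l) x * derive1n 1 psi x +
      c^-1 * flux_coef l x * derive1n 2 psi x) + (- c^-1) * mass_coef l x * derive1n 0 psi x.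
    apply/funext => x; have := eq0 x; rewrite /elop -/c.
    have d y := isdM (smooth_isder sp y) (smooth_isder (smooth_derive1 spsi) y).
    rewrite (isder_derive1 d).
    change (derive1 (derive1 psi) x) with (derive1n 2 psi x).
    change (derive1 psi x) with (derive1n 1 psi x).
    change (derive1n 0 psi x) with (psi x).
    move: (derive1n 4 psi x) (derive1n 2 psi x) (derive1n 1 psi x) (psi x)
      (flux_coef l x) (derive1 (flux_coef l) x) (mass_coef l x) c0 => d4 d2 d1 d0 p p' r c0' H.
    apply: (mulfI c0'); rewrite -/c in c0' *; apply/eqP; rewrite -subr_eq0; apply/eqP.
    by rewrite -[RHS]H; field.
  have t1 := dspan_term psi (@smooth_bddZ c^-1 _ (smooth_bdd_derive sbp)) (isT : (1 <= 2)%N).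
  have t2 := dspan_term psi (@smooth_bddZ c^-1 _ sbp) (isT : (2 <= 2)%N).
  have t3 := dspan_term psi (@smooth_bddZ (- c^-1) _ sbr) (isT : (0 <= 2)%N).
  by rewrite E; exact: dspan_add (dspan_add t1 t2) t3.
Qed.

End Eigenfunction.
End Existence.

(** * Sobolev membership and normalisation of the eigenfunction *)

Section Final.
Set Implicit Arguments. Unset Strict Implicit. Unset Printing Implicit Defensive.
Variable R : realType.
Local Notation Rint := Defs.Rint.
Local Notation mu := (@lebesgue_measure R).
Implicit Types f g h : R -> R.
Implicit Types psi rho : R -> R.

Lemma Rint_by_parts_n j f phi : smooth f -> test_fun phi ->
  Rint (fun x => f x * derive1n j phi x) = (-1) ^+ j * Rint (fun x => derive1n j f x * phi x).
Proof.
move=> sf; elim: j phi => [|j IH] phi tp; first by rewrite expr0 mul1r.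
rewrite derive1n_Sr (IH _ (test_derive tp)) exprSr -mulrA; congr (_ * _).
have sj := @smooth_derive1n R f j sf.
have := by_parts_test (smooth_isder sj) (smooth_continuous (smooth_derive1 sj)) tp.
rewrite -derive1nS => ->; by rewrite mulN1r opprK.
Qed.

Lemma weak_deriv_smooth j f : smooth f -> weak_deriv j f (derive1n j f).
Proof.
move=> sf phi tp.
have sj := @smooth_derive1n R f j sf.
have i1 := intble_test (smooth_continuous sf) (test_derive1n j tp).
have i2 := intble_test (smooth_continuous sj) tp.
have i3 := intbleZ ((-1) ^+ j) i2.
rewrite (Rint_EFin i1) Rint_by_parts_n// -RintZ// -(Rint_EFin i3).
by apply: eq_integral => x _; rewrite mulrA.
Qed.

Lemma Hk_smooth k f : smooth f -> (forall j, L2 (derive1n j f)) -> Hk k f.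
Proof.
move=> sf Lf; split; first exact: (Lf 0%N).
by move=> j _; exists (derive1n j f); split; [exact: Lf|exact: weak_deriv_smooth].
Qed.

(** [nonzero] is meant almost everywhere, whereas the construction gives one point; the integral of
    f^2, positive by continuity, bridges the two. *)
Lemma nonzero_continuous f x : continuous f -> L2 f -> f x <> 0 -> nonzero f.
Proof.
move=> cf /L2_sqr if2 fx ae0.
have cf2 : continuous (fun x => f x ^+ 2).
  by have := contM cf cf; under eq_fun do rewrite -expr2.
have : 0 < Rint (fun x => f x ^+ 2).
  apply: (@Rint_gt0 R _ x) => // [y|]; first exact: sqr_ge0.
  by rewrite lt_neqAle sqr_ge0 andbT eq_sym sqrf_eq0; apply/eqP.
rewrite /Defs.Rint (ae_eq_integral (fun=> 0%E)) ?integral0 ?ltxx//.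
  by apply/measurable_EFinP; exact: continuous_meas.
case: ae0 => Z [mZ Z0 HZ]; exists Z; split=> //; apply: subset_trans HZ => y /=.
by apply: contra_not => fy _; rewrite fy expr0n.
Qed.

Lemma elopZ c p r (s : R) f x : smooth p -> smooth f ->
  elop c p r (fun y => s * f y) x = s * elop c p r f x.
Proof.
move=> sp sf; rewrite /elop derive1nZ//.
have d := smooth_isder (smooth_flux sp sf).
have E : derive1 (fun y => p y * derive1 (fun z => s * f z) y) =
    fun x => s * derive1 (fun y => p y * derive1 f y) x.
  have -> : derive1 (fun z => s * f z) = fun x => s * derive1 f x.
    by apply: isder_derive1 => y; apply: isdZ; exact: smooth_isder.
  apply: isder_derive1 => y.
  under eq_fun do rewrite mulrCA.
  by apply: isdZ; exact: d.
by rewrite E; ring.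
Qed.

Section Assembly.
Variables (a m g Mh Mv rho0 : R) (rho : R -> R).
Hypotheses (a_gt0 : 0 < a) (m_gt0 : 0 < m) (Mh_ge0 : 0 <= Mh)
  (Mv_ge0 : 0 <= Mv) (rho0_gt0 : 0 < rho0) (rho_ge : forall x, rho0 <= rho x)
  (rho_sb : smooth_bdd rho) (rho'_cs : csupp (derive1 rho)).

Lemma normalized_eigenfunction u0 : admissible u0 ->
  Mh * a ^+ 2 * Rint (fun x => j0 u0 x ^+ 2) +
  (Mh + a ^+ 2 * Mv) * Rint (fun x => j1 u0 x ^+ 2) +
  Mv * Rint (fun x => j2 u0 x ^+ 2) <
    Rint (fun x => g * a ^+ 2 * derive1 rho x * j0 u0 x ^+ 2) ->
  exists psi l, [/\ 0 < l /\ nonzero psi, smooth psi,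
    (forall k, L2 (derive1n k psi)) /\
    Rint (fun x => rho x * (a ^+ 2 * psi x ^+ 2 + derive1 psi x ^+ 2)) = 1 &
    forall x, - l ^+ 2 * (rho x * a ^+ 2 * psi x
        - derive1 (fun y => rho y * derive1 psi y) x)
      = l * m * (a ^+ 4 * psi x - 2 * a ^+ 2 * derive1n 2 psi x + derive1n 4 psi x)
        - g * a ^+ 2 * derive1 rho x * psi x
        + (Mh * (a ^+ 2 * psi x - derive1n 2 psi x)
           + Mv * (derive1n 4 psi x - a ^+ 2 * derive1n 2 psi x))].
Proof.
move=> au0 Hu0.
have [l [psi [l0 spsi [x0 psix0] Lpsi eq0]]] :=
  eigenfunction a_gt0 m_gt0 Mh_ge0 Mv_ge0 rho0_gt0 rho_ge rho_sb rho'_cs au0 Hu0.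
have a2 : 0 < a ^+ 2 by rewrite exprn_gt0.
have [srho _] := rho_sb; have brho := smooth_bdd0 rho_sb.
have crho := smooth_continuous srho; have cpsi := smooth_continuous spsi.
have cpsi1 := smooth_continuous (smooth_derive1 spsi).
pose e (x : R) := rho x * (a ^+ 2 * psi x ^+ 2 + derive1 psi x ^+ 2).
have rho_gt0 x : 0 < rho x by exact: lt_le_trans (rho_ge x).
have ie : intble e.
  apply: (intble_bdd brho); apply: intbleD; first by apply: intbleZ; exact: L2_sqr (Lpsi 0%N).
  exact: L2_sqr (Lpsi 1%N).
have ce : continuous e.
  apply: (contM crho).
  have := contD (contM (@cst_continuous _ _ (a ^+ 2)) (contM cpsi cpsi)) (contM cpsi1 cpsi1).
  by under eq_fun do rewrite -!expr2.
have e_ge0 x : 0 <= e x.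
  by rewrite mulr_ge0 ?(ltW (rho_gt0 x))// addr_ge0 ?sqr_ge0// mulr_ge0 ?sqr_ge0// ltW.
have E0 : 0 < Rint e.
  apply: (@Rint_gt0 R _ x0) => //; apply: mulr_gt0 => //.
  apply: ltr_pwDl; last exact: sqr_ge0.
  by rewrite mulr_gt0// lt_neqAle sqr_ge0 andbT eq_sym sqrf_eq0; apply/eqP.
(* The equation is linear in [psi], so scaling can meet the quadratic constraint of [in_calA]. *)
pose s := (Num.sqrt (Rint e))^-1.
have s0 : s != 0 by rewrite invr_neq0// sqrtr_eq0 -ltNge.
have s2 : s ^+ 2 * Rint e = 1.
  by rewrite exprVn sqr_sqrtr ?mulVf ?gt_eqF// ltW.
have sspsi : smooth (fun x => s * psi x) by exact: (@smoothZ R s psi).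
have d1 : derive1 (fun x => s * psi x) = fun x => s * derive1 psi x.
  exact: (@derive1nZ R s psi 1).
have dn n : derive1n n (fun x => s * psi x) = fun x => s * derive1n n psi x.
  exact: (@derive1nZ R s psi n).
have Ls n : L2 (derive1n n (fun x => s * psi x)) by rewrite dn; exact: L2Z.
exists (fun x => s * psi x), l; split => //.
- split=> //; apply: (@nonzero_continuous _ x0); [exact: smooth_continuous|exact: (Ls 0%N)|].
  by apply/eqP; rewrite mulf_neq0//; apply/eqP.
- split=> //; rewrite d1 -s2 -RintZ//; apply: eq_Rint => x; rewrite /e; ring.
- move=> x.
  have sp : smooth (flux_coef a m Mh Mv rho l).
    by have [] := @smooth_bdd_flux R a m Mh Mv rho rho_sb l.
  have := @elopZ (l * m + Mv) _ (mass_coef a m g Mh rho l) s psi x sp spsi.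
  rewrite eq0 mulr0 /elop.
  have -> : derive1 (fun y => flux_coef a m Mh Mv rho l y * derive1 (fun z => s * psi z) y) x =
      l ^+ 2 * derive1 (fun y => rho y * derive1 (fun z => s * psi z) y) x +
      (2 * l * m * a ^+ 2 + Mh + a ^+ 2 * Mv) * derive1n 2 (fun z => s * psi z) x.
    have h1 := smooth_isder (smooth_flux srho sspsi).
    have h2 := smooth_isder (smooth_derive1 sspsi).
    have h3 y := isdD (isdZ (l ^+ 2) (h1 y))
      (isdZ (2 * l * m * a ^+ 2 + Mh + a ^+ 2 * Mv) (h2 y)).
    apply: etrans (congr1 (fun F => F x) (isder_derive1 h3)).
    by congr (derive1 _ x); apply/funext => y; rewrite /flux_coef; ring.
  rewrite /mass_coef.
  move: (derive1n 4 _ x) (derive1n 2 _ x) (derive1 (fun y => rho y * _) x) => d4 d2 fl H.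
  apply/eqP; rewrite -subr_eq0; apply/eqP.
  by rewrite -[RHS]oppr0 -[in RHS]H; ring.
Qed.

End Assembly.
End Final.

(** * The growth set as negativity of the form at zero growth rate *)

Section Cases.
Set Implicit Arguments. Unset Strict Implicit. Unset Printing Implicit Defensive.
Variable R : realType.
Local Notation Rint := Defs.Rint.
Local Notation mu := (@lebesgue_measure R).
Implicit Types f g h : R -> R.

(** The root is 0 below 0, so lying strictly above some [b >= 0] forces positivity and squaring is
    legitimate. *)
Lemma esqrt_gt (y : \bar R) (b : R) : 0 <= b -> (b%:E < esqrt y)%E -> ((b ^+ 2)%:E < y)%E.
Proof.
case: y => [y||] b0 /=; [|by rewrite !ltry|by rewrite lte_fin ltNge b0].
rewrite !lte_fin => H; have y0 : 0 <= y.
  by rewrite ltW// -sqrtr_gt0 (le_lt_trans b0).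
by rewrite -(sqr_sqrtr y0) ltr_pXn2r// nnegrE// sqrtr_ge0.
Qed.

Lemma esqrt_lt (y : \bar R) (b : R) : (esqrt y < b%:E)%E -> (y < (b ^+ 2)%:E)%E.
Proof.
case: y => [y||] /=; [|by []|by rewrite !ltNyr].
rewrite !lte_fin => H; have b0 : 0 < b by exact: le_lt_trans (sqrtr_ge0 _) H.
have [y0|y0] := lerP 0 y; last by rewrite (lt_trans y0)// exprn_gt0.
by rewrite -(sqr_sqrtr y0) ltr_pXn2r// nnegrE ?sqrtr_ge0// ltW.
Qed.

(* Both magnetic terms have the form
   Mh (|xi|^2 psi - psi'') + Mv (psi'''' - |xi|^2 psi''). *)
Definition Mh_of (c : field_case) (M xi1 : R) : R :=
  if c is Horizontal then M ^+ 2 * xi1 ^+ 2 else 0.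

Definition Mv_of (c : field_case) (M : R) : R :=
  if c is Vertical then M ^+ 2 else 0.

(** Clearing denominators in |xi| < S(xi), or in the inequality defining the vertical set, gives the
    required inequality for a weak competitor, which [strict_approximation] makes C^2. When
    [xi1 = 0] the magnetic terms vanish and a bump where rho' > 0 suffices. *)
Lemma admissible_of_Ag c (g M xi1 xi2 : R) rho : 0 < g -> smooth_bdd rho ->
  csupp (derive1 rho) -> (exists x0, 0 < derive1 rho x0) ->
  M_hyp c g rho M -> Ag c g rho M xi1 xi2 ->
  let a := xinorm xi1 xi2 in
  let Mh := Mh_of c M xi1 in let Mv := Mv_of c M in
  0 < a /\ exists2 u : jet R, admissible u &
  Mh * a ^+ 2 * Rint (fun x => j0 u x ^+ 2) +
  (Mh + a ^+ 2 * Mv) * Rint (fun x => j1 u x ^+ 2) +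
  Mv * Rint (fun x => j2 u x ^+ 2) <
    Rint (fun x => g * a ^+ 2 * derive1 rho x * j0 u x ^+ 2).
Proof.
move=> g0 sb cs [x0 rx0] hM hA a Mh Mv.
have sb' := smooth_bdd_derive sb; have br' := smooth_bdd0 sb'.
have cr' : continuous (derive1 rho) by case: br'.
have a_ge0 : 0 <= a by exact: sqrtr_ge0.
have a2E : a ^+ 2 = xi1 ^+ 2 + xi2 ^+ 2 by rewrite sqr_sqrtr// addr_ge0 ?sqr_ge0.
pose q x := g * a ^+ 2 * derive1 rho x.
have cq : continuous q by apply: contM => //; exact: cst_continuous.
have sq : csupp q by exact: csuppMr.
have Eq psi : L2 psi -> Rint (fun x => q x * psi x ^+ 2) =
    g * a ^+ 2 * Rint (fun x => derive1 rho x * psi x ^+ 2).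
  move=> /L2_sqr ip; rewrite -RintZ; last exact: intble_bdd.
  by apply: eq_Rint => x; rewrite /q; ring.
case: c hM hA @Mh @Mv => [hM [[[xiM [_ H]]|xi10] xi0]|[hM _] H] Mh Mv.
- have /= := esqrt_gt a_ge0 H; move=> /ereal_sup_gt[_ [psi [w [Hpsi Lw dw _ ->]]]].
  rewrite lte_fin -/a => lt.
  have a_gt0 : 0 < a.
    rewrite lt_neqAle a_ge0 andbT eq_sym; apply/eqP => a0; apply: xi0.
    move: a2E; rewrite a0 expr0n => /esym/eqP; rewrite paddr_eq0 ?sqr_ge0//.
    by rewrite !sqrf_eq0 => /andP[/eqP-> /eqP->].
  split=> //; have Lpsi : L2 psi by case: Hpsi.
  have Mxi : 0 < (M * xi1) ^+ 2.
    rewrite lt_neqAle sqr_ge0 andbT eq_sym sqrf_eq0; apply/eqP => M0.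
    by move: xiM; rewrite [xi1 * M]mulrC M0 normr0 mul0r ltxx.
  have Mh0 : 0 <= Mh by rewrite /Mh /= mulr_ge0// sqr_ge0.
  (* The last [psi] only fills the place of a second derivative, whose coefficient is 0 here. *)
  apply: (@strict_approximation _ q _ _ _ psi w psi) => //.
  + by rewrite mulr_ge0// sqr_ge0.
  + by rewrite addr_ge0// mulr_ge0// sqr_ge0.
  + by left.
  rewrite Eq// /Mv /= mulr0 addr0 mul0r addr0 /Mh /= -exprMn.
  move: lt; move: (Rint (fun x => derive1 rho x * psi x ^+ 2)) => F.
  have : 0 <= Rint (fun x => psi x ^+ 2) by apply: Rint_ge0 => x; exact: sqr_ge0.
  move: (Rint (fun x => psi x ^+ 2)) (Rint (fun x => w x ^+ 2)) => P W P0 lt.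
  (* If [P] were 0, the quotient would be 0 by the convention on division and could not exceed
     [a ^+ 2]. *)
  have P_gt0 : 0 < P.
    rewrite lt_neqAle P0 andbT eq_sym; apply/eqP => P00.
    by move: lt; rewrite P00 invr0 mulr0 ltNge sqr_ge0.
  move: lt; rewrite ltr_pdivlMr// ltrBrDr ltr_pdivlMr// => lt.
  by rewrite -/a in lt; nra.
- have a_gt0 : 0 < a.
    rewrite lt_neqAle a_ge0 andbT eq_sym; apply/eqP => a0; apply: xi0.
    move: a2E; rewrite a0 expr0n xi10 expr0n add0r => /esym/eqP.
    by rewrite sqrf_eq0 => /eqP->.
  split=> //.
  have : \forall y \near x0, 0 < derive1 rho y by have /cvgr_gt := cr' x0; apply.
  move=> /nbhs_ballP[e/= e0 He].
  (* A bump supported in the ball about [x0] where rho' stays positive. *)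
  pose phi (x : R) : R := hat (e^-1 * x + - (e^-1 * x0)).
  have tphi : test_fun phi.
    by apply: test_affine; [rewrite invr_neq0// gt_eqF|exact: test_hat].
  exists (jet_of phi); first exact: admissible_test.
  have Mh0 : Mh = 0 by rewrite /Mh /= xi10 expr0n mulr0.
  have zero A B D : Mh * a ^+ 2 * A + (Mh + a ^+ 2 * Mv) * B + Mv * D = 0.
    by rewrite Mh0 /Mv /=; ring.
  rewrite zero.
  have phi0 : 0 < phi x0 by rewrite /phi subrr hat_gt0// normr0.
  have cphi := test_continuous tphi.
  have cqp : continuous (fun x => q x * phi x ^+ 2).
    apply: (contM cq); have := contM cphi cphi.
    by under eq_fun do rewrite -expr2.
  change (0 < Rint (fun x => q x * phi x ^+ 2)).
  apply: (@Rint_gt0 R _ x0) => //.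
  + exact: intble_bdd (bdd_csupp cq sq) (L2_sqr (L2_test tphi)).
  + move=> x; have [xe|xe] := ltP `|x0 - x| e.
      by rewrite mulr_ge0 ?sqr_ge0// /q !mulr_ge0 ?(ltW g0) ?sqr_ge0// ltW//; exact: He.
    rewrite /phi hat_out ?expr0n ?mulr0// -mulrBr normrM gtr0_norm ?invr_gt0//.
    by rewrite distrC ler_pdivlMl// mulr1.
  + apply: mulr_gt0; last exact: exprn_gt0.
    by apply: mulr_gt0 => //; apply: mulr_gt0 => //; exact: exprn_gt0.
- have := esqrt_lt H; rewrite -/a.
  move=> /ereal_inf_lt[_ [psi [w1 [w2 [Hpsi [Lw1 Lw2] [dw1 dw2] D0 ->]]]]].
  rewrite lte_fin => lt.
  have Lpsi : L2 psi by case: Hpsi.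
  have DE : Rint (fun x => g * derive1 rho x * psi x ^+ 2 - M ^+ 2 * w1 x ^+ 2) =
      g * Rint (fun x => derive1 rho x * psi x ^+ 2) - M ^+ 2 * Rint (fun x => w1 x ^+ 2).
    have ip := intble_bdd br' (L2_sqr Lpsi); have igp := intbleZ g ip.
    have iw := L2_sqr Lw1; have iMw := intbleZ (M ^+ 2) iw.
    rewrite -!RintZ// -RintB//; apply: eq_Rint => x; ring.
  rewrite DE in lt D0.
  (* The quotient is nonnegative, so being strictly below [a ^+ 2] excludes [a = 0]. *)
  have a_gt0 : 0 < a.
    rewrite lt_neqAle a_ge0 andbT eq_sym; apply/eqP => a0.
    move: lt; rewrite a0 expr0n ltNge divr_ge0 ?(ltW D0)// mulr_ge0 ?sqr_ge0//.
    by apply: Rint_ge0 => x; exact: sqr_ge0.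
  split=> //.
  have M2 : 0 <= M ^+ 2 := sqr_ge0 M.
  apply: (@strict_approximation _ q _ _ _ psi w1 w2) => //.
  + by rewrite /Mh /= mul0r.
  + by rewrite /Mh /= add0r mulr_ge0// sqr_ge0.
  + by right.
  rewrite Eq// /Mh /Mv /= !mul0r !add0r.
  by move: lt; rewrite ltr_pdivrMr// => lt; nra.
Qed.

End Cases.

Theorem theorem2p1 (R : realType) (c : field_case) (g mu : R) (rho : R -> R) (M : R)
  (xi1 xi2 : R) :
  0 < g -> 0 < mu ->
  (* rho in L^infty(R) *)
  measurable_fun setT rho -> (exists C : R, forall x, `|rho x| <= C) ->
  (* rho' in C_0^infty(R) *)
  smooth rho -> (exists K : R, forall x, K < `|x| -> derive1 rho x = 0) ->
  0 < inf (range rho) ->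
  (exists x30 : R, 0 < derive1 rho x30) ->
  M_hyp c g rho M ->
  Ag c g rho M xi1 xi2 ->
  exists (psi : R -> R) (lam : R),
    [/\ 0 < lam /\ nonzero psi, smooth psi,
     (forall k : nat, Hk k psi) /\ in_calA rho xi1 xi2 psi,
     (forall x : R,
        - lam ^+ 2 * (rho x * xinorm xi1 xi2 ^+ 2 * psi x
                      - derive1 (fun y => rho y * derive1 psi y) x)
        = lam * mu * (xinorm xi1 xi2 ^+ 4 * psi x
                      - 2 * xinorm xi1 xi2 ^+ 2 * derive1n 2 psi x
                      + derive1n 4 psi x)
          - g * xinorm xi1 xi2 ^+ 2 * derive1 rho x * psi x
          + mag_term c M xi1 xi2 psi x) &
     psi x @[x --> +oo%R] --> 0 /\ psi x @[x --> -oo%R] --> 0 /\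
     derive1 psi x @[x --> +oo%R] --> 0 /\ derive1 psi x @[x --> -oo%R] --> 0].
Proof.
move=> g0 mu0 mrho brho srho [K HK] inf0 hx0 hM hA.
have [C rhoC] := brho.
have cs : csupp (derive1 rho) by exists K.
have sb : smooth_bdd rho by exact: smooth_bdd_csupp_derive.
have rho_ge x : inf (range rho) <= rho x.
  apply: ge_inf; last by exists x.
  (* Boundedness of rho gives the range a lower bound, so that its infimum is a genuine one. *)
  by exists (- C) => _ [y _ <-]; have := rhoC y; rewrite ler_norml => /andP[].
have [a0 [u au Hu]] := @admissible_of_Ag R c g M xi1 xi2 rho g0 sb cs hx0 hM hA.
have Mh0 : 0 <= @Mh_of R c M xi1 by case: (c) => //=; rewrite mulr_ge0// sqr_ge0.
have Mv0 : 0 <= @Mv_of R c M by case: (c) => //=; exact: sqr_ge0.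
have [psi [l [[l0 nz] spsi [Lpsi norm1] eqn]]] :=
  normalized_eigenfunction a0 mu0 Mh0 Mv0 inf0 rho_ge sb cs au Hu.
exists psi, l; split=> //.
- split; first by move=> k; exact: Hk_smooth.
  split; first exact: Hk_smooth.
  exists (derive1 psi); split; first exact: (Lpsi 1%N).
  by split=> //; exact: (@weak_deriv_smooth R 1 psi).
- move=> x; rewrite eqn; congr (_ + _).
  by rewrite /mag_term /Mh_of /Mv_of; case: (c); rewrite mul0r ?addr0 ?add0r.
- have s1 := smooth_derive1 spsi; have s2 := smooth_derive1 s1.
  have [p1 p2] := L2_decay (smooth_isder spsi) (smooth_continuous s1) (Lpsi 0%N) (Lpsi 1%N).
  have [p3 p4] := L2_decay (smooth_isder s1) (smooth_continuous s2) (Lpsi 1%N) (Lpsi 2%N).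
  by split; [exact: p1|split; [exact: p2|split; [exact: p3|exact: p4]]].
Qed.
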